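(* A profinite group $G$ is prosolvable if and only if every closed two-generator subgroup of $G$ is prosolvable.
   Context: A closed two-generator subgroup is the closure of a subgroup generated by two elements (i.e. a closed subgroup topologically generated by two elements). A profinite group is prosolvable if it is an inverse limit of finite solvable groups (equivalently, all its quotients by open normal subgroups are solvable). *)

(* Defs.v *)
From HB Require Import structures.
From mathcomp Require Import all_boot all_order fingroup nilpotent.
From mathcomp Require Import all_classical topology.

Set Implicit Arguments.
Unset Strict Implicit.
Unset Printing Implicit Defensive.

Local Open Scope classical_set_scope.
Local Open Scope group_scope.

(* Topological groups; no separation axiom is imposed. *)
HB.mixin Record Group_isTopologicalGroup G & Topological G & monoid.Group G := {
  mulg_continuous : continuous (fun x : G * G => x.1 * x.2);
  invg_continuous : continuous (fun x : G => x^-1)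
}.

#[short(type="topGroupType")]
HB.structure Definition TopologicalGroup :=
  {G of Topological G & monoid.Group G & Group_isTopologicalGroup G}.

Definition topgroup_isog (G H : topGroupType) : Prop :=
  exists (f : G -> H) (g : H -> G),
    [/\ {morph f : x y / x * y}, cancel f g, cancel g f,
        continuous f & continuous g].

Section DiscreteTopologicalGroup.
Variable G : groupType.
Local Notation T := (discrete_topology G).

HB.instance Definition _ := monoid.Group.copy T G.

Let discrete_mulg_continuous : continuous (fun x : T * T => x.1 * x.2).
Proof.
move=> [x y] U Uxy; exists ([set x], [set y]).
  by split; exact: discrete_set1.
by move=> [a b] /= [-> ->]; exact: nbhs_singleton Uxy.
Qed.

Let discrete_invg_continuous : continuous (fun x : T => x^-1).
Proof.
move=> x U Ux; apply: (@filterS _ (nbhs x) _ [set x]).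
  by move=> a /= ->; exact: nbhs_singleton Ux.
exact: discrete_set1.
Qed.

HB.instance Definition _ := Group_isTopologicalGroup.Build T
  discrete_mulg_continuous discrete_invg_continuous.

End DiscreteTopologicalGroup.

Section ProductTopologicalGroup.
Variables (I : Type) (K : I -> topGroupType).
Local Notation T := (prod_topology K).

Definition prod_mul (x y : T) : T := fun i => x i * y i.
Definition prod_one : T := fun i => 1.
Definition prod_inv (x : T) : T := fun i => (x i)^-1.

Let prod_mulA : associative prod_mul.
Proof. by move=> x y z; apply: functional_extensionality_dep => i; exact: mulgA. Qed.

Let prod_mul1 : left_id prod_one prod_mul.
Proof. by move=> x; apply: functional_extensionality_dep => i; exact: mul1g. Qed.

Let prod_mulr1 : right_id prod_one prod_mul.
Proof. by move=> x; apply: functional_extensionality_dep => i; exact: mulg1. Qed.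

Let prod_mulV : left_inverse prod_one prod_inv prod_mul.
Proof. by move=> x; apply: functional_extensionality_dep => i; exact: mulVg. Qed.

Let prod_mulrV : right_inverse prod_one prod_inv prod_mul.
Proof. by move=> x; apply: functional_extensionality_dep => i; exact: mulgV. Qed.

HB.instance Definition _ := isGroup.Build T
  prod_mulA prod_mul1 prod_mulr1 prod_mulV prod_mulrV.

Lemma prod_mulgE (x y : T) i : (x * y) i = x i * y i. Proof. by []. Qed.
Lemma prod_invgE (x : T) i : (x^-1) i = (x i)^-1. Proof. by []. Qed.
Lemma prod_onegE i : (1 : T) i = 1. Proof. by []. Qed.

Let prod_evalP (i : I) : continuous (fun x : T => x i).
Proof.
move=> x U Ui; have /cvg_sup/(_ i) : nbhs x --> (x : T) by exact: cvg_id.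
apply; exact: (@initial_continuous _ _ (fun f : T => f i) x U Ui).
Qed.

Let prod_contP (X : topologicalType) (f : X -> T) :
  (forall i, continuous (fun x => f x i)) -> continuous f.
Proof.
move=> fc x; apply/cvg_sup => i U [_ [[V oV <-] /= Vx VU]].
have /fc : nbhs (f x i) V by exact: open_nbhs_nbhs.
by apply: (@filterS _ (nbhs x)) => y; exact: VU.
Qed.

Let prod_mulg_continuous : continuous (fun x : T * T => x.1 * x.2).
Proof.
apply: prod_contP => i x.
apply: (@continuous_comp _ _ _ (fun x : T * T => (x.1 i, x.2 i))
  (fun z : K i * K i => z.1 * z.2)); last exact: mulg_continuous.
apply: cvg_pair; apply: (@continuous_comp _ _ _ _ (fun x : T => x i)).
- exact: cvg_fst.
- exact: prod_evalP.
- exact: cvg_snd.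
- exact: prod_evalP.
Qed.

Let prod_invg_continuous : continuous (fun x : T => x^-1).
Proof.
apply: prod_contP => i x.
apply: (@continuous_comp _ _ _ (fun x : T => x i) (fun z : K i => z^-1)).
  exact: prod_evalP.
exact: invg_continuous.
Qed.

HB.instance Definition _ := Group_isTopologicalGroup.Build T
  prod_mulg_continuous prod_invg_continuous.

End ProductTopologicalGroup.

Record subgroup (G : groupType) := Subgroup {
  subgroup_set :> set G;
  subgroupP : group_closed (fun x : G => x \in subgroup_set)
}.

HB.instance Definition _ (T : choiceType) (A : set T) :=
  SubChoice.copy (set_type A) {x : T | x \in A}.

HB.instance Definition _ (G : groupType) (H : subgroup G) :=
  SubChoice_isSubGroup.Build G _ (set_type H) (subgroupP H).

Section SubTopologicalGroup.
Variables (G : topGroupType) (H : subgroup G).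
Local Notation T := (set_type H).

Let sub_valP : continuous (val : T -> G).
Proof. exact: initial_continuous. Qed.

Let sub_contP (X : topologicalType) (f : X -> T) :
  continuous (fun x => val (f x)) -> continuous f.
Proof.
move=> fc x U [_ [[V oV <-] /= Vx VU]].
have /fc : nbhs (val (f x)) V by exact: open_nbhs_nbhs.
by apply: (@filterS _ (nbhs x)) => y; exact: VU.
Qed.

Let sub_mulg_continuous : continuous (fun x : T * T => x.1 * x.2).
Proof.
apply: sub_contP => x.
apply: (@continuous_comp _ _ _ (fun x : T * T => (val x.1, val x.2))
  (fun z : G * G => z.1 * z.2)); last exact: mulg_continuous.
apply: cvg_pair; apply: (@continuous_comp _ _ _ _ (val : T -> G)).
- exact: cvg_fst.
- exact: sub_valP.
- exact: cvg_snd.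
- exact: sub_valP.
Qed.

Let sub_invg_continuous : continuous (fun x : T => x^-1).
Proof.
apply: sub_contP => x.
apply: (@continuous_comp _ _ _ (val : T -> G) (fun z : G => z^-1)).
  exact: sub_valP.
exact: invg_continuous.
Qed.

HB.instance Definition _ := Group_isTopologicalGroup.Build T
  sub_mulg_continuous sub_invg_continuous.

End SubTopologicalGroup.

Definition generated_subgroup (G : groupType) (A : set G) : set G :=
  smallest (fun B => group_closed (fun x : G => x \in B)) A.

(* Requiring equality with a closure makes H closed. *)
Definition closed_two_generator (G : topGroupType) (H : subgroup G) : Prop :=
  exists x y : G,
    subgroup_set H = closure (generated_subgroup [set x; y]).

Record inverse_system := InverseSystem {
  sys_disp : Order.disp_t;
  sys_index : porderType sys_disp;
  sys_nonempty : inhabited sys_index;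
  sys_directed : forall i j : sys_index, exists k, (i <= k)%O /\ (j <= k)%O;
  sys_group :> sys_index -> finGroupType;
  sys_map : forall i j, (i <= j)%O -> sys_group j -> sys_group i;
  sys_mapM : forall i j (ij : (i <= j)%O), {morph sys_map ij : x y / x * y};
  sys_map_id : forall i (ii : (i <= i)%O) x, sys_map ii x = x;
  sys_map_comp : forall i j k (ij : (i <= j)%O) (jk : (j <= k)%O) (ik : (i <= k)%O) x,
    sys_map ij (sys_map jk x) = sys_map ik x
}.

Section InverseLimit.
Variable S : inverse_system.

(* The finite groups carry the discrete topology, and the limit the topology
   induced by the product topology. *)
Definition threads : set (prod_topology (fun i => discrete_topology (S i))) :=
  [set x | forall i j (ij : (i <= j)%O), sys_map ij (x j) = x i].

Fact threads_group_closed : group_closed (fun x => x \in threads).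
Proof.
have map1 i j (ij : (i <= j)%O) : sys_map ij 1 = 1 :> S i.
  by apply: (mulgI (sys_map ij 1)); rewrite -sys_mapM !mulg1.
have mapV i j (ij : (i <= j)%O) (x : S j) :
    sys_map ij x^-1 = (sys_map ij x)^-1.
  by apply: (mulgI (sys_map ij x)); rewrite -sys_mapM !mulgV map1.
split; first by rewrite inE => i j ij; exact: map1.
move=> x y; rewrite !inE => xS yS i j ij.
have -> : (x / y) i = (x i : S i) * (y i : S i)^-1 by [].
by rewrite -(xS i j ij) -(yS i j ij) -mapV -sys_mapM.
Qed.

Definition inverse_limit : topGroupType :=
  set_type (Subgroup threads_group_closed).

End InverseLimit.

Definition profinite (G : topGroupType) : Prop :=
  exists S : inverse_system, topgroup_isog G (inverse_limit S).

Definition prosolvable (G : topGroupType) : Prop :=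
  exists S : inverse_system,
    (forall i, solvable [set: S i]%SET) /\ topgroup_isog G (inverse_limit S).

(* Main.v *)
(** A compatible family of projections onto finite groups turns the claim into
    Thompson's theorem that a finite group all of whose two-generator subgroups
    are solvable is itself solvable: two elements of the image Q of G in a finite
    group lift to x and y in G, the kernel of the closed subgroup generated by x
    and y acting on Q is open, so that the subgroup they generate in Q is a
    section of a finite solvable quotient.

    Thompson's theorem is proved directly, without the classification of minimal
    simple groups.  Let G be a minimal counterexample; G is simple and its proper
    subgroups are solvable.  If a Sylow p-subgroup P with p > 3 is not cyclic, let E
    be a normal subgroup of P elementary abelian of order p^2.  The subgroups
    theta(e) = O_p'(C(e)), e in E, generate a p'-group W, because a product of
    commuting elements of coprime orders generates both of them, and so
    two-generator subgroups can be used as if they had three generators.  From W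
    and the normalizer of a Glauberman-Solomon characteristic subgroup of P one
    builds a solvable subgroup M containing the normalizer of each of its
    nontrivial p-subgroups, and two-generator subgroups <x, x^g> force every g into
    M.  If all these Sylow subgroups are cyclic, take x of order the largest prime
    divisor p of |G| and N = N(<x>).  The index of N is a {2, 3}-number and G = A N B
    with A a 3-group and B a 2-group, both normalized by x.  This makes the relation
    u v^-1 is a p'-element transitive on elements of order p, from which N = C(x),
    and transfer into a Sylow p-subgroup contradicts simplicity.  Groups with no
    prime divisor above 3 are solvable by Burnside's p^a q^b theorem. *)

From mathcomp Require Import all_boot all_fingroup all_solvable.
From mathcomp Require Import ssralg zmodp finalg matrix mxalgebra mxrepresentation mxabelem.
From mathcomp Require Import integral_char.

Set Implicit Arguments.
Unset Strict Implicit.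
Unset Printing Implicit Defensive.

Import GroupScope.

(** * Coprime action *)

(** Solvability comes from two sources only: normalizers of nontrivial solvable subgroups, which are
    proper by simplicity, and pairs. An argument that wants three or four elements in one solvable
    group must therefore pack them into a pair. The bound p > 3 enters twice. Quadratic action is
    controlled by identities that have to be divided by 2 and by 3; and in the cyclic case a b-group
    V with b at most 3, of order at most b^2, with p dividing |V| - 1, cannot exist, as |V| - 1 is
    1, 2, 3 or 8. Nothing is known about Sylow subgroups for 2 and 3, but two primes are few enough:
    elements of order p that differ by a 3-element and then by a 2-element can be compared inside a
    pair, and G = A N B says that such double steps connect any two conjugates of <x>. The transfer
    of x is a product of conjugates of powers of x inside a cyclic group; N = C(x) makes it a plain
    power of x, with exponent prime to p. *)

Section Solvable.
Implicit Types (gT : finGroupType) (p : nat).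

(** Otherwise the image of [C] in [G / F] contains a nontrivial abelian normal subgroup of [G / F].
    Its preimage in [C] has derived subgroup in [F] and is centralized by [F], so it is a nilpotent
    normal subgroup of [G] outside [F]. *)
Lemma cent_sub_Fitting gT (G : {group gT}) :
  solvable G -> 'C_G('F(G)) \subset 'F(G).
Proof.
move=> solG; pose F := 'F(G)%G; pose C := 'C_G(F)%G.
have nsFG : F <| G := Fitting_normal G.
have nsCG : C <| G by rewrite /normal subsetIl /= normsI ?normG ?norms_cent ?normal_norm.
have nFC : C \subset 'N(F) by rewrite (subset_trans (subsetIl _ _)) ?normal_norm.
change (C \subset F); rewrite -quotient_sub1 //; apply/idPn; rewrite subG1 => ntCF.
have [L [sLC nsLG ntL abL]] := solvable_norm_abelem (quotient_sol _ (solvableS (subsetIl _ _)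
  solG)) (quotient_normal F nsCG) ntCF.
pose M := (C :&: coset F @*^-1 L)%G.
have nsMG : M <| G.
  have nsL' : coset F @*^-1 L <| G by rewrite -(quotientGK nsFG) cosetpre_normal.
  by rewrite /normal subIset ?(normal_sub nsCG) // normsI ?normal_norm.
have sMF : M^`(1) \subset F.
  apply: der1_min; first by rewrite subIset ?nFC.
  apply: (abelianS (B := L)); last by case/is_abelemP: abL => r _ /abelem_abelian.
  by rewrite -(cosetpreK L) quotientS // subsetIr.
have nilM : nilpotent M.
  apply/lcnP; exists 2; rewrite !lcnSn lcn1 -/(gval M); apply/commG1P.
  by rewrite centsC (subset_trans (subsetIl _ _)) // (subset_trans (subsetIr _ _)) // centS.
have sMF' := Fitting_max nsMG nilM.
case/negP: ntL; rewrite -subG1; apply/subsetP=> x Lx.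
have /morphimP[c Nc Cc defx] := subsetP sLC x Lx.
have Mc : c \in M by rewrite inE Cc mem_morphpre // -defx.
by rewrite defx inE /= coset_id // (subsetP sMF').
Qed.

Lemma coprime_cent_prod gT (A G : {group gT}) :
  A \subset 'N(G) -> coprime #|G| #|A| -> solvable G -> [~: G, A] * 'C_G(A) = G.
Proof.
move=> nGA coGA solG.
have sRG : [~: G, A] \subset G by rewrite commg_subl.
have nRG : G \subset 'N([~: G, A]) by rewrite commg_norml.
have nRA : A \subset 'N([~: G, A]) by rewrite commg_normr.
rewrite -quotientK ?subIset ?nRG // (coprime_quotient_cent sRG nRA coGA solG).
rewrite (setIidPl _) ?quotientGK //; first by rewrite /normal sRG.
by rewrite quotient_cents2r.
Qed.

Lemma stable_factor_cent gT (A G H : {group gT}) :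
  A \subset 'N(G) -> A \subset 'N(H) -> H <| G -> coprime #|G| #|A| -> solvable G ->
  [~: G, A] \subset H -> A \subset 'C(H) -> A \subset 'C(G).
Proof.
move=> nGA nHA nsHG coGA solG sRH cHA; have [sHG nHG] := andP nsHG.
have sHC : H \subset 'C_G(A) by rewrite subsetI sHG centsC.
rewrite centsC; suff <-: 'C_G(A) :=: G by rewrite subsetIr.
apply: (@quotient_inj _ H); rewrite ?inE.
- by rewrite /(_ <| _) sHC subIset ?nHG.
- exact: nsHG.
by rewrite /= coprime_quotient_cent // (setIidPl _) // quotient_cents2r.
Qed.

(** Induction through a minimal normal subgroup [K] of [A <*> G]. If [K = G], then [G] is an
    irreducible [A]-module, and a faithful one would make the abelian group [A] cyclic; hence some
    [a] in [A^#] centralizes all of [G]. *)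
Lemma coprime_abelian_gen_cent1 gT (A G : {group gT}) :
  abelian A -> ~~ cyclic A -> A \subset 'N(G) -> coprime #|G| #|A| -> solvable G ->
  <<\bigcup_(a in A^#) 'C_G[a]>> = G.
Proof.
have [n] := ubnP #|G|; elim: n gT A G => // n IHn gT A G /ltnSE-leGn abA ncA nGA coGA solG.
apply/eqP; rewrite eqEsubset gen_subG; apply/andP; split.
  by apply/bigcupsP=> a _; rewrite subsetIl.
have [->|ntG] := eqsVneq G 1; first by rewrite sub1G.
have nsGL : G <| A <*> G by rewrite /normal joing_subr join_subG nGA normG.
have [K minK sKG] : {K : {group gT} | minnormal K (A <*> G) & K \subset G}.
  by apply: mingroup_exists; rewrite ntG normal_norm.
have [/andP[ntK nKL] _] := mingroupP minK.
have [nKA nKG] : A \subset 'N(K) /\ G \subset 'N(K) by apply/andP; rewrite -join_subG.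
have [_ _ /is_abelemP[r r_pr abelK]] := minnormal_solvable minK sKG solG.
have [sGK|prK] := boolP (G \subset K); last first.
  have ltK : #|K| < #|G| by rewrite proper_card // properE sKG.
  set Z := <<_>>.
  have sKZ : K \subset Z.
    have <- : <<\bigcup_(a in A^#) 'C_K[a]>> = K.
      by apply: IHn; rewrite ?(leq_trans ltK) ?(coprimeSg sKG) ?(solvableS sKG).
    by apply/genS/bigcupsP=> a Aa; rewrite (bigcup_max a) // setSI.
  rewrite -(quotientSGK nKG sKZ).
  have coKA : coprime #|K| #|A| by rewrite (coprimeSg sKG).
  rewrite -[G / K](IHn _ (A / K)%G) ?quotient_abelian ?quotient_norms ?quotient_sol //.
  - rewrite gen_subG; apply/bigcupsP=> aK /setD1P[nt_aK /morphimP[a Na Aa def_a]].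
    have nta : a != 1 by apply: contraNneq nt_aK => a1; rewrite def_a a1 morph1.
    have -> : 'C_(G / K)[aK] = 'C_(G / K)(<[a]> / K).
      by rewrite quotient_cycle // cent_cycle def_a.
    rewrite -coprime_quotient_cent ?cycle_subG //; last first.
      by rewrite (coprimegS _ coGA) ?cycle_subG.
    rewrite quotientS // cent_cycle sub_gen // (bigcup_max a) // !inE nta Aa //.
  - by rewrite (leq_trans _ leGn) // ltn_quotient.
  - rewrite -(isog_cyclic (quotient_isog _ _)) // coprime_TIg //.
  - exact: coprime_morph.
have eqGK : K :=: G by apply/eqP; rewrite eqEsubset sKG.
have abG : abelian G by rewrite -eqGK (abelem_abelian abelK).
have minA : minnormal K A.
  apply/mingroupP; rewrite ntK nKA; split=> // H /andP[ntH nHA] sHK.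
  case/mingroupP: minK => _; apply=> //; rewrite ntH join_subG nHA.
  by rewrite (subset_trans _ (cent_sub _)) // (subset_trans abG) // centS // -eqGK.
pose rG := abelem_repr abelK ntK nKA.
have irrG : mx_irreducible rG by apply/abelem_mx_irrP.
have : ~~ mx_faithful rG.
  apply: contra ncA => ffG; have := mx_faithful_irr_center_cyclic ffG irrG.
  by rewrite (center_idP abA).
rewrite /mx_faithful rker_abelem => /subsetPn[a /setIP[Aa cKa]]; rewrite inE => nta.
by rewrite sub_gen // (bigcup_max a) ?inE ?nta // subsetI subxx /= -eqGK -cent_set1 centsC sub1set.
Qed.

(** Thompson's A x B lemma. By induction [Q] centralizes [[~: T, P]], proper in [T] by nilpotency of
    [T <*> P]; the three subgroup lemma then puts [[~: Q, T]] in ['C_T(P)], which [Q]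
    centralizes. *)
Lemma cent_pgroup_act gT p (P Q T : {group gT}) :
  p.-group P -> p^'.-group Q -> p.-group T -> P \subset 'N(T) -> Q \subset 'N(T) ->
  P \subset 'C(Q) -> Q \subset 'C('C_T(P)) -> Q \subset 'C(T).
Proof.
move=> pP p'Q; have [n] := ubnP #|T|.
elim: n T => // n IHn T /ltnSE-leTn pT nTP nTQ cPQ cQC.
have [->|ntT] := eqsVneq T 1; first by rewrite cent1T subsetT.
have sRT : [~: T, P] \subset T by rewrite commg_subl.
have prR : [~: T, P] \proper T.
  have nilPT : nilpotent (T <*> P).
    by apply: (@pgroup_nil _ p); rewrite /= norm_joinEr // pgroupM pT.
  rewrite properE sRT /=; apply: contra ntT => sTR.
  have /implyP := forallP nilPT T; apply.
  by rewrite subsetI joing_subl (subset_trans sTR) // commgS ?joing_subr.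
have nRQ : Q \subset 'N([~: T, P]).
  by rewrite normsR // (subset_trans _ (cent_sub _)) // centsC.
have cRQ : Q \subset 'C([~: T, P]).
  apply: IHn => //.
  - exact: leq_trans (proper_card prR) leTn.
  - exact: pgroupS pT.
  - exact: commg_normr.
  - by rewrite (subset_trans cQC) // centS // setSI.
have cTQP : [~: Q, T] \subset 'C_T(P).
  rewrite subsetI commg_subr nTQ /=; apply/commG1P; apply: three_subgroup.
    by apply/commG1P; rewrite centsC.
  by rewrite (commG1P cPQ) comm1G.
have coTQ : coprime #|T| #|Q| by rewrite (pnat_coprime pT).
have nilT := pgroup_nil pT; have solT := nilpotent_sol nilT.
have cRQ' : Q \subset 'C([~: T, Q]).
  by rewrite (subset_trans cQC) // centS // commGC.
apply: (stable_factor_cent (H := [~: T, Q]%G)) => //; first exact: commg_normr.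
by rewrite /normal commg_subl nTQ commg_norml.
Qed.

Lemma solvable_p_constrained gT p (X : {group gT}) :
  solvable X -> 'O_p^'(X) = 1 -> 'C_X('O_p(X)) \subset 'O_p(X).
Proof. by move=> solX p'X1; rewrite -(Fitting_eq_pcore p'X1) cent_sub_Fitting. Qed.

(** Modulo ['O_p^'(X)] the A x B lemma applies to [Y] and the image [K] of the core acting on [T]:
    [K] and the centralizer of [Y] in [T] normalize each other and have coprime orders. So [K]
    centralizes [T], which contains its own centralizer. *)
Lemma p'core_cent_pgroup gT p (X Y : {group gT}) :
  solvable X -> Y \subset X -> p.-group Y -> 'O_p^'('C_X(Y)) \subset 'O_p^'(X).
Proof.
move=> solX sYX pY; set H := 'O_p^'(X).
have nHX : X \subset 'N(H) by rewrite gFnorm.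
have sCX : 'C_X(Y) \subset X := subsetIl _ _.
have sKC : 'O_p^'('C_X(Y)) \subset 'C_X(Y) := pcore_sub _ _.
have nHK : 'O_p^'('C_X(Y)) \subset 'N(H) by rewrite (subset_trans sKC) // (subset_trans sCX).
rewrite -quotient_sub1 //; set K := _ / H.
have solXb : solvable (X / H) := quotient_sol _ solX.
have O1 : 'O_p^'(X / H) = 1 by rewrite trivg_pcore_quotient.
have defC : 'C_X(Y) / H = 'C_(X / H)(Y / H).
  apply: coprime_norm_quotient_cent; rewrite ?(subset_trans sYX) ?normG //.
    by rewrite coprime_sym (pnat_coprime pY) // [_.-nat _]pcore_pgroup.
  by rewrite (solvableS (pcore_sub _ _)).
have nsK : K <| 'C_(X / H)(Y / H) by rewrite -defC quotient_normal // pcore_normal.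
have p'K : p^'.-group K by rewrite quotient_pgroup ?pcore_pgroup.
have sKX : K \subset X / H by rewrite quotientS // (subset_trans sKC).
pose T := 'O_p(X / H)%G; have pT : p.-group T := pcore_pgroup _ _.
have nTX : X / H \subset 'N(T) by rewrite gFnorm.
have cKY : Y / H \subset 'C(K).
  by rewrite centsC (subset_trans (normal_sub nsK)) // subsetIr.
have cKT : K \subset 'C(T).
  apply: (cent_pgroup_act (P := (Y / H)%G) (p := p)); rewrite ?quotient_pgroup ?(subset_trans _
    nTX) ?quotientS ?pcore_pgroup ?(subset_trans sKC) //.
  apply/commG1P/trivgP.
  rewrite -(coprime_TIg (pnat_coprime pT p'K)) subsetI.
  rewrite (subset_trans (commgS _ (subsetIl _ _))) ?commg_subr ?(subset_trans sKX) //=.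
  by rewrite commg_subl (subset_trans _ (normal_norm nsK)) // setSI // pcore_sub.
rewrite -(coprime_TIg (pnat_coprime pT p'K)) subsetI subxx andbT.
by rewrite (subset_trans _ (solvable_p_constrained solXb O1)) // subsetI sKX.
Qed.

End Solvable.

(** * Quadratic pairs in characteristic p *)

Section QuadraticPair.
Local Open Scope ring_scope.
Import GRing.Theory.
Variables (A : nzRingType) (p : nat).
Hypothesis charAp : p \in [pchar A].

Let p_pr : prime p. Proof. by case/andP: charAp. Qed.

Lemma natr_cancel_pchar n (x : A) : coprime n p -> x *+ n = 0 -> x = 0.
Proof.
move=> co_np xn0; have n_gt0 : (0 < n)%N.
  by rewrite lt0n; apply: contraL co_np => /eqP->; rewrite /coprime gcd0n gtn_eqF ?prime_gt1.
have [u v def _] := egcdnP p n_gt0.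
have xp0 : x *+ p = 0 by rewrite -mulr_natr (pcharf0 charAp) mulr0.
have := congr1 (fun k => x *+ k) def; rewrite (eqP co_np) mulrnDr mulr1n.
by rewrite [(u * n)%N]mulnC [(v * p)%N]mulnC !mulrnA xn0 xp0 !mul0rn add0r.
Qed.

Lemma exprDn_pchar_comm k (x y : A) :
  GRing.comm x y -> (x + y) ^+ (p ^ k) = x ^+ (p ^ k) + y ^+ (p ^ k).
Proof.
move=> cxy; elim: k => [|k IHk]; first by rewrite expn0 !expr1.
rewrite expnSr !exprM IHk -!(pFrobenius_autE charAp) pFrobenius_autD_comm //.
by apply: commrX; apply/commr_sym/commrX/commr_sym.
Qed.

Lemma exprn_pchar_nat k n : n%:R ^+ (p ^ k) = n%:R :> A.
Proof.
elim: k => [|k IHk]; first by rewrite expn0 expr1.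
by rewrite expnSr exprM IHk -(pFrobenius_autE charAp) pFrobenius_aut_nat.
Qed.

Lemma expr1D_sqr0 n (a : A) : a * a = 0 -> (1 + a) ^+ n = 1 + a *+ n.
Proof.
move=> aa0; elim: n => [|n IHn]; first by rewrite expr0 addr0.
by rewrite exprS IHn mulrDl mul1r mulrDr mulr1 mulrnAr aa0 mul0rn addr0 mulrSr -addrA.
Qed.

Lemma subr_sqr_comm (s d : A) : GRing.comm s d -> (s - d) * (s + d) = s * s - d * d.
Proof. by move=> cd; rewrite mulrBl !mulrDr cd opprD addrA addrK. Qed.

Variables (gT : finGroupType) (X : {group gT}) (rho : gT -> A).
Hypothesis rho1 : rho 1%g = 1.
Hypothesis rhoM : {in X &, forall x y, rho (x * y)%g = rho x * rho y}.

Lemma rhoX n x : x \in X -> rho (x ^+ n)%g = rho x ^+ n.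
Proof.
move=> Xx; elim: n => [|n IHn]; first by rewrite expg0 expr0.
by rewrite expgS rhoM ?groupX // IHn exprS.
Qed.

Lemma rhoVl x : x \in X -> rho x^-1%g * rho x = 1.
Proof. by move=> Xx; rewrite -rhoM ?groupV // mulVg. Qed.
Lemma rhoVr x : x \in X -> rho x * rho x^-1%g = 1.
Proof. by move=> Xx; rewrite -rhoM ?groupV // mulgV. Qed.

Lemma rho_fix_group (N : A) : group_set [set x in X | N * rho x == N].
Proof.
apply/group_setP; split; first by rewrite inE group1 rho1 mulr1 /=.
move=> x y /[!inE] /andP[Xx /eqP Nx] /andP[Xy /eqP Ny].
by rewrite groupM // rhoM // mulrA Nx Ny eqxx.
Qed.

Lemma rho_comm_group (c : A) : group_set [set x in X | c * rho x == rho x * c].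
Proof.
apply/group_setP; split; first by rewrite inE group1 rho1 mulr1 mul1r /=.
move=> x y /[!inE] /andP[Xx /eqP Nx] /andP[Xy /eqP Ny].
by rewrite groupM // rhoM // mulrA Nx -mulrA Ny mulrA eqxx.
Qed.

Section Pair.
Variables (R : {group gT}) (y h : gT).
Hypotheses (sRX : R \subset X) (p'R : p^'.-group R) (Xy : y \in X) (py : p.-elt y).
Hypotheses (nRy : y \in 'N(R)) (Rh : h \in R).
Let y' := (y ^ h)%g.
Variables a b c : A.
Hypotheses (rhoya : rho y = 1 + a) (rhoyb : rho y' = 1 + b) (aa0 : a * a = 0).
Hypothesis defc : c = a * b + b * a.

Let Xh : h \in X. Proof. exact: subsetP Rh. Qed.
Let Xy' : y' \in X. Proof. by rewrite groupJ. Qed.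
(* The q-th power map kills the powers of y and fixes R pointwise. *)
Let q := (p ^ (totient #|R| * (logn p #[y]).+1))%N.
Let t := (y * y'^-1)%g.

Let bb0 : b * b = 0.
Proof.
have -> : b = rho h^-1%g * a * rho h.
  have -> : a = rho y - 1 by rewrite rhoya addrC addKr.
  rewrite mulrBr mulr1 mulrBl rhoVl // -!rhoM ?groupM ?groupV //.
  by rewrite -mulgA -/(conjg y h) rhoyb addrC addKr.
rewrite -!mulrA [rho h * (rho h^-1%g * _)]mulrA rhoVr // mul1r.
by rewrite [a * (a * _)]mulrA aa0 mul0r mulr0.
Qed.

Let cac : c * a = a * c.
Proof. by rewrite defc mulrDl mulrDr -!mulrA aa0 mulr0 addr0 !mulrA aa0 mul0r add0r. Qed.
Let cbc : c * b = b * c.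
Proof. by rewrite defc mulrDl mulrDr -!mulrA bb0 mulr0 add0r !mulrA bb0 mul0r addr0. Qed.

Let rhoyV : rho y^-1%g = 1 - a.
Proof.
have E : rho y * (1 - a) = 1 by rewrite rhoya mulrDl mul1r mulrBr mulr1 aa0 subr0 subrK.
by have := congr1 (fun z => rho y^-1%g * z) E; rewrite /= mulrA rhoVl // mul1r mulr1.
Qed.
Let rhoyV' : rho y'^-1%g = 1 - b.
Proof.
have E : rho y' * (1 - b) = 1 by rewrite rhoyb mulrDl mul1r mulrBr mulr1 bb0 subr0 subrK.
by have := congr1 (fun z => rho y'^-1%g * z) E; rewrite /= mulrA rhoVl // mul1r mulr1.
Qed.

Let Rt : t \in R.
Proof.
have -> : t = (h^-1 ^ (y^-1) * h)%g by rewrite /t /y' /conjg !invMg !invgK !mulgA.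
by rewrite groupM // memJ_norm ?groupV.
Qed.
Let Xt : t \in X. Proof. exact: subsetP Rt. Qed.

(** Expresses [c] through a sum of two commuting elements. The [q]-th power map is additive on such
    sums and fixes [t], which is how [c ^+ q = c] is obtained. *)
Let rho_t : rho t + rho t^-1%g = 2 - c.
Proof.
have -> : (t^-1 = y' * y^-1)%g by rewrite /t invMg invgK.
rewrite /t (rhoM Xy) ?(rhoM Xy') ?groupV // rhoyV rhoyV' rhoya rhoyb.
rewrite !mulrDl !mulrDr !mul1r !mulr1 !mulrN defc.
rewrite (AC ((2*2)*(2*2)) ((1*5)*(3*6)*(7*2)*(4*8))) /= !subrr !addr0 opprD.
by [].
Qed.

Let Xq z : z \in R -> (z ^+ q = z)%g.
Proof.
move=> Rz.
have q1 : q = 1 %[mod #|R|].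
  have coRp : coprime p #|R|.
    by rewrite coprime_sym (pnat_coprime (p'R : _.-nat _)) // pnatNK pnat_id.
  by rewrite /q expnM -modnXm Euler_exp_totient // modnXm exp1n.
rewrite -[RHS]expg1 -(expg_mod q (expg_order z)) -(expg_mod 1 (expg_order z)).
by congr (_ ^+ _)%g; rewrite -(modn_dvdm q (order_dvdG Rz)) q1 modn_dvdm ?order_dvdG.
Qed.

(** The successor in the exponent of [q] covers [y = 1]; the bound lets [c ^+ q] be rewritten with a
    factor [c * c]. *)
Let q_gt1 : (1 < q)%N.
Proof.
rewrite /q -[1%N](exp1n (totient #|R| * (logn p #[y]).+1)) ltn_exp2r ?prime_gt1 //.
by rewrite muln_gt0 totient_gt0 cardG_gt0.
Qed.

Let cq : c ^+ q = c.
Proof.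
set u := rho t + rho t^-1%g; have uq : u ^+ q = u.
  rewrite /u exprDn_pchar_comm -?rhoX ?groupV ?Xq ?groupV //.
  by rewrite /GRing.comm rhoVl ?rhoVr.
have defcu : c = 2 - u by rewrite /u rho_t opprB addrC subrK.
have cuc : GRing.comm u c.
  by rewrite defcu; apply: commrB => //; apply: commr_nat.
have := exprDn_pchar_comm (totient #|R| * (logn p #[y]).+1) cuc.
have euc : u + c = 2 by rewrite defcu addrC subrK.
rewrite -/q uq euc exprn_pchar_nat => E.
by rewrite -[c in RHS](addKr u) euc E addKr.
Qed.

Let commY : <<[set y; y']>> \subset [set x in X | c * rho x == rho x * c].
Proof.
rewrite -[[set x in X | _]]/(gval (Group (rho_comm_group c))) gen_subG.
apply/subsetP=> x /set2P[]->; rewrite inE ?Xy ?Xy' /= ?rhoya ?rhoyb mulrDl mulrDr mul1r mulr1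
  ?cac ?cbc //.
Qed.

Let RY := (R <*> <[y]>)%G.
Let nRRY : RY \subset 'N(R). Proof. by rewrite join_subG normG cycle_subG. Qed.
Let sYRY : <<[set y; y']>> \subset RY.
Proof.
have RYy : y \in RY by rewrite mem_gen // inE cycle_id orbT.
have RYh : h \in RY by rewrite mem_gen // inE Rh.
by rewrite gen_subG; apply/subsetP=> x /set2P[]->; rewrite ?groupJ.
Qed.

(** [<[y]>] is a Sylow subgroup of the pair, so [w] is conjugate there to an element of [<[y]>]. As
    [<[y]>] meets [R] trivially, this element is determined by its image modulo [R], which is that
    of [y ^+ i.+1]. *)
Lemma conj_constt i : let w := ((y * y' ^+ i)%g).`_p in
  exists2 r, r \in <<[set y; y']>> & w ^ r = (y ^+ i.+1)%g.
Proof.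
move=> w; set Y := (<<[set y; y']>>)%G.
have Yy : y \in Y by rewrite mem_gen ?set21.
have Yy' : y' \in Y by rewrite mem_gen ?set22.
have sylRY : p.-Sylow(RY) <[y]>.
  rewrite /pHall joing_subr /= [p.-group _]py /= -divgS ?joing_subr //=.
  rewrite norm_joinEr ?cycle_subG // coprime_cardMg; last by rewrite coprime_sym (pnat_coprime py).
  by rewrite mulnK ?cardG_gt0.
have sylY : p.-Sylow(Y) <[y]> by rewrite (pHall_subl _ sYRY) ?cycle_subG.
have Yw : w \in Y by rewrite /w groupX ?groupM ?groupX.
have [r Yr /subsetP/(_ (w ^ r))] : exists2 r, r \in Y & <[w]> :^ r \subset <[y]>.
  by apply: (Sylow_Jsub sylY); rewrite ?cycle_subG // [_.-group _]p_elt_constt.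
rewrite memJ_conjg cycle_id => /(_ isT) ywr; exists r => //.
have nR z : z \in Y -> z \in 'N(R) by move=> Yz; rewrite (subsetP nRRY) ?(subsetP sYRY).
have abq : abelian (RY / R).
  by rewrite quotientYidl ?cycle_subG // quotient_cycle ?cycle_abelian.
have Cq z1 z2 : z1 \in Y -> z2 \in Y -> coset R (z1 ^ z2) = coset R z1.
  move=> Y1 Y2; rewrite morphJ ?nR //; apply/conjg_fixP/commgP.
  by apply: (centsP abq); rewrite mem_quotient // (subsetP sYRY).
have eqc : coset R (w ^ r) = coset R (y ^+ i.+1).
  rewrite Cq // /w.
  have Yg : (y * y' ^+ i)%g \in Y by rewrite groupM ?groupX.
  rewrite -[coset R _]/(coset_morphism R _) morph_constt ?nR //= morphM ?nR ?groupX // !morphX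
    ?nR //.
  have -> : coset_morphism R y' = coset_morphism R y.
    have ch : coset_morphism R h = 1%g := coset_id Rh.
    have E := morphJ (coset_morphism R) (nR y Yy) (subsetP (normG R) h Rh).
    by rewrite ch conjg1 in E.
  by rewrite -expgS constt_p_elt // p_eltX // morph_p_elt.
have tiR : R :&: <[y]> = 1%g.
  by apply: coprime_TIg; rewrite coprime_sym (pnat_coprime py).
apply/eqP; rewrite eq_mulgV1; apply/eqP/set1gP; rewrite -tiR.
rewrite inE andbC groupM ?groupV ?mem_cycle //=.
apply: coset_idr; first by rewrite groupM ?groupV ?groupX ?nR ?groupJ.
by rewrite morphM ?groupV ?groupX ?nR ?groupJ // morphV ?groupX ?nR //= eqc mulgV.
Qed.

(* For g = y y'^i, the p-part w of g is conjugate to y^(i+1) and g^q is its p'-part,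
   while rho g + rho g^-1 = 2 + i c. *)
Lemma quad_pair_step i : (a * (c *+ i) * (c *+ i + 4)) *+ i.+1 = 0.
Proof.
have [r Yr defwr] := conj_constt i.
set g := (y * y' ^+ i)%g in defwr; set w := g.`_p in defwr; set k := g.`_p^'.
have sYX : <<[set y; y']>> \subset X.
  by rewrite gen_subG; apply/subsetP=> x /set2P[]->.
have Yg : g \in <<[set y; y']>> by rewrite groupM ?groupX ?mem_gen ?set21 ?set22.
have Xg := subsetP sYX g Yg; have Xr := subsetP sYX r Yr.
have Rk : k \in R.
  have nRg : g \in 'N(R) by rewrite (subsetP nRRY) ?(subsetP sYRY).
  apply: coset_idr; first by rewrite groupX.
  rewrite -[coset R _]/(coset_morphism R _) morph_constt //=.
  have : coset R g \in <[coset R y]>.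
    rewrite -quotient_cycle // -(quotientYidl (H := R)) ?cycle_subG // mem_quotient //.
    exact: subsetP Yg.
  move=> /cycleP[j ->]; apply: constt1P; rewrite p_eltNK p_eltX //.
  by rewrite (morph_p_elt (coset_morphism R)).
have Xk := subsetP sRX k Rk; have Xw : w \in X by rewrite groupX.
have cwk : commute w k by apply: commuteX2.
have defg : g = (w * k)%g by rewrite consttC.
have wq : (w ^+ q = 1)%g.
  have ow : #[w] %| #[y].
    by rewrite -(orderJ w r) defwr orderXdvd.
  apply/eqP; rewrite -order_dvdn (dvdn_trans ow) //.
  rewrite -(part_pnat_id (py : p.-nat _)) p_part dvdn_exp2l //.
  by rewrite (leq_trans (leqnSn _)) // leq_pmull // totient_gt0 cardG_gt0.
have kq : (k ^+ q = k)%g by apply: Xq.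
have gq : (g ^+ q = k)%g by rewrite defg expgMn // wq kq mul1g.
pose s := rho g + rho g^-1%g.
have defs : s = 2 + c *+ i.
  have aX n : rho (y' ^+ n)%g = 1 + b *+ n by rewrite rhoX // rhoyb expr1D_sqr0.
  have aXV n : rho ((y' ^+ n)^-1)%g = 1 - b *+ n.
    rewrite -expgVn rhoX ?groupV // rhoyV' expr1D_sqr0 ?mulNrn //.
    by rewrite mulrNN.
  rewrite /s /g invMg !rhoM ?groupV ?groupX // aX aXV rhoya rhoyV.
  rewrite defc mulrnDl -mulrnAr -mulrnAl.
  rewrite !mulrDl !mulrDr !mul1r !mulr1 !mulrN !mulNr opprK.
  rewrite (AC ((2*2)*(2*2)) ((1*5)*(3*6)*(2*7)*(4*8))) /= subrr ?subrr ?addNr !addr0.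
  by [].
have sq : s ^+ q = s.
  rewrite defs exprDn_pchar_comm; last exact/commr_sym/commr_nat.
  by rewrite exprn_pchar_nat -[c *+ i]mulr_natl exprMn_comm ?exprn_pchar_nat ?cq //;
    apply/commr_sym/commr_nat.
have eqs : s = rho k + rho k^-1%g.
  rewrite -sq {1}/s exprDn_pchar_comm; last by rewrite /GRing.comm rhoVl ?rhoVr.
  by rewrite -!rhoX ?groupV // -/q expgVn gq.
(* Multiplying [eqs] by [rho (w * k)] gives [N * rho (w * (k * k)) = N]. The stabilizer of [N] thus
   contains [w * (k * k)], its [q]-th power [k * k], then [w] and [g * g]; so [s * s] acts on [N] as
   4. *)
pose N := rho w - 1; pose St := Group (rho_fix_group N).
have Stwk2 : (w * (k * k))%g \in St.
  rewrite !inE ?groupM //=; apply/eqP; rewrite /N mulrBl mul1r -rhoM ?groupM //.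
  apply/eqP; rewrite subr_eq addrAC -subr_eq opprK eq_sym; apply/eqP.
  have e1 : rho g * rho (w * k)%g = rho (w * (w * (k * k)))%g.
    have -> : rho g = rho (w * k)%g by rewrite -defg.
    by rewrite -rhoM ?groupM // mulgA -[(w * k * w)%g]mulgA -cwk !mulgA.
  have e2 : rho g^-1%g * rho (w * k)%g = 1.
    have -> : rho (w * k)%g = rho g by rewrite -defg.
    exact: rhoVl.
  have e3 : rho k * rho (w * k)%g = rho (w * (k * k))%g.
    by rewrite -rhoM ?groupM // mulgA -cwk mulgA.
  have e4 : rho k^-1%g * rho (w * k)%g = rho w.
    by rewrite -rhoM ?groupM ?groupV // cwk mulKg.
  have E : (rho g + rho g^-1%g) * rho (w * k)%g = (rho k + rho k^-1%g) * rho (w * k)%g.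
    by rewrite -eqs.
  by rewrite !mulrDl e1 e2 e3 e4 in E; rewrite addrC -E.
have Stk2 : (k * k)%g \in St.
  have <- : ((w * (k * k)) ^+ q = k * k)%g.
    rewrite expgMn; last by apply: commuteM.
    by rewrite wq mul1g expgMn ?kq.
  exact: groupX.
have Stw : w \in St by rewrite -(groupMr _ Stk2).
have Stg2 : (g * g)%g \in St.
  by rewrite defg -mulgA [(k * (w * k))%g]mulgA -cwk -[(w * k * k)%g]mulgA groupM // groupM.
have Nfix z : z \in St -> N * rho z = N by rewrite !inE => /andP[_ /eqP].
have Ns : N * (s * s) = N *+ 4.
  have -> : s * s = rho (g * g)%g + 1 + (1 + rho (g * g)^-1%g).
    rewrite -[s]/(rho g + rho g^-1%g) mulrDl !mulrDr rhoVr // rhoVl //.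
    by rewrite (invMg g g) (rhoM Xg Xg) (rhoM (groupVr Xg) (groupVr Xg)).
  rewrite mulrDr [N * (rho _ + 1)]mulrDr [N * (1 + _)]mulrDr Nfix // Nfix ?groupV // mulr1.
  by rewrite !mulrS mulr0n addr0 !addrA.
have Nc : N * ((c *+ i) * (c *+ i + 4)) = 0.
  have -> : c *+ i = s - 2 by rewrite defs addrC addKr.
  have -> : s - 2 + 4 = s + 2 by rewrite -addrA; congr (_ + _); rewrite -[4]/(2 + 2)%:R natrD addKr.
  rewrite subr_sqr_comm; last exact: commr_nat.
  by rewrite -natrM mulrBr Ns mulr_natr subrr.
have cr : c * rho r = rho r * c by have /(subsetP commY) := Yr; rewrite inE => /andP[_ /eqP].
set d := _ * (_ + 4) in Nc; have dr : GRing.comm (rho r) d.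
  have cir : GRing.comm (rho r) (c *+ i) by apply: commrMn.
  by apply: commrM => //; apply: commrD => //; apply: commr_nat.
have defN : rho r * (a *+ i.+1) = N * rho r.
  have -> : a *+ i.+1 = rho (y ^+ i.+1)%g - 1 by rewrite rhoX // rhoya expr1D_sqr0 // addrC addKr.
  rewrite -defwr /N mulrBr mulrBl mulr1 mul1r -!rhoM ?groupJ // /conjg mulKVg //.
rewrite -mulrA -mulrnAl.
have -> : a *+ i.+1 = rho r^-1%g * (N * rho r) by rewrite -defN mulrA rhoVl // mul1r.
by rewrite -2!mulrA dr [N * _]mulrA Nc mul0r mulr0.
Qed.

Hypothesis p_gt3 : (3 < p)%N.

Let cancelp n (x : A) : (0 < n < p)%N -> x *+ n = 0 -> x = 0.
Proof.
move=> /andP[n0 ltnp]; apply: natr_cancel_pchar.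
by rewrite coprime_sym prime_coprime // gtnNdvd.
Qed.

(** The case [i = 1] gives [a c (c + 4) = 0] after division by 2, and [i = 2] gives
    [a c (c + 2) = 0] after division by 3 and twice by 2; the difference is [2 a c]. *)
Lemma quad_pair_ac0 : a * c = 0.
Proof.
have := quad_pair_step 1; rewrite mulr1n => /cancelp.
rewrite (ltn_trans _ p_gt3) // => /(_ isT) E1.
have := quad_pair_step 2 => /cancelp; rewrite p_gt3 => /(_ isT).
have -> : 4 = 2 *+ 2 :> A by rewrite -mulrnA.
rewrite -mulrnDl !mulrnAr !mulrnAl.
do 2![move/cancelp; rewrite (ltn_trans _ p_gt3) // => /(_ isT)] => E2.
apply: (@cancelp 2); first by rewrite (ltn_trans _ p_gt3).
have : a * c * (c + 4) - a * c * (c + 2) = 0 by rewrite E1 E2 subr0.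
by rewrite -mulrBr opprD addrACA subrr add0r -natrB // mulr_natr.
Qed.

(** [c] is nilpotent and fixed by the [q]-th power map, hence 0, and then [e = rho t - 1] has square
    0. The [q]-th power map sends [rho t = 1 + e] to 1, and it fixes [rho t]. *)
Lemma quad_pair_trivial : b * c = 0 -> rho (y * (y ^ h)^-1)%g = 1.
Proof.
move=> bc0; have cc0 : c * c = 0.
  by rewrite {1}defc mulrDl -!mulrA bc0 quad_pair_ac0 !mulr0 addr0.
have c0 : c = 0.
  by rewrite -cq -(subnK q_gt1) exprD expr2 cc0 mulr0.
change (rho t = 1); set e := rho t - 1.
have ee0 : e * e = 0.
  have e1 : rho t^-1%g = 2 - rho t.
    by move: rho_t; rewrite c0 subr0 => <-; rewrite addrAC subrr add0r.
  have := rhoVr Xt; rewrite e1 mulrBr mulr_natr => /eqP; rewrite subr_eq => /eqP E.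
  by rewrite /e mulrBr mulrBl mulr1 mul1r opprB addrACA [_ + 1]addrC -E -opprD -mulr2n subrr.
have := Xq Rt => tq; rewrite -tq rhoX //.
have -> : rho t = 1 + e by rewrite addrC subrK.
rewrite exprDn_pchar_comm; last by apply: commr_sym; apply: commr1.
by rewrite -/q -(subnK q_gt1) [e ^+ _]exprD [e ^+ 2]expr2 ee0 mulr0 addr0 expr1n.
Qed.

End Pair.

Lemma quadratic_p'_comm (R : {group gT}) (y h : gT) :
    (3 < p)%N -> R \subset X -> p^'.-group R -> y \in X -> p.-elt y -> y \in 'N(R) -> h \in R ->
  (rho y - 1) * (rho y - 1) = 0 -> rho (y * (y ^ h)^-1)%g = 1.
Proof.
move=> p_gt3 sRX p'R Xy py nRy Rh aa0.
have def z : rho z = 1 + (rho z - 1) by rewrite addrC subrK.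
apply: (quad_pair_trivial sRX p'R Xy py nRy Rh (def _) (def _) aa0 erefl p_gt3).
have Xh := subsetP sRX h Rh.
have bb0 : (rho (y ^ h)%g - 1) * (rho (y ^ h)%g - 1) = 0.
  have -> : rho (y ^ h)%g - 1 = rho h^-1%g * (rho y - 1) * rho h.
    rewrite mulrBr mulr1 mulrBl rhoVl // -!rhoM ?groupM ?groupV //.
    by rewrite -mulgA.
  rewrite -!mulrA [rho h * (rho h^-1%g * _)]mulrA rhoVr // mul1r.
  by rewrite [(rho y - 1) * ((rho y - 1) * _)]mulrA aa0 mul0r mulr0.
(* The pair [y ^ h], [h^-1] exchanges the roles of [a] and [b] and has the same [c]. *)
apply: (@quad_pair_ac0 R (y ^ h)%g h^-1%g) => //; rewrite ?groupJ ?groupV ?p_eltJ //.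
- by rewrite (subsetP (normG R)).
by rewrite conjgK addrC.
Qed.

End QuadraticPair.

(** * Quadratic action on normal p-subgroups *)

Section Stability.
Implicit Types (gT : finGroupType) (p : nat).

Lemma pgroup_elts gT (pi : nat_pred) (G : {group gT}) :
  {in G, forall x, pi.-elt x} -> pi.-group G.
Proof.
move=> piG; apply/pgroupP=> q q_pr /(Cauchy q_pr)[x Gx ox].
by have := piG x Gx; rewrite /p_elt ox pnatE.
Qed.

Lemma pi'_elt_pgroup1 gT (pi : nat_pred) (G : {group gT}) x :
  pi.-group G -> pi^'.-elt x -> x \in G -> x = 1.
Proof. by move=> piG pi'x Gx; rewrite -(constt_p_elt (mem_p_elt piG Gx)); apply/constt1P. Qed.

(** [X / K] acts faithfully and irreducibly, so ['O_p(X / K)] is trivial and its Fitting subgroup is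
    a [p']-group. The image of [y] centralizes it by [quadratic_p'_comm], hence lies in it, hence is
    trivial. *)
Lemma quadratic_irr_cent gT p (X U : {group gT}) y :
    solvable X -> (3 < p)%N -> minnormal U X -> p.-abelem U -> y \in X -> p.-elt y ->
  {in U, forall a, [~ a, y, y] = 1} -> y \in 'C(U).
Proof.
move=> solX p_gt3 minU abelU Xy py quad.
have [/andP[ntU nUX] _] := mingroupP minU.
have [p_pr _ _] := pgroup_pdiv (abelem_pgroup abelU) ntU.
have charFp : p \in [pchar 'F_p]%R by apply: pchar_Fp.
pose rG := abelem_repr abelU ntU nUX.
have irrG : mx_irreducible rG by apply/abelem_mx_irrP.
pose K := rker rG; pose rX := kquo_repr rG.
have irrX : mx_irreducible rX by apply/quo_mx_irr.
have ffX : mx_faithful rX := kquo_mx_faithful rG.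
have O1 : 'O_p(X / K) = 1 := pcore_faithful_mx_irr_pchar charFp irrX ffX.
have solXK : solvable (X / K) := quotient_sol _ solX.
pose F := 'F(X / K)%G.
have p'F : p^'.-group F.
  have /dprodP[_ /= <- _ _] := nilpotent_pcoreC p (Fitting_nil (X / K)).
  by rewrite p_core_Fitting O1 mul1g pcore_pgroup.
have Ny : y \in 'N(K) by rewrite (subsetP (rker_norm rG)).
have XKy : coset K y \in X / K by rewrite mem_quotient.
have aa0 : ((rX (coset K y) - 1) * (rX (coset K y) - 1) = 0)%R.
  rewrite /rX kquo_repr_coset //.
  have rVc v : rVabelem abelU ntU (v *m (rG y - 1%:M))%R = [~ rVabelem abelU ntU v, y].
    by rewrite mulmxBr mulmx1 GRing.addrC rVabelemD rVabelemN rVabelemJ.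
  apply/row_matrixP=> i; rewrite !rowE mulmx0 -[(_ * _)%R]/(_ *m _)%R mulmxA.
  apply: (@rVabelem_inj _ _ _ abelU ntU); rewrite !rVc rVabelem0.
  by rewrite quad // mem_rVabelem.
have cFy : coset K y \in 'C(F).
  apply/centP=> h Fh; apply/commgP/conjg_fixP.
  have charM : p \in [pchar 'M['F_p]_('dim U)]%R by rewrite GRing.pchar_lalg.
  have sFX : F \subset X / K := Fitting_sub _.
  have := @quadratic_p'_comm _ p charM _ (X / K)%G rX (repr_mx1 rX) (repr_mxM rX) F (coset K y) h
    p_gt3 sFX p'F XKy.
  rewrite (subsetP (gFnorm _ _)) // Fh (morph_p_elt (coset_morphism K)) // => /(_ isT isT isT
    aa0) E.
  have Xh := subsetP sFX h Fh.
  apply/esym/eqP; rewrite eq_mulgV1 -in_set1; apply: (subsetP ffX).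
  by apply/rkerP; split; [rewrite groupM ?groupV ?groupJ | exact: E].
have Fy : coset K y \in F.
  by apply: (subsetP (cent_sub_Fitting solXK)); rewrite inE XKy.
have : coset K y = 1 by apply: (pi'_elt_pgroup1 p'F) => //; rewrite p_eltNK (morph_p_elt
  (coset_morphism K)).
move/(coset_idr Ny) => Ky.
have : y \in rker (abelem_repr abelU ntU nUX) := Ky.
by rewrite rker_abelem => /setIP[].
Qed.

(** This places [y] in ['O_p] of [X / 'C_X(Q)]. The induction peels off a minimal normal subgroup
    [U], which [y] centralizes; a [p']-element trivial on [U] and on [Q / U] is trivial on [Q]. *)
Lemma quadratic_normal_cent gT p (X Q : {group gT}) y :
    solvable X -> (3 < p)%N -> Q <| X -> p.-group Q -> y \in X -> p.-elt y ->
    {in Q, forall a, [~ a, y, y] = 1} ->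
  exists D : {group gT}, [/\ D <| X, y \in D & {in D, forall d, p^'.-elt d -> d \in 'C(Q)}].
Proof.
have [n] := ubnP #|Q|; elim: n gT X Q y => // n IHn gT X Q y /ltnSE-leQn solX p_gt3 nsQX pQ Xy py
  quad.
have [Q1|ntQ] := eqsVneq Q 1.
  by exists X; split=> // d _ _; rewrite Q1 cent1T inE.
have [sQX nQX] := andP nsQX.
have [U minU sUQ] : {U : {group gT} | minnormal U X & U \subset Q}.
  by apply: mingroup_exists; rewrite ntQ.
have [/andP[ntU nUX] _] := mingroupP minU.
have sUX := subset_trans sUQ sQX.
have [_ _] := minnormal_solvable minU sUX solX; rewrite (is_abelem_pgroup (pgroupS sUQ pQ)) =>
  abelU.
have cUy : y \in 'C(U).
  by apply: (quadratic_irr_cent solX) abelU Xy py _ => // a Ua; rewrite quad ?(subsetP sUQ).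
have nUy : y \in 'N(U) := subsetP nUX y Xy.
have [] := IHn _ (X / U)%G (Q / U)%G (coset U y).
- by rewrite (leq_trans _ leQn) // ltn_quotient.
- exact: quotient_sol.
- by [].
- exact: quotient_normal.
- exact: quotient_pgroup.
- exact: mem_quotient.
- exact: morph_p_elt.
- move=> _ /morphimP[a Na Qa ->] /=.
  by rewrite -!morphR ?groupR //= quad // morph1.
move=> D [nsD Dy cD].
have nsUX : U <| X by rewrite /normal sUX.
exists (coset U @*^-1 D :&: 'C_X(U))%G; split.
- have nsD' : coset U @*^-1 D <| X by rewrite -(quotientGK nsUX) cosetpre_normal.
  have nsC : 'C_X(U) <| X by rewrite /normal subsetIl normsI ?normG ?norms_cent.
  by rewrite /normal subIset ?(normal_sub nsD') // normsI ?normal_norm.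
- by rewrite inE mem_morphpre // inE Xy.
move=> d /setIP[/morphpreP[Nd Dd] /setIP[Xd cUd]] p'd.
rewrite -cycle_subG; apply: (stable_factor_cent (H := U)); rewrite ?cycle_subG //.
- by rewrite (subsetP nQX).
- by rewrite /normal sUQ (subset_trans sQX).
- by rewrite (pnat_coprime pQ).
- exact: pgroup_sol pQ.
rewrite -quotient_cents2 ?cycle_subG ?(subset_trans sQX) // centsC quotient_cycle // cycle_subG.
by rewrite cD // (morph_p_elt (coset_morphism U)).
Qed.

Lemma pseries_p'pE gT p (X : {group gT}) :
  'O_{p^', p}(X) = coset 'O_p^'(X) @*^-1 'O_p(X / 'O_p^'(X)).
Proof. by rewrite -(pseries1 p^') -[[:: _; _]]/(rcons [:: _] _) pseries_rcons. Qed.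

(** Modulo ['O_p^'(X)], the [p']-elements of the normal subgroup [D] centralize ['O_p], which
    contains its own centralizer; so they are trivial and [D] is a [p]-group. *)
Lemma quadratic_Sylow_p'p gT p (X S : {group gT}) u :
    solvable X -> (3 < p)%N -> p.-Sylow(X) S -> u \in S ->
    {in S, forall s, [~ s, u, u] = 1} -> u \in 'O_{p^', p}(X).
Proof.
move=> solX p_gt3 sylS Su quad; have [sSX pS _] := and3P sylS.
have Xu := subsetP sSX u Su; set H := 'O_p^'(X)%G.
have nHX : X \subset 'N(H) := gFnorm _ _.
have Nu : u \in 'N(H) := subsetP nHX u Xu.
rewrite pseries_p'pE mem_morphpre //.
have O1 : 'O_p^'(X / H) = 1 := trivg_pcore_quotient _ _.
have solXb : solvable (X / H) := quotient_sol _ solX.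
have [] := @quadratic_normal_cent _ p (X / H)%G 'O_p(X / H)%G (coset H u) solXb p_gt3.
- exact: pcore_normal.
- exact: pcore_pgroup.
- exact: mem_quotient.
- exact/morph_p_elt/(mem_p_elt pS).
- have sylSb : p.-Sylow(X / H) (S / H) by rewrite quotient_pHall ?(subset_trans sSX).
  move=> a /(subsetP (pcore_sub_Hall sylSb))/morphimP[s Ns Ss ->].
  by rewrite /= -!morphR ?groupR //= quad // morph1.
move=> D [nsD Du cD]; apply: (subsetP (pcore_max _ nsD)) Du.
apply: pgroup_elts => d Dd.
suff d1 : d.`_p^' = 1 by rewrite -(consttC p d) d1 mulg1 p_elt_constt.
have Dd' : d.`_p^' \in D by rewrite groupX.
apply: (pi'_elt_pgroup1 (pcore_pgroup p (X / H))); rewrite ?p_elt_constt //.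
apply: (subsetP (solvable_p_constrained solXb O1)).
by rewrite inE (subsetP (normal_sub nsD)) // cD ?p_elt_constt.
Qed.

End Stability.

(** * The Glauberman-Solomon subgroup *)

Section Dstar.

Definition quad_closed (gT : finGroupType) (S A : {group gT}) : bool :=
  [&& A <| S, abelian A &
      [forall (y | y \in S), [forall (a | a \in A), [~ a, y, y] == 1] ==> (y \in 'C(A))]].

Lemma quad_closedP (gT : finGroupType) (S A : {group gT}) :
  reflect [/\ A <| S, abelian A &
    {in S, forall y, {in A, forall a, [~ a, y, y] = 1} -> y \in 'C(A)}] (quad_closed S A).
Proof.
apply: (iffP and3P) => -[nsA abA H]; split=> //.
  move=> y Sy q; apply: (implyP (forall_inP H y Sy)).
  by apply/forall_inP=> a Aa; apply/eqP/q.
apply/forall_inP=> y Sy; apply/implyP=> /forall_inP q; apply: H => // a Aa.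
exact/eqP/q.
Qed.

Definition Dstar (gT : finGroupType) (S : {group gT}) : {set gT} :=
  <<\bigcup_(A : {group gT} | quad_closed S A) A>>.

Canonical Dstar_group (gT : finGroupType) (S : {group gT}) :=
  [group of @Dstar gT S].

(** An element [b] of [B] is quadratic on [A], because [[~ a, b]] lies in the abelian group [B];
    hence [A] and [B] commute. This closure under joins makes [Dstar S] the largest group of its
    kind. *)
Lemma quad_closedM (gT : finGroupType) (S A B : {group gT}) :
  quad_closed S A -> quad_closed S B -> quad_closed S (A <*> B)%G.
Proof.
move=> /quad_closedP[nsA abA qA] /quad_closedP[nsB abB qB].
have [sAS nAS] := andP nsA; have [sBS nBS] := andP nsB.
have cAB : B \subset 'C(A).
  apply/subsetP=> b Bb; apply: qA => [|a Aa]; first exact: subsetP Bb.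
  apply/eqP/commgP; apply: (centsP abB); rewrite // commgEr groupM // memJ_norm ?groupV //.
  by rewrite (subsetP nBS) // (subsetP sAS).
apply/quad_closedP; split; first exact: normalY.
  by rewrite abelianY abA abB cAB.
move=> y Sy q; rewrite centY inE qA ?qB // => a Aa; apply: q;
  by rewrite mem_gen // inE Aa ?orbT.
Qed.

Lemma quad_closed1 (gT : finGroupType) (S : {group gT}) : quad_closed S 1%G.
Proof.
apply/quad_closedP; split; rewrite ?normal1 ?abelian1 // => y Sy _.
by rewrite cent1T inE.
Qed.

Lemma Dstar_quad_closed (gT : finGroupType) (S : {group gT}) : quad_closed S (Dstar_group S).
Proof.
have [A maxA _] := @maxgroup_exists _ (quad_closed S) 1%G (quad_closed1 S).
have [qA maxA'] := maxgroupP maxA.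
suff -> : Dstar_group S = A by [].
apply/eqP; rewrite -val_eqE eqEsubset /= gen_subG; apply/andP; split.
  apply/bigcupsP=> B qB; rewrite -(maxA' _ (quad_closedM qA qB)) ?joing_subr ?joing_subl //.
by rewrite sub_gen // (bigcup_max A).
Qed.

Lemma sub_Dstar (gT : finGroupType) (S A : {group gT}) : quad_closed S A -> A \subset Dstar S.
Proof. by move=> qA; rewrite sub_gen // (bigcup_max A). Qed.

Lemma Dstar_normal (gT : finGroupType) (S : {group gT}) : Dstar S <| S.
Proof. by have /quad_closedP[] := Dstar_quad_closed S. Qed.

Lemma center_sub_Dstar (gT : finGroupType) (S : {group gT}) : 'Z(S) \subset Dstar S.
Proof.
apply: (sub_Dstar (A := 'Z(S)%G)); apply/quad_closedP; split; rewrite ?center_normal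
  ?center_abelian //.
by move=> y Sy _; rewrite (subsetP _ y Sy) // centsC subsetIr.
Qed.

Lemma injm_quad_closed (gT rT : finGroupType) (D : {group gT}) (f : {morphism D >-> rT})
    (S A : {group gT}) :
  'injm f -> S \subset D -> quad_closed S A -> quad_closed (f @* S)%G (f @* A)%G.
Proof.
move=> injf sSD /quad_closedP[nsA abA qA].
have sAD := subset_trans (normal_sub nsA) sSD.
apply/quad_closedP; split; rewrite ?morphim_normal ?morphim_abelian //.
move=> _ /morphimP[y Dy Sy ->] q.
have cAy : y \in 'C(A).
  apply: qA => // a Aa; have Da := subsetP sAD a Aa.
  apply: (injmP injf); rewrite ?groupR // morph1 !morphR ?groupR //.
  by apply: q; apply: mem_morphim.
by rewrite (subsetP (morphim_cent _ _)) // mem_morphim.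
Qed.

Lemma injm_Dstar (gT rT : finGroupType) (D : {group gT}) (f : {morphism D >-> rT})
    (S : {group gT}) :
  'injm f -> S \subset D -> Dstar (f @* S)%G = f @* Dstar S.
Proof.
move=> injf sSD; apply/eqP; rewrite eqEsubset gen_subG; apply/andP; split; last first.
  exact: (sub_Dstar (A := (f @* Dstar_group S)%G)) (injm_quad_closed injf sSD (Dstar_quad_closed
    S)).
apply/bigcupsP=> B qB; have /quad_closedP[/normal_sub sB _ _] := qB.
have sfS : f @* S \subset f @* D := morphimS f sSD.
have := injm_quad_closed (injm_invm injf) sfS qB.
have -> : (invm injf @* (f @* S))%G = S by apply/val_inj; rewrite /= morphim_invm.
move/sub_Dstar => sAD; have <- : f @* (invm injf @* B) = B.
  by rewrite morphim_invmE morphpreK // (subset_trans sB).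
exact: morphimS.
Qed.

Lemma DstarJ (gT : finGroupType) (S : {group gT}) x : Dstar (S :^ x)%G = Dstar S :^ x.
Proof.
have -> : (S :^ x)%G = (conjgm S x @* S)%G by apply/val_inj; rewrite /= morphim_conj setIid.
by rewrite injm_Dstar ?injm_conj // morphim_conj (setIidPr (normal_sub (Dstar_normal S))).
Qed.

Lemma norm_Dstar (gT : finGroupType) (S : {group gT}) : 'N(S) \subset 'N(Dstar S).
Proof.
apply/subsetP=> n /normP nSn; apply/normP; rewrite -DstarJ.
by congr (Dstar _); apply/val_inj.
Qed.

Lemma quad_closedJ (gT : finGroupType) (S A : {group gT}) x :
  quad_closed S A -> quad_closed (S :^ x)%G (A :^ x)%G.
Proof.
move=> qA; have /quad_closedP[/normal_sub sAS _ _] := qA.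
have -> : (S :^ x)%G = (conjgm S x @* S)%G by apply/val_inj; rewrite /= morphim_conj setIid.
have -> : (A :^ x)%G = (conjgm S x @* A)%G by apply/val_inj; rewrite /= morphim_conj (setIidPr sAS).
by apply: injm_quad_closed; rewrite ?injm_conj.
Qed.

(** A counterpart of Glauberman's ZJ theorem. The normal closure [N] of [Dstar S] in [X] is shown to
    be abelian and quadratically closed in [S], so it is contained in [Dstar S]. *)
Lemma Dstar_normal_p'core1 (gT : finGroupType) p (X S : {group gT}) :
    solvable X -> (3 < p)%N -> p.-Sylow(X) S -> 'O_p^'(X) = 1 -> Dstar S <| X.
Proof.
move=> solX p_gt3 sylS O1; pose A := Dstar_group S.
have [sSX pS _] := and3P sylS.
have qA := Dstar_quad_closed S; have /quad_closedP[nsAS abA cA] := qA.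
have [sAS nAS] := andP nsAS; pose T := 'O_p(X)%G.
have sTS : T \subset S := pcore_sub_Hall sylS.
have nsTX : T <| X := pcore_normal _ _.
have sAT : A \subset T.
  apply/subsetP=> u Au; have Su := subsetP sAS u Au.
  have : u \in 'O_{p^', p}(X).
    apply: (quadratic_Sylow_p'p solX p_gt3 sylS Su) => s Ss.
    apply/eqP/commgP; apply: (centsP abA) => //; rewrite commgEr groupM // memJ_norm ?groupV //.
    exact: subsetP Ss.
  by rewrite pseries_pop2.
have sATg g : g \in X -> A :^ g \subset T.
  by move=> Xg; rewrite -(normsP (normal_norm nsTX) g Xg) conjSg.
(* [A] lies in [T], hence normalizes [A :^ g]; as [A :^ g] is abelian, it acts quadratically on
   [A]. *)
have cAA g : g \in X -> A :^ g \subset 'C(A).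
  move=> Xg; apply/subsetP=> y Agy; have Ty := subsetP (sATg g Xg) y Agy.
  apply: cA => [|a Aa]; first exact: subsetP Ty.
  have abAg : abelian (A :^ g) by rewrite abelianJ.
  apply/eqP/commgP; apply: (centsP abAg) => //; rewrite commgEr groupM // memJ_norm ?groupV //.
  rewrite (subsetP _ a Aa) // normJ (subset_trans sAT) //.
  by rewrite -(normsP (normal_norm nsTX) g Xg) conjSg (subset_trans sTS).
pose N := <<class_support A X>>%G.
have sAgN g : g \in X -> A :^ g \subset N.
  by move=> Xg; rewrite sub_gen // class_supportEr (bigcup_max g).
have sAN : A \subset N by rewrite -[gval A]conjsg1 sAgN.
have sNT : N \subset T.
  by rewrite gen_subG class_supportEr; apply/bigcupsP=> g Xg; apply: sATg.
have nsNX : N <| X.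
  rewrite /normal (subset_trans sNT) ?(normal_sub nsTX) //=.
  by apply: norms_gen; apply: class_support_norm.
have pN : p.-group N := pgroupS sNT (pcore_pgroup p X).
have abN : abelian N.
  rewrite abelian_gen; apply/centsP => x; rewrite class_supportEr => /bigcupP[g Xg Agx] y
    /bigcupP[h Xh Ahy].
  have : A :^ (h * g^-1) \subset 'C(A) by rewrite cAA ?groupM ?groupV.
  rewrite -(conjSg _ _ g) -conjsgM mulgKV -centJ => /subsetP/(_ y Ahy)/centP/(_ x Agx).
  exact: commute_sym.
have qN : quad_closed S N.
  apply/quad_closedP; split=> //; first by rewrite (normalS _ _ nsNX) ?(subset_trans sNT).
  move=> y Sy quad; have Xy := subsetP sSX y Sy.
  have [D [nsD Dy cD]] := quadratic_normal_cent solX p_gt3 nsNX pN Xy (mem_p_elt pS Sy) quad.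
  have [sDX nDX] := andP nsD.
  have sylSD : p.-Sylow(D) (D :&: S) by apply: Sylow_setI_normal sylS.
  pose C := 'C_D(N)%G.
  have nsC : C <| D.
    by rewrite /normal subsetIl normsI ?normG // norms_cent // (subset_trans sDX) ?normal_norm.
  have pDC : p.-group (D / C).
    apply: pgroup_elts => _ /morphimP[d Nd Dd ->] /=.
    have Cd : d.`_p^' \in C by rewrite inE groupX //= cD ?groupX ?p_elt_constt.
    rewrite -[d](consttC p) morphM ?groupX //= [coset C d.`_p^']coset_id // mulg1.
    by apply: (morph_p_elt (coset_morphism C)); rewrite ?groupX ?p_elt_constt.
  have defD : C * (D :&: S) = D.
    have := quotient_pHall (subset_trans (subsetIl D S) (normal_norm nsC)) sylSD.
    move/(pHall_id) => /(_ pDC) eqDC.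
    rewrite -quotientK ?(subset_trans (subsetIl D S)) ?normal_norm // eqDC quotientGK //.
  rewrite gen_subG class_supportEr in sNT.
  rewrite -sub1set centsC gen_subG class_supportEr; apply/bigcupsP=> g Xg.
  (* This rewrites [A :^ g] as [A :^ m] with [m] normalizing [D :&: S]. Then [y] lies in [S :^ m],
     and the closure property of [A :^ m] in [S :^ m] applies to it. *)
  have : g \in D * 'N_X(D :&: S) by rewrite (Frattini_arg nsD sylSD).
  case/mulsgP=> d n Dd /setIP[Xn Nn] defg.
  have : d \in C * (D :&: S) by rewrite defD.
  case/mulsgP=> c s /setIP[Dc cNc] DSs defd.
  pose m := s * n; have Nm : m \in 'N(D :&: S) by rewrite groupM // (subsetP (normG (D :&: S)%G)).
  have -> : A :^ g = A :^ m.
    have NAc : c \in 'N(A) by rewrite (subsetP (cent_sub A)) // (subsetP (centS sAN)).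
    by rewrite defg defd -mulgA conjsgM (normP NAc).
  have Sy' : y \in S :^ m.
    have DSy : y \in D :&: S by rewrite inE Dy.
    by rewrite -(normP Nm) in DSy; rewrite (subsetP _ y DSy) // conjSg subsetIr.
  have /quad_closedP[_ _ cAm] := quad_closedJ m qA.
  rewrite centsC sub1set; apply: (cAm y Sy') => a Aa; apply: quad.
  apply: (subsetP (sAgN m _)) Aa.
  by rewrite groupM // (subsetP sDX) //; case/setIP: DSs.
suff <- : N :=: A by [].
by apply/eqP; rewrite eqEsubset sAN sub_Dstar.
Qed.

Lemma Dstar_Frattini (gT : finGroupType) p (X S : {group gT}) :
    solvable X -> (3 < p)%N -> p.-Sylow(X) S -> 'O_p^'(X) * 'N_X(Dstar S) = X.
Proof.
move=> solX p_gt3 sylS; pose H := 'O_p^'(X)%G.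
have [sSX pS _] := and3P sylS; have p'H : p^'.-group H := pcore_pgroup _ _.
have nHX : X \subset 'N(H) := gFnorm _ _.
have nHS := subset_trans sSX nHX.
have sDS : Dstar S \subset S := normal_sub (Dstar_normal S).
have tiHS : H :&: S = 1 by rewrite setIC (coprime_TIg (pnat_coprime pS p'H)).
have sylSb : p.-Sylow(X / H) (S / H) by rewrite quotient_pHall.
have nsDb := Dstar_normal_p'core1 (quotient_sol _ solX) p_gt3 sylSb (trivg_pcore_quotient _ _).
have defD : Dstar (S / H)%G = Dstar S / H.
  pose f := restrm_morphism nHS (coset_morphism H).
  have injf : 'injm f by rewrite ker_restrm ker_coset /= setIC tiHS.
  have := injm_Dstar injf (subxx S).
  have -> : (f @* S)%G = (S / H)%G by apply/val_inj; rewrite /= morphim_restrm setIid.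
  by move->; rewrite morphim_restrm (setIidPr sDS).
have nsHD : H * Dstar S <| X.
  rewrite -quotientK ?(subset_trans sDS) // -(quotientGK (pcore_normal _ X : H <| X)).
  by rewrite cosetpre_normal -defD.
have eqHD : H * Dstar S = H <*> Dstar S by rewrite norm_joinEr ?(subset_trans sDS).
rewrite eqHD in nsHD.
have sylD : p.-Sylow(H <*> Dstar S) (Dstar_group S).
  have := @coprime_mulGp_Hall _ p (H <*> Dstar S)%G H (Dstar_group S).
  by rewrite /= -eqHD => /(_ erefl p'H (pgroupS sDS pS))[].
rewrite -[RHS](Frattini_arg nsHD sylD) /= -eqHD -mulgA; congr (_ * _).
by rewrite mulSGid // subsetI normG (subset_trans sDS).
Qed.

End Dstar.

(** * Two-generator subgroups and non-cyclic p-groups *)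

Section Pairs.
Implicit Types (gT : finGroupType) (p : nat).

Lemma mem_pairM_coprime gT (a b g : gT) : commute a b -> coprime #[a] #[b] ->
  [/\ a \in <<[set a * b; g]>>, b \in <<[set a * b; g]>> & g \in <<[set a * b; g]>>].
Proof.
move=> cab co; have sub : <[a * b]> \subset <<[set a * b; g]>>.
  by rewrite cycle_subG mem_gen ?set21.
rewrite cycleM // in sub; split; last by rewrite mem_gen ?set22.
  by rewrite (subsetP (subset_trans (mulG_subl _ _) sub)) ?cycle_id.
by rewrite (subsetP (subset_trans (mulG_subr _ _) sub)) ?cycle_id.
Qed.

(** Another way to hold three elements in a pair: [n * h] conjugates [<[x]>] to [<[x ^ h]>], so the
    pair contains [x ^ h], hence [h], hence [n]. *)
Lemma mem_pairM_norm gT (x n h : gT) : n \in 'N(<[x]>) -> h \in <<[set x; x ^ h]>> ->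
  n \in <<[set x; n * h]>> /\ h \in <<[set x; n * h]>>.
Proof.
move=> Nn xh; pose X := <<[set x; (n * h)%g]>>%G.
have Xx : x \in X by rewrite mem_gen ?set21.
have Xnh : n * h \in X by rewrite mem_gen ?set22.
have Xxh : x ^ h \in X.
  have : x ^ h \in <[x]> :^ (n * h) by rewrite conjsgM (normP Nn) memJ_conjg cycle_id.
  by rewrite -cycleJ => /cycleP[i ->]; rewrite groupX // groupJ.
have Xh : h \in X.
  by apply: subsetP xh; rewrite gen_subG; apply/subsetP=> z /set2P[]->.
by split=> //; rewrite -(groupMr _ Xh).
Qed.

(** Sylow's theorem in the pair brings [f ^ g] back into [<[f]>] by some [r], and exactly to [f]
    since conjugation is trivial modulo [Q]. The component of [r^-1] in [Q] serves as [h]. *)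
Lemma conj_in_pair gT (p : nat) (Q : {group gT}) (f g : gT) :
    p.-elt f -> f \in 'N(Q) -> p^'.-group Q -> g \in Q ->
  exists2 h, h \in Q & (h \in <<[set f; f ^ g]>>) && (f ^ h == f ^ g).
Proof.
move=> pf nQf p'Q Qg; pose Y := <<[set f; f ^ g]>>%G; pose L := (Q <*> <[f]>)%G.
have nQL : L \subset 'N(Q) by rewrite join_subG normG cycle_subG.
have Lf : f \in L by rewrite mem_gen // inE cycle_id orbT.
have Lg : g \in L by rewrite mem_gen // inE Qg.
have Yf : f \in Y by rewrite mem_gen ?set21.
have Yfg : f ^ g \in Y by rewrite mem_gen ?set22.
have sYL : Y \subset L by rewrite gen_subG; apply/subsetP=> z /set2P[]->; rewrite ?groupJ.
have sylL : p.-Sylow(L) <[f]>.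
  rewrite /pHall joing_subr /= [p.-group _]pf /= -divgS ?joing_subr //=.
  rewrite norm_joinEr ?cycle_subG // coprime_cardMg; last by rewrite coprime_sym (pnat_coprime pf).
  by rewrite mulnK ?cardG_gt0.
have sylY : p.-Sylow(Y) <[f]> by rewrite (pHall_subl _ sYL) ?cycle_subG.
have [r Yr] : exists2 r, r \in Y & <[f ^ g]> :^ r \subset <[f]>.
  by apply: (Sylow_Jsub sylY); rewrite ?cycle_subG // [_.-group _]p_eltJ.
rewrite -cycleJ cycle_subG => fgr.
have tiQ : Q :&: <[f]> = 1 by apply: coprime_TIg; rewrite coprime_sym (pnat_coprime pf).
have abq : abelian (L / Q) by rewrite quotientYidl ?cycle_subG // quotient_cycle ?cycle_abelian.
have Lr := subsetP sYL r Yr.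
have fgrE : (f ^ g) ^ r = f.
  have Lgr : g * r \in L by rewrite groupM.
  have NQ z : z \in L -> z \in 'N(Q) by apply: subsetP.
  have eqc : coset Q (f ^ (g * r)) = coset Q f.
    rewrite -[LHS]/(coset_morphism Q _) morphJ ?NQ //; apply/conjg_fixP/commgP.
    by apply: (centsP abq); rewrite mem_quotient.
  rewrite -conjgM in fgr; rewrite -conjgM.
  apply/eqP; rewrite eq_mulgV1; apply/eqP/set1gP; rewrite -tiQ inE andbC.
  rewrite groupM ?groupV ?cycle_id //=.
  apply: coset_idr; first by rewrite groupM ?groupV ?NQ ?groupJ.
  by rewrite morphM ?groupV ?NQ ?groupJ // morphV ?NQ //= eqc mulgV.
have : r^-1 \in <[f]> * Q by rewrite normC ?cycle_subG // -norm_joinEr ?cycle_subG // groupV.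
case/mulsgP=> k q fk Qq defr; exists q => //.
have -> : q = k^-1 * r^-1 by rewrite defr mulKg.
rewrite groupM ?groupV //=; last by rewrite (subsetP _ k fk) // cycle_subG.
have /cycleP[i defk] := fk.
have -> : f ^ (k^-1 * r^-1) = f ^ r^-1.
  rewrite conjgM; congr (_ ^ _); apply/conjg_fixP/commgP/commuteV.
  by rewrite defk; apply: commuteX.
by rewrite -{1}fgrE conjgK.
Qed.

Lemma p'sub_p'p gT (p : nat) (X T : {group gT}) :
  p^'.-group T -> T \subset 'O_{p^', p}(X) -> T \subset 'O_p^'(X).
Proof.
move=> p'T; rewrite pseries_p'pE => sT; set H := 'O_p^'(X)%G.
have nHT : T \subset 'N(H) by rewrite (subset_trans sT) // subsetIl.
rewrite -quotient_sub1 //.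
have pT : p.-group (T / H).
  rewrite (pgroupS _ (pcore_pgroup p (X / H))) //.
  by apply: subset_trans (quotientS H sT) _; rewrite cosetpreK.
have p'TH : p^'.-group (T / H) by rewrite quotient_pgroup.
by rewrite -(coprime_TIg (pnat_coprime pT p'TH)) setIid.
Qed.

Lemma p'p_Frattini gT (p : nat) (X S : {group gT}) :
  p.-Sylow(X) S -> 'O_p^'(X) * 'N_X('O_{p^', p}(X) :&: S) = X.
Proof.
move=> sylS; pose L := 'O_{p^', p}(X)%G; pose H := 'O_p^'(X)%G.
have nsLX : L <| X := pseries_normal _ _.
have sHL : H \subset L.
  by have := pseries_sub_catl [:: p^' : nat_pred] [:: p : nat_pred] X; rewrite pseries1.
have nsHL : H <| L by apply: normalS sHL (normal_sub nsLX) (pcore_normal _ _).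
have sylL : p.-Sylow(L) (L :&: S) := Sylow_setI_normal nsLX sylS.
have sLSN : L :&: S \subset 'N(H) := subset_trans (subsetIl L S) (normal_norm nsHL).
have pLH : p.-group (L / H).
  by rewrite /L /= pseries_p'pE cosetpreK pcore_pgroup.
have defL : H * (L :&: S) = L.
  have := quotient_pHall sLSN sylL; move/pHall_id/(_ pLH) => eqL.
  by rewrite -quotientK // eqL quotientGK.
rewrite -[RHS](Frattini_arg nsLX sylL) -defL -mulgA; congr (_ * _).
rewrite mulSGid // subsetI normG andbT (subset_trans (subsetIl _ _)) ?(normal_sub nsLX) //.
Qed.

Lemma noncyclic_normal_abelian gT (p : nat) (P : {group gT}) :
    p.-group P -> odd p -> ~~ cyclic P ->
  exists X : {group gT}, [/\ X <| P, abelian X & ~~ cyclic X].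
Proof.
move=> pP p_odd ncP.
have oddP : odd #|P| := odd_pgroup_odd p_odd pP.
case: (boolP [exists X : {group gT}, [&& X <| P, abelian X & ~~ cyclic X]]) => [/existsP[X
  /and3P[]]|noX].
  by exists X.
case/negP: ncP; have [|//|] := normal_rank1_structure pP.
  move=> X nsX abX; apply: contraNT noX => ncX; apply/existsP; exists X.
  by rewrite nsX abX.
by case/and3P=> /eqP p2; rewrite p2 in p_odd.
Qed.

Lemma noncyclic_normal_abelem2 gT (p : nat) (P : {group gT}) :
    p.-group P -> odd p -> ~~ cyclic P ->
  exists E : {group gT}, [/\ E <| P, p.-abelem E & #|E| = (p ^ 2)%N].
Proof.
move=> pP p_odd ncP; have [X [nsX abX ncX]] := noncyclic_normal_abelian pP p_odd ncP.
have pX := pgroupS (normal_sub nsX) pP.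
have ntX : X :!=: 1 by apply: contraNneq ncX => ->; rewrite cyclic1.
have [p_pr _ _] := pgroup_pdiv pX ntX.
have nsO : 'Ohm_1(X) <| P by apply: char_normal_trans (Ohm_char 1 X) nsX.
have abelO : p.-abelem 'Ohm_1(X) by rewrite Ohm1_abelem.
have le2 : 2 <= logn p #|'Ohm_1(X)|.
  rewrite -(p_rank_abelem abelO) p_rank_Ohm1 -(rank_pgroup pX) ltnNge.
  by rewrite -abelian_rank1_cyclic.
have [E [sEO nsE oE]] := normal_pgroup pP nsO le2.
by exists E; rewrite (abelemS sEO).
Qed.

End Pairs.

(** * Minimal simple groups have cyclic Sylow subgroups *)

Section MinSimple.
Variable gT : finGroupType.
Hypothesis solP : forall H : {group gT}, H :!=: [set: gT] -> solvable H.
Hypothesis nsolG : ~~ solvable [set: gT].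
Hypothesis simpleG : forall N : {group gT}, N <| [set: gT] -> N :!=: 1 -> N :=: [set: gT].
Hypothesis sol2 : forall x y : gT, solvable <<[set x; y]>>.

Lemma sol_norm (K : {group gT}) : K :!=: 1 -> solvable K -> solvable 'N(K).
Proof.
move=> ntK solK; apply: solP; apply: contraNneq nsolG => NG.
by rewrite -(simpleG (N := K)) // /normal subsetT NG /=.
Qed.

Lemma sol_cent1 (e : gT) : e != 1 -> solvable 'C[e].
Proof.
have sub : 'C[e] \subset 'N(<[e]>) by rewrite -cent_cycle cent_sub.
move=> nte; apply: (solvableS sub).
by apply: sol_norm; rewrite ?cycle_eq1 // abelian_sol ?cycle_abelian.
Qed.

Section NonCyclicSylow.
Variables (p : nat) (P : {group gT}).
Hypotheses (p_gt3 : 3 < p) (sylP : p.-Sylow([set: gT]) P) (ncP : ~~ cyclic P).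

Let pP : p.-group P. Proof. exact: pHall_pgroup sylP. Qed.
Let ntP : P :!=: 1.
Proof. by apply: contraNneq ncP => ->; rewrite cyclic1. Qed.
Let p_pr : prime p. Proof. by have [] := pgroup_pdiv pP ntP. Qed.
Let p_odd : odd p.
Proof. by have := p_gt3; case: (even_prime p_pr) => // ->. Qed.

Lemma sol_p'group (Q : {group gT}) : p^'.-group Q -> solvable Q.
Proof.
move=> p'Q; apply: solP; apply/eqP=> QG; case/eqP: ntP; apply/trivgP.
rewrite -(coprime_TIg (pnat_coprime pP p'Q)) subsetI subxx QG subsetT //.
Qed.

Lemma sol_pnorm (Y : {group gT}) : p.-group Y -> Y :!=: 1 -> solvable 'N(Y).
Proof. by move=> pY ntY; apply: sol_norm => //; apply: pgroup_sol pY. Qed.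

Definition theta (e : gT) := 'O_p^'('C[e]).
Canonical theta_group e := [group of theta e].

Lemma theta_p' e : p^'.-group (theta e). Proof. exact: pcore_pgroup. Qed.
Lemma theta_cent e : theta e \subset 'C[e]. Proof. exact: pcore_sub. Qed.
Lemma thetaJ e g : theta (e ^ g) = theta e :^ g.
Proof. by rewrite /theta cent1J pcoreJ. Qed.

Lemma sub_theta (X : {group gT}) e :
  solvable X -> e \in X -> p.-elt e -> theta e :&: X \subset 'O_p^'(X).
Proof.
move=> solX Xe pe.
apply: subset_trans (p'core_cent_pgroup solX (Y := <[e]>) _ pe); last by rewrite cycle_subG.
rewrite cent_cycle; apply: subset_trans (pcoreS _ (subsetIr X 'C[e])).
by rewrite subsetI subsetIl andbT subsetI subsetIr (subset_trans (subsetIl _ _)) ?pcore_sub.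
Qed.

(** A normal [p']-subgroup of ['N(Y)] centralizes the normal [p]-subgroup [Y], hence lies in the
    [p']-core of ['C_('C[e])(Y)], and [p'core_cent_pgroup] applies in ['C[e]]. *)
Lemma p'core_norm_theta (Y : {group gT}) e :
  p.-group Y -> e \in 'Z(Y) -> e != 1 -> 'O_p^'('N(Y)) \subset theta e.
Proof.
move=> pY /setIP[Ye cYe] nte.
have sYC : Y \subset 'C[e] by rewrite sub_cent1.
apply: subset_trans (p'core_cent_pgroup (sol_cent1 nte) sYC pY).
set K := 'O_p^'('N(Y))%G.
have p'K : p^'.-group K := pcore_pgroup _ _.
have cKY : K \subset 'C(Y).
  apply/commG1P/trivgP; rewrite -(coprime_TIg (pnat_coprime pY p'K)) subsetI.
  by rewrite commg_subr pcore_sub commg_subl (subset_trans (normG Y)) // gFnorm.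
have sKC : K \subset 'C_('C[e])(Y).
  by rewrite subsetI cKY andbT -cent_cycle (subset_trans cKY) // centS // cycle_subG.
apply: pcore_max => //; rewrite /normal sKC (subset_trans _ (gFnorm _ 'N(Y))) //.
by rewrite (subset_trans (subsetIr _ _)) ?cent_sub.
Qed.

Section NormalRankTwo.
Variable E : {group gT}.
Hypotheses (nsEP : E <| P) (abelE : p.-abelem E) (cardE : #|E| = (p ^ 2)%N).

Let sEP : E \subset P. Proof. exact: normal_sub. Qed.
Let abE : abelian E. Proof. exact: abelem_abelian abelE. Qed.
Let pE : p.-group E. Proof. exact: abelem_pgroup abelE. Qed.
Let ncE : ~~ cyclic E.
Proof. by rewrite (abelem_cyclic abelE) cardE pfactorK. Qed.

Let oE e : e \in E -> e != 1 -> #[e] = p.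
Proof. by move=> Ee nte; apply: (abelem_order_p abelE). Qed.

Lemma E_outside e : exists2 z, z \in E & z \notin <[e]>.
Proof.
apply/subsetPn; apply: contra ncE => sEe.
exact: cyclicS sEe (cycle_cyclic e).
Qed.

Lemma E_gen e z (H : {group gT}) :
  e \in E -> e != 1 -> z \in E -> z \notin <[e]> -> e \in H -> z \in H -> E \subset H.
Proof.
move=> Ee nte Ez nez He Hz.
have sub : <<[set e; z]>> \subset E :&: H.
  by rewrite gen_subG; apply/subsetP=> u /set2P[]->; rewrite inE ?Ee ?Ez.
suff <- : <<[set e; z]>> = E by apply: subset_trans sub (subsetIr _ _).
apply/eqP; rewrite eqEcard (subset_trans sub) ?subsetIl //= cardE.
have : <[e]> \proper <<[set e; z]>>.
  rewrite properE cycle_subG mem_gen ?set21 //=.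
  by apply: contra nez => /subsetP-> //; rewrite mem_gen ?set22.
move/proper_card; rewrite -[#|<[e]>|]/#[e] oE //.
have pX : p.-group <<[set e; z]>> by rewrite (pgroupS (subset_trans sub (subsetIl _ _))).
rewrite (card_pgroup pX); case: (logn _ _) => [|[|k]]; rewrite ?expn1 ?ltnn //.
  by rewrite expn0 ltnNge prime_gt0.
by rewrite leq_exp2l // prime_gt1.
Qed.

(** [C] has index at most [p] in [P], and a Sylow subgroup [S] of ['C[e]] above it is no larger than
    [P]; so [C] is normal in [S]. For [s] in [S] and [u] in [E], [[~ s, u]] lies in [C] and commutes
    with [u]: [E] is quadratic on [S]. *)
Lemma E_p'p e : e \in E -> e != 1 -> E \subset 'O_{p^', p}('C[e]).
Proof.
move=> Ee nte; pose C := 'C_P(E)%G.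
have sEC : E \subset C by rewrite subsetI sEP.
have sCe : C \subset 'C[e] by rewrite (subset_trans (subsetIr _ _)) // -cent_set1 centS // sub1set.
have pC : p.-group C by rewrite (pgroupS _ pP) ?subsetIl.
have [S sylS sCS] := Sylow_superset sCe pC.
have pS := pHall_pgroup sylS.
have leSP : #|S| <= #|P|.
  have [g _ sSg] := Sylow_Jsub sylP (subsetT S) pS.
  by rewrite -(cardJg S g) subset_leq_card.
have iCP : #|P : C| <= p.
  have ntZ : E :&: 'Z(P) != 1.
    by rewrite meet_center_nil ?(pgroup_nil pP) // -cardG_gt1 cardE -(exp1n 2) ltn_sqr prime_gt1.
  have [z Zz ntz] := trivgPn _ ntZ; have {Zz} [Ez /setIP[Pz cPz]] := setIP Zz.
  have [u Eu nzu] := E_outside z.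
  have -> : C = 'C_P[u]%G.
    apply/val_inj/eqP; rewrite eqEsubset /= setIS ?centS //; last by rewrite -cent_set1 centS //
      sub1set.
    rewrite subsetI subsetIl /= centsC (E_gen Ez ntz Eu nzu) // ?inE.
      by rewrite (subsetP (centS (subsetIl P 'C[u]))).
    by rewrite -sub_cent1 subsetIr.
  rewrite index_cent1.
  (* The class of [u] has [p]-power size and lies in [E^#], which has fewer than [p ^ 2] elements;
     so its size is at most [p]. *)
  have sub : u ^: P \subset E^#.
    apply/subsetP=> _ /imsetP[y Py ->]; rewrite !inE conjg_eq1 memJ_norm ?Eu ?(subsetP
      (normal_norm nsEP)) //.
    by rewrite andbT; apply: contraNneq nzu => ->; rewrite group1.
  have pcl : p.-nat #|u ^: P| by rewrite -index_cent1 (pnat_dvd (dvdn_indexg _ _)).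
  have : #|u ^: P| < p ^ 2.
    rewrite (leq_ltn_trans (subset_leq_card sub)) // -cardE [in X in _ < X](cardsD1 1 E) group1 //.
  by case/p_natP: pcl => // k ->; rewrite ltn_exp2l ?prime_gt1 // -{2}[p]expn1 leq_exp2l ?prime_gt1.
have nsCS : C <| S.
  have iCS : #|S : C| <= p.
    rewrite (leq_trans _ iCP) // -!divgS ?subsetIl // leq_div2r //.
  have : p.-nat #|S : C| by rewrite (pnat_dvd (dvdn_indexg _ _)).
  case/p_natP => // -[|[|k]] iE; last 1 first.
  - by move: iCS; rewrite iE -{2}[p]expn1 leq_exp2l ?prime_gt1.
  - by rewrite (index1g sCS iE) normal_refl.
  - by apply: (p_maximal_normal pS); apply: (p_index_maximal sCS); rewrite iE expn1.
apply/subsetP=> u Eu; apply: (quadratic_Sylow_p'p (sol_cent1 nte) p_gt3 sylS).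
  by rewrite (subsetP (subset_trans sEC sCS)).
move=> s Ss; apply/eqP/commgP.
have Cu := subsetP sEC u Eu.
have : [~ s, u] \in C by rewrite commgEr groupM // memJ_norm ?groupV // (subsetP (normal_norm
  nsCS)).
by case/setIP=> _ /centP; apply.
Qed.

Lemma comm_E_theta (T : {group gT}) e : e \in E -> e != 1 ->
  p^'.-group T -> T \subset 'C[e] -> E \subset 'N(T) -> [~: T, E] \subset theta e.
Proof.
move=> Ee nte p'T sTC nTE.
have sRT : [~: T, E] \subset T by rewrite commg_subl.
apply: p'sub_p'p; first exact: pgroupS p'T.
rewrite (subset_trans (commgS T (E_p'p Ee nte))) // commg_subr.
by rewrite (subset_trans sTC) // gFnorm.
Qed.

Lemma comm_E_p'core (H X : {group gT}) :
    p^'.-group H -> E \subset 'N(H) -> solvable X -> E \subset X -> H \subset X ->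
  [~: H, E] \subset 'O_p^'(X).
Proof.
move=> p'H nHE solX sEX sHX; set K := 'O_p^'(X)%G.
have nKX : X \subset 'N(K) := gFnorm _ _.
have nKE := subset_trans sEX nKX; have nKH := subset_trans sHX nKX.
rewrite -quotient_cents2 // sub_quotient_pre //.
have coHE : coprime #|H| #|E| by rewrite coprime_sym (pnat_coprime pE).
have solH := solvableS sHX solX.
have <- := coprime_abelian_gen_cent1 abE ncE nHE coHE solH.
rewrite gen_subG; apply/bigcupsP=> e /setD1P[nte Ee].
rewrite -sub_quotient_pre ?subIset ?nKH //.
rewrite quotient_cents2 ?subIset ?nKH //.
have nCE : E \subset 'N('C_H[e]).
  by rewrite normsI // -cent_set1 norms_cent // cents_norm // (subset_trans abE) // centS //
    sub1set.
have sRX : [~: 'C_H[e], E] \subset X.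
  by rewrite comm_subG // subIset ?sHX.
apply: subset_trans (sub_theta solX (subsetP sEX e Ee) (mem_p_elt pE Ee)).
rewrite subsetI sRX andbT; apply: (comm_E_theta (T := 'C_H[e]%G)) => //.
  by rewrite (pgroupS _ p'H) ?subsetIl.
by rewrite subsetIr.
Qed.

Definition Einv (g : gT) : Prop :=
  exists Q : {group gT}, [/\ p^'.-group Q, E \subset 'N(Q) & g \in Q].

(* This is what replaces the signalizer functor theorem: left multiplication by
   theta f preserves the set of elements of E-invariant p'-subgroups, and W is
   contained in that set. *)
Lemma Einv_mul f a g : f \in E -> f != 1 -> a \in theta f -> Einv g -> Einv (a * g).
Proof.
move=> Ef ntf ta [Q [p'Q nQE Qg]]; have nQf := subsetP nQE f Ef.
have pf := mem_p_elt pE Ef.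
have [h Qh /andP[fh /eqP efh]] := conj_in_pair pf nQf p'Q Qg; rewrite -efh in fh.
have [z Ez nz] := E_outside f.
(* Here [a * g = b * h], where [b] is a [p']-element centralizing [f], and [h] lies in the pair of
   [f] and [f ^ h]. The pair [f * b], [z * h] then contains [f], [b], [z], [h], hence [E]; its
   [p']-core joined with [b] is the required subgroup. *)
pose T := (theta f <*> 'C_Q[f])%G; pose b := a * (g * h^-1).
have Cc : g * h^-1 \in 'C_Q[f].
  rewrite inE groupM ?groupV //=; apply/cent1P/esym/commgP/conjg_fixP.
  by rewrite conjgM -efh conjgK.
have nTC : 'C_Q[f] \subset 'N(theta f) by rewrite subIset // orbC gFnorm.
have p'T : p^'.-group T.
  by rewrite /= norm_joinEr // pgroupM theta_p' (pgroupS _ p'Q) ?subsetIl.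
have Tb : b \in T by rewrite groupM // mem_gen // inE ?ta ?Cc ?orbT.
have sTC : T \subset 'C[f] by rewrite join_subG theta_cent subsetIr.
have cfb : commute f b by apply/esym/cent1P; apply: (subsetP sTC).
have cofb : coprime #[f] #[b] by rewrite (pnat_coprime pf) // [_.-nat _](mem_p_elt p'T).
have [] := mem_pairM_coprime (z * h) cfb cofb.
pose X := <<[set (f * b)%g; (z * h)%g]>>%G; rewrite -[<<_>>]/(gval X) => Xf Xb Xzh.
have Nz : z \in 'N(<[f]>).
  by rewrite (subsetP _ z Ez) // cents_norm // (subset_trans abE) // centS // cycle_subG.
have [Xz Xh] : z \in X /\ h \in X.
  have [fz fh'] := mem_pairM_norm Nz fh.
  have sub : <<[set f; z * h]>> \subset X by rewrite gen_subG; apply/subsetP=> u /set2P[]->.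
  by rewrite !(subsetP sub).
have sEX : E \subset X := E_gen Ef ntf Ez nz Xf Xz.
have solX : solvable X := sol2 _ _; pose K := 'O_p^'(X)%G.
have nKX : X \subset 'N(K) := gFnorm _ _.
have XN (Y : {group gT}) : E \subset 'N(Y) -> E \subset 'N(Y :&: X).
  by move=> nYE; rewrite normsI // (subset_trans sEX) ?normG.
have sK (Y : {group gT}) : p^'.-group Y -> E \subset 'N(Y) -> [~: Y :&: X, E] \subset K.
  move=> p'Y nYE; apply: (comm_E_p'core (H := (Y :&: X)%G)) => //; rewrite ?subsetIr ?XN //.
  by rewrite (pgroupS _ p'Y) ?subsetIl.
(* As [f ^ h = [~ h, f^-1] * f], the pair of [f] and [f ^ h] lies in [R * <[f]>], and the
   [p']-element [h] falls into [R]. *)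
have Kh : h \in K.
  pose R := [~: Q :&: X, <[f]>]%G.
  have sRK : R \subset K by rewrite (subset_trans _ (sK Q p'Q nQE)) // commgS // cycle_subG.
  have nRf : <[f]> \subset 'N(R) by rewrite commg_normr.
  have : h \in R * <[f]>.
    rewrite -norm_joinEr //; apply: subsetP fh; rewrite gen_subG; apply/subsetP=> u /set2P[]->.
      by rewrite mem_gen // inE cycle_id orbT.
    have -> : f ^ h = [~ h, f^-1] * f by rewrite commgEl conjgE invgK /conjg !mulgA mulgKV.
    by rewrite groupM // mem_gen // inE ?cycle_id ?orbT // mem_commg ?groupV ?cycle_id // inE Qh.
  case/mulsgP=> r k Rr fk defh.
  have sRQ : R \subset Q.
    by rewrite (subset_trans (commSg _ (subsetIl _ _))) // commg_subl cycle_subG.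
  have k1 : k = 1.
    apply/set1gP; rewrite -(coprime_TIg (pnat_coprime pf p'Q)) inE fk /=.
    by rewrite -(groupMl _ (subsetP sRQ r Rr)) -defh.
  by rewrite defh k1 mulg1 (subsetP sRK).
have nTE : E \subset 'N(T).
  have sEC : E \subset 'C[f] by rewrite sub_cent1 (subsetP abE).
  have nCE : E \subset 'N('C_Q[f]) by rewrite normsI // (subset_trans sEC) ?normG.
  by rewrite normsY // (subset_trans sEC) ?gFnorm.
have nKb : <[b]> \subset 'N(K) by rewrite cycle_subG (subsetP nKX).
exists (K <*> <[b]>)%G; split.
- rewrite /= norm_joinEr // pgroupM pcore_pgroup /=.
  by rewrite [_.-group _](mem_p_elt p'T).
- rewrite -commg_subl; apply: subset_trans (joing_subl K <[b]>).
  rewrite -quotient_cents2 ?join_subG ?normG ?(subset_trans sEX) // quotientYidl //.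
  rewrite quotient_cents2 ?(subset_trans sEX) //.
  by apply: subset_trans (sK T p'T nTE); rewrite commSg // cycle_subG inE Tb.
have -> : a * g = b * h by rewrite /b !mulgA mulgKV.
by rewrite groupM // mem_gen // inE ?Kh ?cycle_id ?orbT.
Qed.

Definition W := <<\bigcup_(e in E^#) theta e>>.
Canonical W_group := [group of W].

Lemma Einv_W w : w \in W -> Einv w.
Proof.
case/gen_prodgP=> n [c Ac ->]; elim: n c Ac => [|n IHn] c Ac.
  by rewrite big_ord0; exists 1%G; rewrite pgroup1 norms1 inE.
rewrite big_ord_recl; have /bigcupP[e /setD1P[nte Ee] tc] := Ac ord0.
by apply: (Einv_mul Ee nte tc); apply: IHn => i; apply: Ac.
Qed.

Lemma W_p' : p^'.-group W.
Proof. by apply: pgroup_elts => w /Einv_W[Q [p'Q _ Qw]]; apply: mem_p_elt Qw. Qed.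

Lemma theta_sub_W e : e \in E -> e != 1 -> theta e \subset W.
Proof. by move=> Ee nte; rewrite sub_gen // (bigcup_max e) // !inE nte. Qed.

Lemma normE_normW : 'N(E) \subset 'N(W).
Proof.
apply: norms_gen; apply/subsetP=> x Nx; rewrite inE.
apply/subsetP=> _ /imsetP[w /bigcupP[e /setD1P[nte Ee] tw] ->].
apply/bigcupP; exists (e ^ x); first by rewrite !inE conjg_eq1 nte memJ_norm.
by rewrite thetaJ memJ_conjg.
Qed.

(** [Q] is generated by the ['C_Q[e]]. Each is the product of its commutator with [E], which lies in
    [theta e], and of its centralizer of [E], which normalizes [W]. *)
Lemma Einv_normW (Q : {group gT}) : p^'.-group Q -> E \subset 'N(Q) ->
  Q \subset 'N(W) /\ [~: Q, E] \subset W.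
Proof.
move=> p'Q nQE.
have coQE : coprime #|Q| #|E| by rewrite coprime_sym (pnat_coprime pE).
have solQ := sol_p'group p'Q.
have genQ := coprime_abelian_gen_cent1 abE ncE nQE coQE solQ.
have comW e : e \in E^# -> E \subset 'N('C_Q[e]) /\ [~: 'C_Q[e], E] \subset W.
  case/setD1P=> nte Ee.
  have nCE : E \subset 'N('C_Q[e]).
    by rewrite normsI // -cent_set1 norms_cent // cents_norm // (subset_trans abE) // centS //
      sub1set.
  split=> //; apply: subset_trans (theta_sub_W Ee nte).
  apply: (comm_E_theta (T := 'C_Q[e]%G)) => //; last by rewrite subsetIr.
  by rewrite (pgroupS _ p'Q) ?subsetIl.
have nWE : E \subset 'N(W) := subset_trans (normG E) normE_normW.
have nWQ : Q \subset 'N(W).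
  rewrite -genQ gen_subG; apply/bigcupsP=> e Ee; have [nCE sW] := comW e Ee.
  rewrite -(coprime_cent_prod nCE) ?(coprimeSg (subsetIl _ _)) ?(solvableS (subsetIl _ _)) //.
  rewrite mul_subG ?(subset_trans sW) ?normG //.
  by rewrite (subset_trans (subsetIr _ _)) // (subset_trans (cent_sub E)) ?normE_normW.
split=> //; rewrite -quotient_cents2 // sub_quotient_pre // -genQ gen_subG.
apply/bigcupsP=> e Ee; have [nCE sW] := comW e Ee.
by rewrite -sub_quotient_pre ?quotient_cents2 // subIset ?nWQ.
Qed.

(** * The subgroup [M] and its uniqueness properties *)

Variable x : gT.
Hypotheses (Ex : x \in E) (Zx : x \in 'Z(P)) (ntx : x != 1).

Let M0 := 'N(Dstar P)%G.
Let B0 := ('O_{p^', p}(M0) :&: P)%G.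
Let Wt := <<class_support W 'N_M0(B0)>>%G.
(* M contains the normalizer of each of its nontrivial p-subgroups: norm_pgroup_M. *)
Definition M := (Wt <*> M0)%G.

Lemma Dstar_neq1 (S : {group gT}) : p.-group S -> S :!=: 1 -> Dstar_group S :!=: 1.
Proof.
move=> pS; apply: contraNneq => D1; rewrite -(center_nil_eq1 (pgroup_nil pS)).
by rewrite -subG1 -D1 center_sub_Dstar.
Qed.

Let pD (S : {group gT}) : p.-group S -> p.-group (Dstar S).
Proof. by move=> pS; rewrite (pgroupS (normal_sub (Dstar_normal S))). Qed.

Let solM0 : solvable M0.
Proof. by apply: sol_pnorm; [apply: pD | apply: Dstar_neq1]. Qed.

Let sPM0 : P \subset M0. Proof. exact: normal_norm (Dstar_normal P). Qed.
Let sylM0 : p.-Sylow(M0) P.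
Proof. by apply: pHall_subl sylP; rewrite ?subsetT. Qed.

Let sEB0 : E \subset B0.
Proof.
rewrite subsetI sEP andbT; apply/subsetP=> u Eu.
apply: (quadratic_Sylow_p'p solM0 p_gt3 sylM0) => [|s Ps]; first exact: subsetP Eu.
apply/eqP/commgP; apply: (centsP abE) => //.
by rewrite commgEr groupM // memJ_norm ?groupV // (subsetP (normal_norm nsEP)).
Qed.

(** [W :^ k] is a [p']-group normalized by [B0 :^ k = B0], hence by [E], so [Einv_normW] makes it
    normalize [W]. *)
Let W_conj_norm n m : n \in 'N_M0(B0) -> m \in 'N_M0(B0) -> W :^ n \subset 'N(W :^ m).
Proof.
have WN k : k \in 'N_M0(B0) -> W :^ k \subset 'N(W).
  case/setIP=> _ Nk; apply: (proj1 (Einv_normW (Q := (W_group :^ k)%G) _ _)).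
    by rewrite /= pgroupJ W_p'.
  rewrite normJ (subset_trans sEB0) // -(normP Nk) conjSg.
  by rewrite (subset_trans (subsetIr _ _)) // (subset_trans (normal_norm nsEP)) ?normE_normW.
move=> Nn Nm; rewrite normJ -sub_conjgV -conjsgM WN // groupM ?groupV //.
Qed.

Let sWWt n : n \in 'N_M0(B0) -> W :^ n \subset Wt.
Proof. by move=> Nn; rewrite sub_gen // class_supportEr (bigcup_max n). Qed.

Lemma Wt_p' : p^'.-group Wt.
Proof.
suff : Wt \subset 'O_p^'(Wt) by move/pgroupS; apply; apply: pcore_pgroup.
rewrite {1}/Wt gen_subG class_supportEr; apply/bigcupsP=> n Nn.
apply: (pcore_max (H := (W_group :^ n)%G)); first by rewrite pgroupJ W_p'.
rewrite /normal sWWt //= gen_subG class_supportEr; apply/bigcupsP=> m Nm.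
exact: W_conj_norm.
Qed.

(** [M0] is the product of its [p']-core and ['N_M0(B0)]. The latter permutes the conjugates
    generating [Wt]; the former lies in [theta x], because [x] is central in [Dstar P]. *)
Lemma M0_norm_Wt : M0 \subset 'N(Wt).
Proof.
rewrite -(p'p_Frattini sylM0) mul_subG //; last first.
  by apply: norms_gen; apply: class_support_norm.
apply: subset_trans (normG Wt).
apply: (@subset_trans _ _ (mem W)); last by rewrite -[W]conjsg1 sWWt.
apply: subset_trans (theta_sub_W Ex ntx).
have ZDx : x \in 'Z(Dstar P).
  rewrite inE (subsetP (center_sub_Dstar P)) //=; case/setIP: Zx => _.
  by apply: subsetP; rewrite centS // (normal_sub (Dstar_normal P)).
by apply: (p'core_norm_theta (Y := Dstar_group P)) => //; apply: pD.
Qed.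

Lemma solM : solvable M.
Proof.
have nsW : Wt <| M by rewrite /normal joing_subl join_subG normG M0_norm_Wt.
rewrite (series_sol nsW) (sol_p'group Wt_p') /= quotientYidl ?M0_norm_Wt //.
exact: quotient_sol.
Qed.

Let sM0M : M0 \subset M. Proof. exact: joing_subr. Qed.
Let sPM : P \subset M. Proof. exact: subset_trans sPM0 sM0M. Qed.
Let sEM : E \subset M. Proof. exact: subset_trans sEP sPM. Qed.
Let sWM : W \subset M.
Proof. by apply: subset_trans (joing_subl _ _); rewrite -[W]conjsg1 sWWt. Qed.
Let sylM : p.-Sylow(M) P.
Proof. by apply: pHall_subl sylP; rewrite ?subsetT. Qed.

Lemma cent_x_M : 'C[x] \subset M.
Proof.
have sPC : P \subset 'C[x] by rewrite sub_cent1; case/setIP: Zx => _.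
have sylC : p.-Sylow('C[x]) P by apply: pHall_subl sylP; rewrite ?subsetT.
rewrite -(Dstar_Frattini (sol_cent1 ntx) p_gt3 sylC) mul_subG //.
  exact: subset_trans (theta_sub_W Ex ntx) sWM.
by rewrite (subset_trans (subsetIr _ _)) ?sM0M.
Qed.

Lemma Einv_M (Q : {group gT}) : p^'.-group Q -> E \subset 'N(Q) -> Q \subset M.
Proof.
move=> p'Q nQE; have [_ sRW] := Einv_normW p'Q nQE.
have coQE : coprime #|Q| #|E| by rewrite coprime_sym (pnat_coprime pE).
rewrite -(coprime_cent_prod nQE coQE (sol_p'group p'Q)) mul_subG //.
  exact: subset_trans sRW sWM.
rewrite (subset_trans _ cent_x_M) // (subset_trans (subsetIr _ _)) //.
by rewrite -cent_set1 centS // sub1set.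
Qed.

(** If [e] does not commute with [u] in [E], then for [a] in [theta e] the pair [e * a], [u]
    contains [e], [a], [u] and so [E], generated by [u] and [[~ u, e]]. Thus [a] lies in the
    [p']-core of a solvable group containing [E]. *)
Lemma theta_M e : e \in P -> #[e] = p -> theta e \subset M.
Proof.
move=> Pe oe; have [cEe|] := boolP (e \in 'C(E)).
  apply: Einv_M; first exact: theta_p'.
  by rewrite (subset_trans _ (gFnorm _ _)) // sub_cent1.
rewrite -sub1set centsC => /subsetPn[u Eu]; rewrite cent_set1 => ncu.
have ntu : u != 1 by apply: contraNneq ncu => ->; rewrite group1.
have pe : p.-elt e := mem_p_elt pP Pe.
apply/subsetP=> a ta.
have cea : commute e a by apply/esym/cent1P; apply: (subsetP (theta_cent e)).
have co : coprime #[e] #[a] by rewrite (pnat_coprime pe) // [_.-nat _](mem_p_elt (theta_p' e)).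
have [] := mem_pairM_coprime u cea co.
pose X := <<[set (e * a)%g; u]>>%G; rewrite -[<<_>>]/(gval X) => Xe Xa Xu.
have Er : [~ u, e] \in E.
  by rewrite commgEl groupM ?groupV // memJ_norm // (subsetP (normal_norm nsEP)).
have nru : [~ u, e] \notin <[u]>.
  apply: contra ncu => ru; apply/cent1P/esym.
  have Nu : e \in 'N(<[u]>).
    rewrite inE -cycleJ cycle_subG -[u ^ e](mulKVg u) -commgEl groupM ?cycle_id //.
  have pu : p.-group (<[u]> <*> <[e]>).
    by rewrite (pgroupS _ pP) // join_subG !cycle_subG Pe (subsetP sEP).
  have : <[u]> :&: 'Z(<[u]> <*> <[e]>) != 1.
    rewrite meet_center_nil ?(pgroup_nil pu) ?cycle_eq1 //.
    by rewrite /normal joing_subl join_subG normG cycle_subG.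
  have pr_u : prime #|<[u]>| by rewrite -[#|_|]/#[u] (oE Eu ntu).
  move/(prime_meetG pr_u); rewrite cycle_subG => /setIP[_ /centP cu].
  by apply/esym/cu; rewrite mem_gen // inE cycle_id orbT.
have sEX : E \subset X by apply: (E_gen Eu ntu Er nru); rewrite ?groupR.
have solX : solvable X := sol2 _ _.
have : a \in 'O_p^'(X) by apply: (subsetP (sub_theta solX Xe pe)); rewrite inE ta.
apply: subsetP; apply: Einv_M; first exact: pcore_pgroup.
by rewrite (subset_trans sEX) // gFnorm.
Qed.

Let theta_core_M (Y : {group gT}) : Y \subset P -> Y :!=: 1 -> 'O_p^'('N(Y)) \subset M.
Proof.
move=> sYP ntY; have pY := pgroupS sYP pP.
have ntZ : 'Z(Y) != 1 by rewrite center_nil_eq1 ?(pgroup_nil pY).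
have [_ pdvd _] := pgroup_pdiv (pgroupS (center_sub Y) pY) ntZ.
have [e Ze oe] := Cauchy p_pr pdvd.
have nte : e != 1 by rewrite -order_gt1 oe prime_gt1.
apply: subset_trans (p'core_norm_theta pY Ze nte) _.
by apply: theta_M => //; rewrite (subsetP sYP) // (subsetP (center_sub Y)).
Qed.

(** Induction with ['N_P(Y)] growing. Let [S1] be a Sylow subgroup of ['N(Y)] above [S0 = 'N_P(Y)].
    If [S0] is [P] or [S1], use [Dstar_Frattini]. Otherwise ['N_S1(S0)] lies in [M] and is conjugate
    in [M] into [P], which moves [Y] to a conjugate with larger normalizer in [P]. *)
Lemma norm_sub_M (Y : {group gT}) : Y \subset P -> Y :!=: 1 -> 'N(Y) \subset M.
Proof.
have [n] := ubnP (#|P| - #|'N_P(Y)|); elim: n Y => // n IHn Y /ltnSE-leY sYP ntY.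
have IH (Z : {group gT}) : Z \subset P -> Z :!=: 1 -> #|'N_P(Y)| < #|'N_P(Z)| -> 'N(Z) \subset M.
  move=> sZP ntZ lt; apply: IHn => //; apply: leq_trans leY.
  by rewrite ltn_sub2l // (leq_trans lt) // subset_leq_card ?subsetIl.
have pY := pgroupS sYP pP; have solN := sol_pnorm pY ntY.
pose S0 := 'N_P(Y)%G.
have pS0 : p.-group S0 := pgroupS (subsetIl _ _) pP.
have sYS0 : Y \subset S0 by rewrite subsetI sYP normG.
have ntS0 : S0 :!=: 1 by apply: contraNneq ntY => S1; rewrite -subG1 -S1.
have [S1 sylS1 sS01] := Sylow_superset (subsetIr P 'N(Y)) pS0.
have pS1 := pHall_pgroup sylS1.
have [S0P|ltS0P] := eqVproper (subsetIl P 'N(Y)).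
  have S1P : S1 :=: P.
    by apply: (sub_pHall sylP pS1); rewrite ?subsetT // -S0P.
  rewrite -(Dstar_Frattini solN p_gt3 sylS1) mul_subG ?theta_core_M //.
  rewrite (subset_trans (subsetIr _ _)) //= (subset_trans _ sM0M) //=.
  by have -> : S1 = P by apply/val_inj.
have ltN : #|S0| < #|'N_P(S0)|.
  by rewrite proper_card // nilpotent_proper_norm ?(pgroup_nil pP).
have [S01|ltS01] := eqVproper sS01.
  rewrite -(Dstar_Frattini solN p_gt3 sylS1) mul_subG ?theta_core_M //.
  have -> : S1 = S0 by apply/val_inj.
  rewrite (subset_trans (subsetIr _ _)) //; apply: (IH (Dstar_group S0)).
  - by rewrite (subset_trans (normal_sub (Dstar_normal S0))) ?subsetIl.
  - exact: Dstar_neq1.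
  by apply: leq_trans ltN _; rewrite subset_leq_card // setIS // norm_Dstar.
have NS0 : 'N(S0) \subset M by apply: IH => //; rewrite subsetIl.
pose T := 'N_S1(S0)%G; have sTM : T \subset M := subset_trans (subsetIr _ _) NS0.
have pT : p.-group T := pgroupS (subsetIl _ _) pS1.
have [m Mm sTmP] := Sylow_Jsub sylM sTM pT.
have ltT : #|S0| < #|T|.
  by rewrite proper_card // nilpotent_proper_norm ?(pgroup_nil pS1).
have sYT : Y \subset T.
  by rewrite subsetI (subset_trans sYS0) //= (subset_trans sYS0) ?normG.
have : 'N(Y :^ m) \subset M.
  apply: (IH (Y :^ m)%G); rewrite ?(subset_trans _ sTmP) ?conjSg //.
    by rewrite -!cardG_gt1 cardJg cardG_gt1 in ntY *.
  apply: leq_trans ltT _; rewrite -(cardJg T m) subset_leq_card // subsetI sTmP normJ conjSg.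
  by rewrite (subset_trans (subsetIl _ _)) // (pHall_sub sylS1).
by rewrite normJ sub_conjg (conjGid (groupVr Mm)).
Qed.

Lemma norm_pgroup_M (Y : {group gT}) : p.-group Y -> Y \subset M -> Y :!=: 1 -> 'N(Y) \subset M.
Proof.
move=> pY sYM ntY; have [m Mm sYP] := Sylow_Jsub sylM sYM pY.
have := norm_sub_M (Y := (Y :^ m)%G) sYP; rewrite /= normJ sub_conjg (conjGid (groupVr Mm)).
by apply; rewrite trivg_card1 cardJg -trivg_card1.
Qed.

Lemma pgroup_meet_M (S : {group gT}) : p.-group S -> S :&: M != 1 -> S \subset M.
Proof.
move=> pS ntSM; suff <- : S :&: M = S by rewrite subsetIr.
apply/eqP; rewrite eqEproper subsetIl /=; apply/negP=> prSM.
have := nilpotent_proper_norm (pgroup_nil pS) prSM.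
rewrite properE => /andP[_ /negP[]]; rewrite subsetI subsetIl (subset_trans (subsetIr _ _)) //.
apply: (norm_pgroup_M (Y := (S :&: M)%G)) => //; last exact: subsetIr.
by rewrite (pgroupS _ pS) ?subsetIl.
Qed.

Lemma conj_x_M g : x ^ g \in M -> g \in M.
Proof.
move=> Mxg; have pPg : p.-group (P :^ g) by rewrite pgroupJ.
have Px : x \in P := subsetP sEP x Ex.
have sPgM : P :^ g \subset M.
  apply: pgroup_meet_M => //; apply/trivgPn; exists (x ^ g); last by rewrite conjg_eq1.
  by rewrite inE memJ_conjg Px.
have sylPg : p.-Sylow(M) (P :^ g).
  by rewrite pHallE sPgM cardJg /= (card_Hall sylM).
have [m Mm defPg] := Sylow_trans sylM sylPg.
have : g * m^-1 \in 'N(P) by apply/normP; rewrite conjsgM defPg conjsgK.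
move/(subsetP (norm_pgroup_M pP sPM ntP)).
by rewrite groupMr ?groupV.
Qed.

(** The [p']-core of [X] is generated by centralizers of elements of [F^#], and the other factor in
    [Dstar_Frattini] normalizes a nontrivial [p]-subgroup of [M]. *)
Lemma noncyclic_sub_M (X F : {group gT}) : solvable X -> p.-group F -> abelian F ->
  ~~ cyclic F -> F \subset X -> F \subset M -> X \subset M.
Proof.
move=> solX pF abF ncF sFX sFM; have [S sylS sFS] := Sylow_superset sFX pF.
have pS := pHall_pgroup sylS.
have ntF : F :!=: 1 by apply: contraNneq ncF => ->; rewrite cyclic1.
have sSM : S \subset M.
  by apply: pgroup_meet_M => //; apply: contraNneq ntF => SM1; rewrite -subG1 -SM1 subsetI sFS.
have ntS : S :!=: 1 by apply: contraNneq ntF => S1; rewrite -subG1 -S1.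
rewrite -(Dstar_Frattini solX p_gt3 sylS) mul_subG //; last first.
  rewrite (subset_trans (subsetIr _ _)) //; apply: (norm_pgroup_M (Y := Dstar_group S)).
  - exact: pD.
  - by rewrite (subset_trans (normal_sub (Dstar_normal S))).
  - exact: Dstar_neq1.
have p'H : p^'.-group 'O_p^'(X) := pcore_pgroup _ _.
have nHF : F \subset 'N('O_p^'(X)) by rewrite (subset_trans sFX) ?gFnorm.
have coHF : coprime #|'O_p^'(X)| #|F| by rewrite coprime_sym (pnat_coprime pF).
rewrite -(coprime_abelian_gen_cent1 (G := 'O_p^'(X)%G) abF ncF nHF coHF (sol_p'group p'H)).
rewrite gen_subG; apply/bigcupsP=> f /setD1P[ntf Ff].
rewrite (subset_trans (subsetIr _ _)) // -cent_cycle (subset_trans (cent_sub _)) //.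
apply: norm_pgroup_M; rewrite ?cycle_eq1 ?cycle_subG ?(subsetP sFM) //.
exact: mem_p_elt Ff.
Qed.

(** With [e] in [E] outside [<[x]>], the pair [x], [e * h] contains [h] and also [E], so it lies in
    [M]. *)
Lemma pair_mem_M h : h \in <<[set x; x ^ h]>> -> h \in M.
Proof.
move=> xh; have [e Ee ne] := E_outside x.
have Ne : e \in 'N(<[x]>).
  by rewrite (subsetP _ e Ee) // cents_norm // (subset_trans abE) // centS // cycle_subG.
have [Xe Xh] := mem_pairM_norm Ne xh.
have Xx : x \in <<[set x; e * h]>> by rewrite mem_gen ?set21.
apply: (subsetP (noncyclic_sub_M (sol2 _ _) pE abE ncE _ sEM)) Xh.
exact: (E_gen Ex ntx Ee ne).
Qed.

Lemma noncyclic_Sylow_contra : False.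
Proof.
case/negP: nsolG; suff -> : [set: gT] = M by apply: solM.
apply/eqP; rewrite eqEsubset subsetT andbT; apply/subsetP=> g _.
have Mx : x \in M := subsetP sEM x Ex.
have px : p.-elt x := mem_p_elt pE Ex.
pose X := <<[set x; x ^ g]>>%G; have solX : solvable X := sol2 _ _.
have Xx : x \in X by rewrite mem_gen ?set21.
have Xxg : x ^ g \in X by rewrite mem_gen ?set22.
have [S sylS sxS] : {S : {group gT} | p.-Sylow(X) S & <[x]> \subset S}.
  by apply: Sylow_superset; rewrite ?cycle_subG.
have pS := pHall_pgroup sylS; rewrite cycle_subG in sxS.
have sSM : S \subset M.
  by apply: pgroup_meet_M => //; apply/trivgPn; exists x; rewrite ?inE ?sxS.
have [cycS|ncS] := boolP (cyclic S); last first.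
  have [F [nsF abF ncF]] := noncyclic_normal_abelian pS p_odd ncS.
  have sFS := normal_sub nsF.
  apply: conj_x_M; apply: (subsetP (noncyclic_sub_M solX _ abF ncF _ _)) Xxg.
  - exact: pgroupS pS.
  - by rewrite (subset_trans sFS) ?(pHall_sub sylS).
  - by rewrite (subset_trans sFS).
(* [<[x]>] is the only subgroup of order [p] in the cyclic group [S], so [g * k] normalizes it.
   Moreover [X] lies in the pair of [x] and [x ^ k^-1], so that [pair_mem_M] applies to [k^-1]. *)
have [k Xk sxgS] : exists2 k, k \in X & <[x ^ g]> :^ k \subset S.
  by apply: (Sylow_Jsub sylS); rewrite ?cycle_subG // [_.-group _]p_eltJ.
have eqx : <[x]> :^ (g * k) = <[x]>.
  rewrite conjsgM -cycleJ; apply/eqP; rewrite (eq_subG_cyclic cycS) ?cycle_subG //.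
  by rewrite cardJg -!/#[_] orderJ.
have Mgk : g * k \in M.
  apply: subsetP (_ : g * k \in 'N(<[x]>)); last by apply/normP.
  by apply: norm_pgroup_M; rewrite ?cycle_eq1 ?cycle_subG.
have Mk : k^-1 \in M.
  apply: pair_mem_M; rewrite groupV.
  apply: subsetP Xk; rewrite gen_subG; apply/subsetP=> u /set2P[]->.
    by rewrite mem_gen ?set21.
  have : x ^ g \in <[x]> :^ k^-1.
    by rewrite -eqx -conjsgM mulgK memJ_conjg cycle_id.
  rewrite -cycleJ; apply: subsetP; rewrite cycle_subG mem_gen ?set22 //.
by rewrite -(groupMr _ (groupVr Mk)) invgK.
Qed.

End NormalRankTwo.
End NonCyclicSylow.

Lemma min_simple_Sylow_cyclic p (P : {group gT}) :
  3 < p -> p.-Sylow([set: gT]) P -> cyclic P.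
Proof.
move=> p_gt3 sylP; apply: contraT => ncP; have pP := pHall_pgroup sylP.
have ntP : P :!=: 1 by apply: contraNneq ncP => ->; rewrite cyclic1.
have [p_pr _ _] := pgroup_pdiv pP ntP.
have p_odd : odd p by have := p_gt3; case: (even_prime p_pr) => // ->.
have [E [nsEP abelE oE]] := noncyclic_normal_abelem2 pP p_odd ncP.
have : E :&: 'Z(P) != 1.
  by rewrite meet_center_nil ?(pgroup_nil pP) // -cardG_gt1 oE -(exp1n 2) ltn_sqr prime_gt1.
case/trivgPn=> x /setIP[Ex Zx] ntx.
by have [] := noncyclic_Sylow_contra p_gt3 sylP ncP nsEP abelE oE Ex Zx ntx.
Qed.

End MinSimple.

(** * Elements of order p when Sylow subgroups are cyclic *)

Section CyclicSylow.
Variables (gT : finGroupType) (p : nat).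
Hypothesis p_pr : prime p.
Hypothesis cycp : forall S : {group gT}, p.-group S -> cyclic S.

Implicit Types (X Y : {group gT}) (u v x c : gT).

Lemma order_p_elt u : #[u] = p -> p.-elt u.
Proof. by move=> ou; rewrite /p_elt ou pnat_id. Qed.

Lemma quotient_pgroup_cyclic X (T : {group coset_of 'O_p^'(X)}) :
  T \subset X / 'O_p^'(X) -> p.-group T -> cyclic T.
Proof.
move=> sTX pT; have [S sylS] := Sylow_exists p X.
have [sSX pS _] := and3P sylS.
have sylSb : p.-Sylow(X / 'O_p^'(X)) (S / 'O_p^'(X)).
  by rewrite quotient_pHall // (subset_trans sSX) ?gFnorm.
have [g _ sTg] := Sylow_Jsub sylSb sTX pT.
by rewrite -(cyclicJ _ g) (cyclicS sTg) // quotient_cyclic ?cycp.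
Qed.

Lemma coset_order_p X u : u \in X -> #[u] = p -> #[coset 'O_p^'(X) u] = p.
Proof.
move=> Xu ou; set H := 'O_p^'(X)%G.
have Nu : u \in 'N(H) by apply: (subsetP (gFnorm _ X)).
apply: nt_prime_order => //; first by rewrite -morphX // -ou expg_order morph1.
apply/eqP=> /(coset_idr Nu) Hu; have := pi'_elt_pgroup1 (pcore_pgroup p^' X) _ Hu.
rewrite p_eltNK order_p_elt // => /(_ isT) u1.
by move: ou p_pr; rewrite u1 order1 => <-.
Qed.

(** A Sylow [p]-subgroup of the quotient is cyclic, so its only subgroup of order [p] lies in the
    nontrivial ['O_p], where it is characteristic. *)
Lemma order_p_quotient_normal X u : solvable X -> u \in X -> #[u] = p ->
  <[coset 'O_p^'(X) u]> <| X / 'O_p^'(X) /\ coset 'O_p^'(X) u \in 'O_p(X / 'O_p^'(X)).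
Proof.
move=> solX Xu ou; set H := 'O_p^'(X)%G; set ub := coset H u.
have oub : #[ub] = p := coset_order_p Xu ou.
have Xub : ub \in X / H by apply: mem_quotient.
pose T := 'O_p(X / H)%G; have pT : p.-group T := pcore_pgroup _ _.
have ntT : T :!=: 1.
  have : 'F(X / H) != 1.
    rewrite trivg_Fitting ?quotient_sol //; apply/trivgPn; exists ub => //.
    by rewrite -order_gt1 oub prime_gt1.
  by rewrite (Fitting_eq_pcore (trivg_pcore_quotient p^' X)).
have [_ pdT _] := pgroup_pdiv pT ntT; have [z Tz oz] := Cauchy p_pr pdT.
have [S sylS sub] : {S : {group coset_of H} | p.-Sylow(X / H) S & <[ub]> \subset S}.
  have pub : p.-elt ub by rewrite /p_elt oub pnat_id.
  by apply: Sylow_superset; rewrite ?cycle_subG.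
have [sSX pS _] := and3P sylS.
have sTS : T \subset S := pcore_sub_Hall sylS.
have cycS : cyclic S by apply: quotient_pgroup_cyclic.
have eqz : <[ub]> = <[z]>.
  apply/eqP; rewrite (eq_subG_cyclic cycS) ?cycle_subG -?cycle_subG //.
    by rewrite -!/#[_] oub oz.
  by rewrite cycle_subG (subsetP sTS).
rewrite -cycle_subG eqz cycle_subG; split=> //.
apply: char_normal_trans (pcore_normal p (X / H)); rewrite -/T.
have cycT := cyclicS sTS cycS.
by rewrite sub_cyclic_char // cycle_subG.
Qed.

Lemma order_p_cosets X u v : solvable X -> u \in X -> v \in X -> #[u] = p -> #[v] = p ->
  <[coset 'O_p^'(X) u]> = <[coset 'O_p^'(X) v]>.
Proof.
move=> solX Xu Xv ou ov; set H := 'O_p^'(X)%G.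
have [_ Tu] := order_p_quotient_normal solX Xu ou.
have [_ Tv] := order_p_quotient_normal solX Xv ov.
have cycT : cyclic 'O_p(X / H).
  by apply: quotient_pgroup_cyclic; rewrite ?pcore_sub ?pcore_pgroup.
apply/eqP; rewrite (eq_subG_cyclic cycT) ?cycle_subG //.
by rewrite -!/#[_] !coset_order_p.
Qed.

Lemma order_p_Frattini X u : solvable X -> u \in X -> #[u] = p ->
  'O_p^'(X) * 'N_X(<[u]>) = X.
Proof.
move=> solX Xu ou; set H := 'O_p^'(X)%G.
have [nsu _] := order_p_quotient_normal solX Xu ou.
have nHu : <[u]> \subset 'N(H) by rewrite cycle_subG (subsetP (gFnorm _ X)).
have nsHu : H <*> <[u]> <| X.
  rewrite norm_joinEr // -quotientK // quotient_cycle -?cycle_subG //.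
  by rewrite -(quotientGK (pcore_normal p^' X)) cosetpre_normal.
have sylu : p.-Sylow(H <*> <[u]>) <[u]>.
  have := @coprime_mulGp_Hall _ p (H <*> <[u]>)%G H <[u]>%G.
  rewrite /= norm_joinEr // => /(_ erefl (pcore_pgroup _ _) (order_p_elt ou)) [_].
  by [].
rewrite -[RHS](Frattini_arg nsHu sylu) /= norm_joinEr // -mulgA; congr (_ * _).
by rewrite mulSGid // subsetI normG cycle_subG Xu.
Qed.

(** If [cb] acted nontrivially on the cyclic group [T], then [[~: T, <[cb]>]] would contain the
    subgroup of order [p], which [cb] centralizes, against coprime action. So [cb] centralizes [T],
    which contains its own centralizer. *)
Lemma p'elt_cent_order_p X u c : solvable X -> u \in X -> #[u] = p ->
  c \in X -> p^'.-elt c -> [~ u, c] \in 'O_p^'(X) -> c \in 'O_p^'(X).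
Proof.
move=> solX Xu ou Xc p'c Huc; set H := 'O_p^'(X)%G.
have NH z : z \in X -> z \in 'N(H) by apply: subsetP; apply: gFnorm.
apply: coset_idr; first exact: NH.
set cb := coset H c; pose T := 'O_p(X / H)%G.
have pT : p.-group T := pcore_pgroup _ _.
have cycT : cyclic T by apply: quotient_pgroup_cyclic; rewrite ?pcore_sub.
have [_ Tu] := order_p_quotient_normal solX Xu ou.
have Xcb : cb \in X / H by apply: mem_quotient.
have p'cb : p^'.-elt cb by apply: (morph_p_elt (coset_morphism H)); rewrite ?NH.
have nTc : <[cb]> \subset 'N(T) by rewrite cycle_subG (subsetP (gFnorm _ (X / H)%G)).
have coTc : coprime #|T| #|<[cb]>| by apply: pnat_coprime pT _.
have cub : coset H u \in 'C(<[cb]>).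
  rewrite cent_cycle; apply/cent1P/commgP/eqP.
  rewrite -[coset H u]/(coset_morphism H u) -[cb]/(coset_morphism H c) -morphR ?NH //=.
  exact: coset_id.
have TI := coprime_abel_cent_TI nTc coTc (cyclic_abelian cycT).
have R1 : [~: T, <[cb]>] = 1.
  apply/eqP/idPn => ntR; have pR : p.-group [~: T, <[cb]>] by rewrite (pgroupS _ pT) ?commg_subl.
  have [_ pdR _] := pgroup_pdiv pR ntR; have [z Rz oz] := Cauchy p_pr pdR.
  have eqz : <[coset H u]> = <[z]>.
    apply/eqP; rewrite (eq_subG_cyclic cycT) ?cycle_subG //.
      by rewrite -!/#[_] oz coset_order_p.
    by apply: subsetP Rz; rewrite commg_subl.
  have : z \in 'C_[~: T, <[cb]>](<[cb]>).
    rewrite inE Rz -cycle_subG -eqz cycle_subG //.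
  by rewrite TI => /set1gP z1; move: oz p_pr; rewrite z1 order1 => <-.
have Tcb : cb \in T.
  apply: (subsetP (solvable_p_constrained (quotient_sol _ solX) (trivg_pcore_quotient p^' X))).
  by rewrite inE Xcb -cycle_subG centsC; apply/commG1P.
by apply: (pi'_elt_pgroup1 pT).
Qed.

Lemma Sylow_joing_cycle (Q : {group gT}) (f : gT) :
  p.-elt f -> f \in 'N(Q) -> p^'.-group Q -> p.-Sylow(Q <*> <[f]>) <[f]>.
Proof.
move=> pf nQf p'Q; rewrite /pHall joing_subr /= [p.-group _]pf /= -divgS ?joing_subr //=.
rewrite norm_joinEr ?cycle_subG // coprime_cardMg; last by rewrite coprime_sym (pnat_coprime pf).
by rewrite mulnK ?cardG_gt0.
Qed.

Lemma order_p_normsub X (u : gT) b (R : {group gT}) : solvable X -> u \in X -> #[u] = p ->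
    b.-Sylow('O_p^'(X)) R ->
  (#|X|`_b * #|'N_('O_p^'(X))(<[u]>)|`_b = #|R| * #|'N_X(<[u]>)|`_b)%N.
Proof.
move=> solX Xu ou sylR; set H := 'O_p^'(X)%G.
have -> : 'N_H(<[u]>) = H :&: 'N_X(<[u]>).
  by rewrite setIA (setIidPl (pcore_sub _ _)).
rewrite (card_Hall sylR) -!partnM ?cardG_gt0 // [in RHS]mul_cardG.
by rewrite [H * _](order_p_Frattini solX Xu ou).
Qed.

End CyclicSylow.

Lemma solvable_joing (gT : finGroupType) (X T : {group gT}) :
  solvable X -> solvable T -> T \subset 'N(X) -> solvable (X <*> T).
Proof.
move=> solX solT nXT.
have nsX : X <| X <*> T by rewrite /normal joing_subl join_subG normG.
by rewrite (series_sol nsX) solX /= quotientYidl // quotient_sol.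
Qed.

(** For nontrivial [R], [Aut R] has order [r.-1 * r ^ e], which is prime to [p]. *)
Lemma cent_cyclic_pgroup (gT : finGroupType) (r p : nat) (R X : {group gT}) :
  prime r -> prime p -> r < p -> r.-group R -> cyclic R -> p.-group X ->
  X \subset 'N(R) -> X \subset 'C(R).
Proof.
move=> r_pr p_pr ltrp rR cycR pX nRX.
have [->|ntR] := eqsVneq R 1; first by rewrite cent1T subsetT.
have [_ _ [e oR]] := pgroup_pdiv rR ntR.
pose f := conj_aut_morphism R.
have : f @* X \subset Aut R := Aut_conj_aut _ _.
move/cardSg; rewrite card_Aut_cyclic // oR totient_pfactor //= => dv.
have pfX : p.-group (f @* X) by rewrite morphim_pgroup.
have co : coprime #|f @* X| (r.-1 * r ^ e).
  rewrite (pnat_coprime pfX) // p'natE // Euclid_dvdM // negb_or.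
  rewrite gtnNdvd ?prime_gt1 //=; last first.
  - by rewrite (leq_ltn_trans (leq_pred r)).
  - by rewrite -ltnS prednK ?prime_gt0 ?prime_gt1.
  rewrite Euclid_dvdX // negb_and dvdn_prime2 //; apply/orP; left.
  by apply: contraL ltrp => /eqP->; rewrite ltnn.
have /card1_trivg fX1 : #|f @* X| = 1%N.
  by apply/eqP; rewrite -dvdn1 -(Gauss_dvdl 1 co) mul1n.
by rewrite -ker_conj_aut /ker -(sub_morphim_pre f) // fX1.
Qed.

(** * Solvable subgroups with the full 2-part or 3-part of the order *)

Section MinSimpleCyclic.
Variable gT : finGroupType.
Hypothesis solP : forall H : {group gT}, H :!=: [set: gT] -> solvable H.
Hypothesis nsolG : ~~ solvable [set: gT].
Hypothesis simpleG : forall N : {group gT}, N <| [set: gT] -> N :!=: 1 -> N :=: [set: gT].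
Hypothesis sol2 : forall x y : gT, solvable <<[set x; y]>>.
Variables (p : nat) (x : gT).
Hypotheses (p_pr : prime p) (p_gt3 : 3 < p) (ox : #[x] = p).
Hypothesis cycp : forall S : {group gT}, p.-group S -> cyclic S.

Let N := 'N(<[x]>)%G.
Let px : p.-elt x. Proof. exact: order_p_elt. Qed.
Let ntx : x != 1. Proof. by rewrite -order_gt1 ox prime_gt1. Qed.
Let Nx : x \in N. Proof. by rewrite (subsetP (normG _)) ?cycle_id. Qed.
Let solN : solvable N.
Proof. by apply: (sol_norm solP nsolG simpleG); rewrite ?cycle_eq1 ?abelian_sol ?cycle_abelian. Qed.

Section MaxPart.
Variables (b : nat).
Hypotheses (b_pr : prime b) (b_le3 : b <= 3).

Let nbp : b != p. Proof. by rewrite neq_ltn (leq_ltn_trans b_le3). Qed.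
Let b'p (H : {group gT}) : b.-group H -> p^'.-group H.
Proof. by apply: sub_pgroup => q; rewrite !inE => /eqP->. Qed.
Let b'pe (u : gT) : b.-elt u -> p^'.-elt u.
Proof. exact: b'p. Qed.

(** ['C_V[n]] and its conjugate ['C_V[n ^ x]] meet in the centralizer of [y = [~ n, x]], which
    generates [<[x]>]; so they meet trivially. If ['C_Z[n]] had index at most [b], then
    [#|V| <= b ^ 2], while [p] divides [#|V| - 1]. *)
Lemma comm_card_lt (Z : {group gT}) n :
    b.-group Z -> abelian Z -> x \in 'N(Z) -> ~~ (Z \subset 'C[x]) -> n \in N -> n \notin 'C[x] ->
  b * #|'C_Z[n]| < #|Z|.
Proof.
move=> bZ abZ nZx ncZ Nn ncn; rewrite ltnNge; apply/negP=> le.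
pose V := [~: Z, <[x]>]%G.
have nZX : <[x]> \subset 'N(Z) by rewrite cycle_subG.
have sVZ : V \subset Z by rewrite commg_subl.
have coZx : coprime #|Z| #|<[x]>|.
  by rewrite coprime_sym (pnat_coprime px) // [_.-nat _](b'p bZ).
have TI : 'C_V(<[x]>) = 1 := coprime_abel_cent_TI nZX coZx abZ.
have ntV : V :!=: 1.
  apply: contraNneq ncZ => V1; rewrite -cent_cycle; exact/commG1P.
have nVX : <[x]> \subset 'N(V) by rewrite commg_normr.
have bV := pgroupS sVZ bZ.
have modV : #|V| = 1 %[mod p].
  have acts : [acts <[x]>, on V | 'J] by rewrite astabsJ.
  by rewrite (pgroup_fix_mod px acts) afixJ -[_ :&: _]/('C_V(<[x]>)) TI cards1.
have [y xy nty] : exists2 y, y = n^-1 * n ^ x & (y \in <[x]>) && (y != 1).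
  exists (n^-1 * n ^ x) => //; apply/andP; split.
    by rewrite -commgEl commgEr groupM ?cycle_id // memJ_norm // groupV cycle_id.
  rewrite -eq_mulVg1 eq_sym; apply: contra ncn => /eqP/conjg_fixP/commgP.
  by move/cent1P.
have {nty} [Xy nty] := andP nty.
have TIn : 'C_V[n] :&: 'C_V[n ^ x] = 1.
  apply/trivgP/subsetP=> v /setIP[/setIP[Vv /cent1P cn] /setIP[_ /cent1P cnx]].
  rewrite -TI inE Vv /=.
  have cvy : v \in 'C[y].
    by apply/cent1P; rewrite xy; apply: commuteM => //; apply: commuteV.
  have eqxy : <[x]> = <[y]>.
    apply/eqP; rewrite eqEsubset [<[y]> \subset _]cycle_subG Xy andbT.
    apply: prime_meetG; first by rewrite -[#|_|]/#[x] ox.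
    by apply/trivgPn; exists y; rewrite // inE Xy cycle_id.
  by rewrite eqxy cent_cycle.
have cardV2 : #|'C_V[n]| * #|'C_V[n]| <= #|V|.
  have eqc : #|'C_V[n ^ x]| = #|'C_V[n]|.
    by rewrite -(cardJg 'C_V[n] x) conjIg -cent1J (normP _) // -cycle_subG.
  rewrite -{2}eqc.
  by rewrite -TI_cardMg // subset_leq_card // mul_subG ?subsetIl.
have leV : #|V| <= b * #|'C_V[n]|.
  have := mul_cardG V 'C_Z[n]; have -> : V :&: 'C_Z[n] = 'C_V[n] by rewrite setIA (setIidPl sVZ).
  move=> E; rewrite -(leq_pmul2r (cardG_gt0 'C_Z[n])) E.
  rewrite mulnAC leq_pmul2r ?cardG_gt0 // (leq_trans _ le) // subset_leq_card //.
  by rewrite mul_subG ?subsetIl.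
have leVb : #|V| <= b ^ 2.
  rewrite -(leq_pmul2r (cardG_gt0 V)) (leq_trans (leq_mul leV leV)) //.
  by rewrite mulnACA mulnn leq_mul2l cardV2 orbT.
have pdvd : p %| #|V| - 1 by rewrite -eqn_mod_dvd ?cardG_gt0 //; apply/eqP.
have [_ _ [k oV]] := pgroup_pdiv bV ntV.
move: leVb pdvd; rewrite oV leq_exp2l ?prime_gt1 // => lek.
have : (b == 2) || (b == 3) by case: (b) b_pr b_le3 => [|[|[|[|]]]].
have small q : 0 < q -> q <= 3 -> (p %| q) = false.
  by move=> q0 q3; rewrite gtnNdvd // (leq_ltn_trans q3).
case/orP=> /eqP->; case: (k) lek => [|[|]] // _.
- by rewrite small.
- by rewrite small.
- by rewrite small.
by rewrite (_ : (3 ^ 2 - 1 = 2 ^ 3)%N) // Euclid_dvdX // small.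
Qed.

Section Extremal.
Variable m : nat.
Hypothesis lt_m : m < #|[set: gT]|`_b.
Hypothesis max_m : forall L : {group gT}, solvable L -> x \in L -> #|L|`_b <= m.

Let nobig (S L : {group gT}) : b.-group S -> solvable L -> x \in L -> S \subset L -> #|S| <= m.
Proof.
move=> bS solL Lx sSL; apply: leq_trans (max_m solL Lx).
rewrite dvdn_leq // -(part_pnat_id bS) partn_dvd ?cardSg ?cardG_gt0 //.
Qed.

Let extend (T S : {group gT}) : b.-group T -> #|T| <= m -> b.-Sylow([set: gT]) S -> T \subset S ->
  exists g, [/\ g \in 'N(T), b.-group (T <*> <[g]>) & #|T| < #|T <*> <[g]>|].
Proof.
move=> bT leT sylS sTS; have bS := pHall_pgroup sylS.
have prTS : T \proper S.
  by rewrite properEcard sTS (card_Hall sylS) (leq_ltn_trans leT).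
have := nilpotent_proper_norm (pgroup_nil bS) prTS.
rewrite properE => /andP[_ /subsetPn[g /setIP[Sg Ng] nTg]].
exists g; split=> //.
  by rewrite (pgroupS _ bS) // join_subG sTS cycle_subG.
apply: proper_card; rewrite properE joing_subl /=.
by apply: contra nTg => /subsetP; apply; rewrite mem_gen // inE cycle_id orbT.
Qed.

(** Let [T] be Sylow in [N] and let [g] in ['N(T)] enlarge it. Each [t] in [T] acts on [<[x]>] and
    [<[x ^ g]>] by the same power, as they agree modulo a [p']-core; so [g] centralizes [T] modulo
    ['C_T[x]]. Then [T <*> <[g]>] and [x] lie in a common solvable group: ['N('C_T[x])], or the
    group they generate if ['C_T[x]] is trivial. *)
Lemma norm_x_lt : (#|N|`_b)%N != m.
Proof.
apply/eqP=> Nm; have [T sylT] := Sylow_exists b N.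
have [sTN bT _] := and3P sylT.
have oT : #|T| = m by rewrite (card_Hall sylT).
have [S sylS sTS] := Sylow_superset (subsetT T) bT.
have [|g [Ng bTg ltTg]] := extend bT _ sylS sTS; first by rewrite oT.
have act t : t \in T -> x ^ (t ^ g^-1) = x ^ t.
  move=> Tt; have [v def_v] : {v | v = x ^ g} by exists (x ^ g).
  pose X := (<[x]> <*> <[v]>)%G.
  have solX : solvable X.
    apply: solvableS (sol2 x v); rewrite join_subG !cycle_subG.
    by rewrite !mem_gen ?set21 ?set22.
  have Nt : t \in 'N(<[x]>) := subsetP sTN t Tt.
  have Ntv : t \in 'N(<[v]>).
    by rewrite def_v cycleJ normJ mem_conjg (subsetP sTN) // memJ_norm ?groupV.
  have nXt : <[t]> \subset 'N(X) by rewrite normsY // cycle_subG.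
  have solY := solvable_joing solX (abelian_sol (cycle_abelian t)) nXt.
  pose Y := (X <*> <[t]>)%G.
  have Xx : x \in X by rewrite mem_gen // inE cycle_id.
  have Xv : v \in X by rewrite mem_gen // inE cycle_id orbT.
  have Yx : x \in Y by rewrite mem_gen // inE Xx.
  have Yv : v \in Y by rewrite mem_gen // inE Xv.
  have Yt : t \in Y by rewrite mem_gen // inE cycle_id orbT.
  have ov : #[v] = p by rewrite def_v orderJ.
  have NY z : z \in Y -> z \in 'N('O_p^'(Y)) by apply: subsetP; apply: gFnorm.
  have eqc := order_p_cosets p_pr cycp solY Yx Yv ox ov.
  have /cycleP[i defv] : coset 'O_p^'(Y) v \in <[coset 'O_p^'(Y) x]> by rewrite eqc cycle_id.
  have /cycleP[k defxt] : x ^ t \in <[x]> by rewrite memJ_norm ?cycle_id.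
  have eqv : v ^ t = v ^+ k.
    apply/eqP; rewrite eq_mulgV1; apply/eqP/set1gP.
    have pv : p.-elt v by rewrite def_v p_eltJ.
    rewrite -(coprime_TIg (pnat_coprime pv (pcore_pgroup p^' Y))) inE.
    rewrite groupM ?groupV ?mem_cycle ?memJ_norm ?cycle_id //=.
    apply: coset_idr; first by rewrite groupM ?groupV ?groupX ?NY ?groupJ.
    rewrite morphM ?groupV ?groupX ?NY ?groupJ // morphV ?groupX ?NY // morphX ?NY //.
    rewrite morphJ ?NY //= defv conjXg.
    rewrite -[coset _ x]/(coset_morphism _ x) -[coset _ t]/(coset_morphism _ t) -morphJ ?NY //
      defxt morphX ?NY //.
    by rewrite -!expgM mulnC mulgV.
  have -> : x ^ (t ^ g^-1) = (v ^ t) ^ g^-1.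
    by rewrite def_v [t ^ g^-1]conjgE invgK !conjgM.
  by rewrite eqv conjXg def_v conjgK defxt.
pose T0 := 'C_T[x]%G.
have [T01|ntT0] := eqVneq (T0 : {set gT}) 1.
  have cgT : T \subset 'C(<[g]>).
    rewrite cent_cycle; apply/subsetP=> t Tt; apply/cent1P/commgP/conjg_fixP.
    have Tgt : t ^ g^-1 \in T by rewrite memJ_norm ?groupV.
    have : t ^ g^-1 * t^-1 \in T0.
      rewrite inE groupM ?groupV //=; apply/cent1P/commute_sym/commgP/conjg_fixP.
      by rewrite conjgM act // conjgK.
    rewrite T01 => /set1gP/eqP; rewrite -eq_mulgV1 => /eqP E.
    by rewrite -{1}E conjgKV.
  pose X := (<[x]> <*> <[g]>)%G.
  have solX : solvable X.
    apply: solvableS (sol2 x g); rewrite join_subG !cycle_subG.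
    by rewrite !mem_gen ?set21 ?set22.
  have nXT : T \subset 'N(X) by rewrite normsY // (subset_trans cgT) ?cent_sub.
  have solY := solvable_joing solX (pgroup_sol bT) nXT.
  have := @nobig (T <*> <[g]>)%G (X <*> T)%G bTg solY.
  rewrite leqNgt -oT ltTg => H; have: false; last by [].
  apply: H; first by rewrite mem_gen // inE mem_gen // inE cycle_id.
  rewrite join_subG joing_subr cycle_subG mem_gen // inE mem_gen //.
  by rewrite inE cycle_id orbT.
have NgT0 : g \in 'N(T0).
  rewrite -groupV inE; apply/subsetP=> _ /imsetP[t /setIP[Tt cxt] ->].
  rewrite inE memJ_norm ?groupV // Tt /=; apply/cent1P/commute_sym/commgP/conjg_fixP.
  by rewrite act //; apply/conjg_fixP/commgP/commute_sym/cent1P.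
have bT0 : b.-group T0 := pgroupS (subsetIl _ _) bT.
have := @nobig (T <*> <[g]>)%G 'N(T0)%G bTg (sol_norm solP nsolG simpleG ntT0 (pgroup_sol bT0)).
rewrite leqNgt -oT ltTg => H; have: false; last by [].
apply: H.
  rewrite (subsetP (cent_sub _)) //; apply/centP=> t /setIP[_ /cent1P]; exact: commute_sym.
rewrite join_subG cycle_subG NgT0 andbT normsI ?normG //.
by rewrite /= -cent_cycle norms_cent.
Qed.

Lemma Sylow_norm_x_contra (L R : {group gT}) : solvable L -> x \in L -> (#|L|`_b)%N = m ->
  b.-Sylow('O_p^'(L)) R -> R \subset N -> False.
Proof.
move=> solL Lx Lm sylR sRN.
have sRK := pHall_sub sylR.
have sylRN : b.-Sylow('N_('O_p^'(L))(<[x]>)) R.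
  by apply: (pHall_subl _ _ sylR); rewrite ?subsetIl // subsetI sRK.
have := order_p_normsub p_pr cycp solL Lx ox sylR.
rewrite -(card_Hall sylRN) mulnC => /eqP; rewrite eqn_pmul2l ?cardG_gt0 // => /eqP eqm.
case/eqP: norm_x_lt; apply/eqP; rewrite eqn_leq max_m //= -Lm eqm.
by rewrite dvdn_leq // partn_dvd ?cardG_gt0 // cardSg ?subsetIr.
Qed.

(** The aim is a nontrivial [b]-group normalized by [x] and by a [b]-group of order greater than
    [m]. It is Thompson's subgroup [J] of a group [Gm] of order [m], generated by the elementary
    abelian subgroups of largest order; [x] normalizes it once these are shown to lie in the
    [x]-invariant group [R]. *)
Lemma extremal_contra (L0 : {group gT}) : solvable L0 -> x \in L0 -> (#|L0|`_b)%N = m -> False.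
Proof.
move=> solL0 L0x L0m.
pose good (L : {group gT}) := [&& solvable L, x \in L & (#|L|`_b)%N == m].
have gL0 : good L0 by rewrite /good solL0 L0x L0m eqxx.
case: (@arg_maxnP _ L0 good (fun L : {group gT} => (#|'O_p^'(L)|`_b)%N) gL0) => L2 /and3P[solL2
  L2x /eqP L2m] max2.
have p'K2 : p^'.-group 'O_p^'(L2) := pcore_pgroup _ _.
have nK2x : <[x]> \subset 'N('O_p^'(L2)) by rewrite cycle_subG (subsetP (gFnorm _ L2)).
have [|R sylR nRx] := sol_coprime_Sylow_exists b (abelian_sol (cycle_abelian x)) nK2x.
  by rewrite coprime_sym (pnat_coprime px).
have [sRK2 bR _] := and3P sylR.
have [R1|ntR] := eqsVneq R 1.
  by apply: (Sylow_norm_x_contra solL2 L2x L2m sylR); rewrite R1 sub1G.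
(* The extremal choice of [L2] makes [R] Sylow in the [p']-core of ['N(R)] too, so [L] may replace
   [L2]. *)
pose L := 'N(R)%G.
have solL : solvable L := sol_norm solP nsolG simpleG ntR (pgroup_sol bR).
have Lx : x \in L by rewrite -cycle_subG.
have Lm : (#|L|`_b)%N = m.
  apply/eqP; rewrite eqn_leq max_m //=.
  have := mul_cardG 'O_p^'(L2) 'N_L2(R).
  rewrite (Frattini_arg (pcore_normal _ _) sylR) => /(congr1 (fun n => (n`_b)%N)).
  rewrite !partnM ?cardG_gt0 // L2m -(card_Hall sylR).
  have sylRN : b.-Sylow('O_p^'(L2) :&: 'N_L2(R)) R.
    apply: pHall_subl sylR; rewrite ?subsetIl // !subsetI sRK2 normG andbT.
    by rewrite (subset_trans sRK2) ?pcore_sub.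
  rewrite -(card_Hall sylRN) mulnC => /eqP; rewrite eqn_pmul2r ?cardG_gt0 // => /eqP <-.
  by rewrite dvdn_leq // partn_dvd ?cardG_gt0 // cardSg ?subsetIr.
pose K := 'O_p^'(L)%G.
have sRK : R \subset K by apply: pcore_max; [apply: b'p | apply: normalG].
have sylRK : b.-Sylow(K) R.
  rewrite pHallE sRK /= eqn_leq; apply/andP; split.
    by rewrite dvdn_leq // -(part_pnat_id bR) partn_dvd ?cardSg ?cardG_gt0.
  by rewrite (card_Hall sylR); apply: max2; rewrite /good solL Lx Lm eqxx.
have [sRN|nRN] := boolP (R \subset N).
  exact: (Sylow_norm_x_contra solL Lx Lm sylRK).
have ncR : x \notin 'C(R).
  apply: contra nRN => cRx; rewrite (subset_trans _ (cent_sub _)) // cent_cycle.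
  by rewrite sub_cent1.
pose NL := 'N_L(<[x]>)%G; pose Q := (R <*> NL)%G.
have nRNL : NL \subset 'N(R) := subsetIl _ _.
have sQL : Q \subset L by rewrite join_subG normG subsetIl.
have leQ : m <= #|Q|`_b.
  have E := order_p_normsub p_pr cycp solL Lx ox sylRK.
  have := mul_cardG R NL; rewrite -norm_joinEr // => /(congr1 (fun n => (n`_b)%N)).
  rewrite !partnM ?cardG_gt0 // (part_pnat_id bR) -E Lm.
  have bRN : b.-group (R :&: NL) := pgroupS (subsetIl _ _) bR.
  rewrite (part_pnat_id bRN) => E2.
  rewrite -(leq_pmul2r (part_gt0 b #|'N_K(<[x]>)|)) E2 leq_mul2l; apply/orP; right.
  rewrite dvdn_leq // -(part_pnat_id bRN) partn_dvd ?cardG_gt0 // cardSg //.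
  by rewrite subsetI (subset_trans (subsetIl _ _) sRK) (subset_trans (subsetIr _ _)) ?subsetIr.
have [Gm sylGm sRG] := Sylow_superset (joing_subl R NL) bR.
have [sGQ bG _] := and3P sylGm.
have sGL := subset_trans sGQ sQL.
have oGm : #|Gm| = m.
  by apply/eqP; rewrite eqn_leq (nobig bG solL Lx sGL) (card_Hall sylGm).
have decomp t : t \in Gm -> exists2 r, r \in R & exists2 n, n \in Gm :&: N & t = r * n.
  move=> Gt; have := subsetP sGQ t Gt; rewrite /= norm_joinEr // => /mulsgP[r n Rr /setIP[_ Nn]
    deft].
  exists r => //; exists n => //; rewrite inE Nn andbT.
  by rewrite -(groupMl _ (subsetP sRG r Rr)) -deft.
have fact1 n : n \in Gm :&: N -> n \in 'C[x] -> n \in R.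
  case/setIP=> Gn _ cxn; have Kn : n \in K.
    apply: (p'elt_cent_order_p p_pr cycp solL Lx ox); rewrite ?(subsetP sGL) //.
      exact/b'pe/(mem_p_elt bG).
    by rewrite (_ : [~ x, n] = 1) ?group1 //; apply/eqP/commgP/commute_sym/cent1P.
  have <- : Gm :&: K = R :> {set gT}; last by rewrite inE Gn.
  apply: (sub_pHall sylRK); rewrite ?subsetIr ?(pgroupS (subsetIl _ _) bG) //.
  by rewrite subsetI sRG.
(* If the factor of [c] in [N] moved [x], then [[~ c, x]] would centralize [R] and have nontrivial
   [p]-part. This part generates a conjugate of [<[x]>] under an element normalizing [R], so [x]
   would centralize [R]. *)
have fact2 c : c \in Gm -> c \in 'C(R) -> c \in R.
  move=> Gc cRc; have [r Rr [n GNn defc]] := decomp c Gc.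
  have [cxn|ncxn] := boolP (n \in 'C[x]); first by rewrite defc groupM // fact1.
  case/negP: ncR; have [Gn Nn] := setIP GNn.
  pose u := c^-1 * c ^ x; pose y := n^-1 * n ^ x; pose rho := (r^-1 * r ^ x) ^ n.
  have nRC : 'N(R) \subset 'N('C(R)) := norms_cent (subxx _).
  have nCx : x \in 'N('C(R)) by rewrite (subsetP nRC).
  have cRu : u \in 'C(R) by rewrite groupM ?groupV ?memJ_norm.
  have Xy : y \in <[x]> by rewrite -[y]commgEl commgEr groupM ?cycle_id // memJ_norm // groupV
    cycle_id.
  have nty : y != 1.
    rewrite -eq_mulVg1 eq_sym; apply: contra ncxn => /eqP/conjg_fixP/commgP.
    by move/cent1P.
  have nRn : n \in 'N(R) by apply: (subsetP sGL).
  have Rrho : rho \in R by rewrite memJ_norm // groupM ?groupV // memJ_norm.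
  have defu : u = rho * y.
    rewrite /u /rho /y defc conjMg; move: (r ^ x) (n ^ x) => rx nx.
    by rewrite conjgE invMg !mulgA mulgK.
  have p'R := b'p bR.
  have sylx := Sylow_joing_cycle px Lx p'R.
  pose RX := (R <*> <[x]>)%G; pose z := u.`_p.
  have RXx : x \in RX by rewrite mem_gen // inE cycle_id orbT.
  have RXu : u \in RX by rewrite defu groupM // mem_gen // inE ?Rrho ?Xy ?orbT.
  have ntz : z != 1.
    apply: contra nty => /eqP z1; have p'u : p^'.-elt u.
      by rewrite -(consttC p u) -/z z1 mul1g p_elt_constt.
    have Ny : y \in 'N(R) by rewrite groupM ?groupV ?groupJ.
    have eqc : coset R u = coset R y by rewrite defu coset_kerl.
    have p'c : p^'.-elt (coset R y).
      rewrite -eqc; apply: (morph_p_elt (coset_morphism R)) => //.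
      by rewrite defu groupM // (subsetP (normG R)).
    have pc : p.-elt (coset R y) by apply: (morph_p_elt (coset_morphism R)) => //;
      apply: mem_p_elt px Xy.
    have /(coset_idr Ny) Ry : coset R y = 1.
      by apply: (pi'_elt_pgroup1 (pi := p) (G := <[coset R y]>)) => //; rewrite cycle_id.
    by apply/eqP/set1gP; rewrite -(coprime_TIg (pnat_coprime px p'R)) inE Xy.
  have [k RXk szk] : exists2 k, k \in RX & <[z]> :^ k \subset <[x]>.
    by apply: (Sylow_Jsub sylx); rewrite ?cycle_subG ?groupX // [_.-group _]p_elt_constt.
  have sxz : <[x]> \subset <[z]> :^ k.
    apply: (prime_meetG (H := (<[z]> :^ k)%G)); first by rewrite -[#|_|]/#[x] ox.
    by rewrite /= (setIidPr szk) trivg_card1 cardJg -trivg_card1 cycle_eq1.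
  have := subsetP sxz x (cycle_id x); apply: subsetP.
  have Nk : k \in 'N(R) by apply: subsetP RXk; rewrite join_subG normG cycle_subG.
  have nCk : k \in 'N('C(R)) by rewrite (subsetP nRC).
  by rewrite -(normP nCk) conjSg cycle_subG groupX.
have [S sylS sGS] := Sylow_superset (subsetT Gm) bG.
have bS := pHall_pgroup sylS.
have ltS : m < #|S| by rewrite (card_Hall sylS).
have ntS : S :!=: 1 by rewrite -cardG_gt1 (leq_ltn_trans _ ltS) // -oGm cardG_gt0.
have ntZS : 'Z(S) != 1 by rewrite center_nil_eq1 ?(pgroup_nil bS).
have [_ bdvd _] := pgroup_pdiv (pgroupS (center_sub S) bS) ntZS.
have [z /setIP[Sz cSz] oz] := Cauchy b_pr bdvd.
have cRz : z \in 'C(R) by rewrite (subsetP (centS (subset_trans sRG sGS))).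
have Rz : z \in R.
  apply: fact2 => //; have <- : S :&: L = Gm.
    apply/esym/eqP; rewrite eqEcard subsetI sGS sGL oGm.
    by apply: (nobig (S := (S :&: L)%G) _ solL Lx); rewrite ?subsetIr ?(pgroupS (subsetIl _ _) bS).
  by rewrite inE Sz (subsetP (cent_sub R)).
pose Z := 'Ohm_1('Z(R))%G.
have sZZ : Z \subset 'Z(R) := Ohm_sub 1 _.
have sZR : Z \subset R := subset_trans sZZ (center_sub R).
have cZR : R \subset 'C(Z) by rewrite centsC (subset_trans sZZ) ?subsetIr.
have bZR : b.-group 'Z(R) := pgroupS (center_sub R) bR.
have abelZ : b.-abelem Z by apply: Ohm1_abelem (center_abelian R).
have Zz : z \in Z.
  by rewrite /= (OhmE 1 bZR) mem_gen // !inE Rz cRz /= -order_dvdn oz expn1.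
have nZx : x \in 'N(Z).
  rewrite -cycle_subG (char_norm_trans (char_trans (Ohm_char 1 _) (center_char R))) //.
have nte : z != 1 by rewrite -order_gt1 oz prime_gt1.
have ncZ : ~~ (Z \subset 'C[x]).
  apply/negP=> /subsetP/(_ z Zz)/cent1P czx.
  have := nobig bS (sol_cent1 solP nsolG simpleG nte); rewrite leqNgt ltS => H.
  have: false; last by []. apply: H; first by apply/cent1P.
  by rewrite sub_cent1.
have claim3 n : n \in N -> n \notin 'C[x] -> b * #|'C_Z[n]| < #|Z|.
  by apply: comm_card_lt; rewrite ?(abelem_pgroup abelZ) ?(abelem_abelian abelZ).
(* [Gm :&: N] covers [Gm / R] and acts on [<[x]>] with kernel inside [R]; the automorphism group of
   [<[x]>] is cyclic. *)
have cycGR : cyclic (Gm / R).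
  pose f := conj_aut_morphism <[x]>; pose J := (Gm :&: N)%G.
  have sJN : J \subset N := subsetIr _ _.
  have cycf : cyclic (f @* J).
    by apply: cyclicS (Aut_prime_cycle_cyclic _); [apply: Aut_conj_aut | rewrite ox].
  have /cyclicP[s0 deff] := cycf.
  have : s0 \in f @* J by rewrite deff cycle_id.
  case/morphimP=> s Ns Js defs.
  have sGs : Gm \subset R * <[s]>.
    apply/subsetP=> t /decomp[r Rr [n Jn ->]].
    have [Gn Nn] := setIP Jn.
    have : f n \in <[f s]> by rewrite -[f s]defs -deff mem_morphim.
    case/cycleP=> i fn; have Jns : n * s ^- i \in J by rewrite groupM ?groupV ?groupX.
    have cns : n * s ^- i \in 'C[x].
      rewrite -cent_cycle -ker_conj_aut; apply/kerP; first by rewrite groupM ?groupV ?groupX.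
      rewrite [LHS]morphM ?groupV ?groupX // morphV ?groupX // morphX //.
      by rewrite [conj_aut_morphism _ n]fn mulgV.
    rewrite -(mulgKV (s ^+ i) n) mulgA mem_mulg ?mem_cycle // groupM // fact1 //.
  have nRs : s \in 'N(R) by rewrite (subsetP sGL) //; case/setIP: Js.
  apply: cyclicS (cycle_cyclic (coset R s)).
  rewrite /= -[<[_]>]/<[coset R s]> -(quotient_cycle nRs) -(quotientMidl R <[s]>) quotientS //.
(* If [t] in [A] lies outside [R], compare [A] with [A0 <*> Z]. Passing from [A] to [A0] loses at
   most a factor [b], since [Gm / R] is cyclic; adjoining [Z] gains more than [b] by [claim3], as
   [A0 :&: Z] lies in ['C_Z[t]]. *)
have claim4 (A : {group gT}) : b.-abelem A -> A \subset Gm ->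
    (forall B : {group gT}, b.-abelem B -> B \subset Gm -> #|B| <= #|A|) -> A \subset R.
  move=> abelA sAG maxA; apply/idPn=> /subsetPn[t At nRt].
  have Gt := subsetP sAG t At; have [r Rr [n GNn deft]] := decomp t Gt.
  have [Gn Nn] := setIP GNn.
  have ncxn : n \notin 'C[x] by apply: contra nRt => cxn; rewrite deft groupM // fact1.
  have eqC : 'C_Z[t] = 'C_Z[n].
    apply/setP=> v; rewrite !in_setI; apply: andb_id2l => Zv.
    have cvr : r \in 'C[v] by apply/cent1P; apply: (centsP cZR).
    by rewrite cent1C deft groupMl // cent1C.
  have := claim3 n Nn ncxn; rewrite -eqC => ltC.
  pose A0 := (A :&: R)%G.
  have leA : #|A| <= b * #|A0|.
    rewrite -(LagrangeI A R) mulnC leq_mul2r -card_quotient ?(subset_trans sAG) //.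
    have abelAR : b.-abelem (A / R) by apply: quotient_abelem.
    rewrite (card_pgroup (abelem_pgroup abelAR)) -{3}(expn1 b) leq_exp2l ?prime_gt1 //.
    by rewrite -abelem_cyclic // (cyclicS _ cycGR) ?quotientS ?orbT.
  have cA0Z : Z \subset 'C(A0) by rewrite centsC (subset_trans (subsetIr _ _)).
  have abelB : b.-abelem (A0 <*> Z)%G.
    by rewrite (cprod_abelem b (cprodEY cA0Z)) abelZ (abelemS (subsetIl A R)).
  have := maxA _ abelB; rewrite join_subG (subset_trans (subsetIl _ _)) // (subset_trans sZR) //
    => /(_ isT) leB.
  have E := mul_cardG A0 Z; rewrite -cent_joinEr // in E.
  have leI : #|A0 :&: Z| <= #|'C_Z[t]|.
    rewrite subset_leq_card // subsetI subsetIr /=.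
    rewrite (subset_trans (subsetIl _ _)) // (subset_trans (subsetIl _ _)) //.
    by rewrite sub_cent1 (subsetP (abelem_abelian abelA)).
  have := leq_mul leB leI; rewrite -E leqNgt => /negP[].
  apply: leq_ltn_trans (_ : b * #|A0| * #|'C_Z[t]| < _); first by rewrite leq_mul2r leA orbT.
  by rewrite mulnAC mulnC ltn_pmul2l ?cardG_gt0.
pose good2 (A : {group gT}) := b.-abelem A && (A \subset Gm).
pose maxA (A : {group gT}) := good2 A && [forall B : {group gT}, good2 B ==> (#|B| <= #|A|)].
have maxAR A : maxA A -> A \subset R.
  case/andP=> /andP[abelA sAG] /forallP H; apply: claim4 => // B abelB sBG.
  by apply: (implyP (H B)); rewrite /good2 abelB.
pose J := <<\bigcup_(A : {group gT} | maxA A) A>>%G.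
have sJR : J \subset R by rewrite gen_subG; apply/bigcupsP.
have normJ y : (forall A : {group gT}, maxA A -> A :^ y \subset Gm) -> y \in 'N(J).
  move=> H; rewrite inE /= -genJ genS //; apply/subsetP=> _ /imsetP[w /bigcupP[A mA Aw] ->].
  apply/bigcupP; exists (A :^ y)%G; last by rewrite memJ_conjg.
  have /andP[/andP[abelA sAG] /forallP H'] := mA.
  rewrite /maxA /good2 /= abelemJ abelA H //=.
  by apply/forallP=> B; have := H' B; rewrite /good2 cardJg.
have ntJ : J :!=: 1.
  have gZ : good2 Z by rewrite /good2 abelZ (subset_trans sZR).
  case: (@arg_maxnP _ Z good2 (fun A : {group gT} => #|A|) gZ) => A gA mA.
  have sAJ : A \subset J.
    rewrite sub_gen // (bigcup_max A) // /maxA gA; apply/forallP=> B; apply/implyP; exact: mA.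
  rewrite -cardG_gt1 (leq_trans _ (subset_leq_card sAJ)) // (leq_trans _ (mA Z gZ)) //.
  by rewrite cardG_gt1; apply/trivgPn; exists z.
have [|g [Ng bGg ltGg]] := extend bG _ sylS sGS; first by rewrite oGm.
have := nobig bGg (sol_norm solP nsolG simpleG ntJ (solvableS sJR (pgroup_sol bR))).
rewrite leqNgt -oGm ltGg => H; have: false; last by []. apply: H.
  apply: normJ => A /maxAR sAR; apply: subset_trans sRG.
  by rewrite -(normP (subsetP nRx x (cycle_id x))) conjSg.
rewrite join_subG cycle_subG; apply/andP; split.
  apply/subsetP=> y Gy; apply: normJ => A /andP[/andP[_ sAG] _].
  by rewrite -(conjGid Gy) conjSg.
apply: normJ => A /andP[/andP[_ sAG] _].
by rewrite -(normP Ng) conjSg.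
Qed.

End Extremal.

Lemma big_solvable : exists L : {group gT},
  [/\ solvable L, x \in L & (#|L|`_b)%N = (#|[set: gT]|`_b)%N].
Proof.
pose good (L : {group gT}) := solvable L && (x \in L).
have gx : good <[x]>%G by rewrite /good abelian_sol ?cycle_abelian ?cycle_id.
case: (@arg_maxnP _ <[x]>%G good (fun L : {group gT} => (#|L|`_b)%N) gx) => L /andP[solL Lx] maxL.
exists L; split=> //; apply/eqP; rewrite eqn_leq; apply/andP; split.
  by rewrite dvdn_leq // partn_dvd ?cardG_gt0 // cardSg ?subsetT.
rewrite leqNgt; apply/negP=> ltL; apply: (extremal_contra ltL _ solL Lx erefl).
by move=> L' solL' L'x; apply: maxL; rewrite /good solL'.
Qed.

Lemma big_pgroup : exists R : {group gT},
  [/\ b.-group R, x \in 'N(R) & (#|[set: gT] : N|`_b)%N <= #|R : R :&: N|].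
Proof.
have [L [solL Lx Lb]] := big_solvable.
have p'K : p^'.-group 'O_p^'(L) := pcore_pgroup _ _.
have nKx : <[x]> \subset 'N('O_p^'(L)) by rewrite cycle_subG (subsetP (gFnorm _ L)).
have [|R sylR nRx] := sol_coprime_Sylow_exists b (abelian_sol (cycle_abelian x)) nKx.
  by rewrite coprime_sym (pnat_coprime px).
have [sRK bR _] := and3P sylR.
exists R; split=> //; first by rewrite -cycle_subG.
have := order_p_normsub p_pr cycp solL Lx ox sylR.
rewrite Lb -(Lagrange (subsetT N)) partnM ?cardG_gt0 // => E.
have bRN : b.-group (R :&: N) := pgroupS (subsetIl _ _) bR.
have leN : #|R :&: N| <= (#|'N_('O_p^'(L))(<[x]>)|`_b)%N.
  by rewrite dvdn_leq // -(part_pnat_id bRN) partn_dvd ?cardG_gt0 // cardSg ?setSI.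
have leNL : (#|'N_L(<[x]>)|`_b)%N <= (#|N|`_b)%N.
  by rewrite dvdn_leq // partn_dvd ?cardG_gt0 // cardSg ?subsetIr.
have : (#|N|`_b * #|[set: gT] : N|`_b * #|'N_('O_p^'(L))(<[x]>)|`_b)%N <=
  #|'N_('O_p^'(L))(<[x]>)|`_b * #|R : R :&: N| * #|N|`_b.
  rewrite E -(Lagrange (subsetIl R N)) leq_mul // leq_mul2r leN orbT //.
rewrite [X in _ <= X -> _]mulnC -mulnA leq_pmul2l // [X in _ <= X -> _]mulnC.
by rewrite leq_pmul2r.
Qed.

End MaxPart.
End MinSimpleCyclic.

(** * Similarity of elements of order p *)

Section Similarity.
Variables (gT : finGroupType) (p : nat).
Hypothesis p_pr : prime p.
Hypothesis cycp : forall S : {group gT}, p.-group S -> cyclic S.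
Hypothesis sol2 : forall x y : gT, solvable <<[set x; y]>>.
Implicit Types (X : {group gT}) (pi : nat_pred) (u v w y z t s g h : gT).

(** For elements of order [p] in a solvable subgroup this is equality modulo its [p']-core. No
    subgroup appears in the definition, at the price that transitivity has to be proved. *)
Definition sim (u v : gT) := p^'.-elt (u * v^-1).

Lemma sim_sym u v : sim u v = sim v u.
Proof. by rewrite /sim -p_eltV invMg invgK. Qed.

Lemma simJ u v g : sim (u ^ g) (v ^ g) = sim u v.
Proof. by rewrite /sim -conjVg -conjMg p_eltJ. Qed.

Let NH X z : z \in X -> z \in 'N('O_p^'(X)).
Proof. by apply: subsetP; apply: gFnorm. Qed.

Lemma mem_order_p v v1 : #[v] = p -> v1 \in <[v]> -> v1 != 1 -> #[v1] = p.
Proof.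
move=> ov Vv1 nt1; apply: nt_prime_order => //.
by apply/eqP; rewrite -order_dvdn -ov order_dvdG.
Qed.

Lemma cycle_order_p v v1 : #[v] = p -> v1 \in <[v]> -> #[v1] = p -> <[v1]> = <[v]>.
Proof.
move=> ov Vv1 o1; apply/eqP; rewrite eqEcard cycle_subG Vv1 /=.
by rewrite -!/#[_] ov o1.
Qed.

Lemma sim_coset X u v : solvable X -> u \in X -> v \in X -> #[u] = p -> #[v] = p ->
  sim u v = (coset 'O_p^'(X) u == coset 'O_p^'(X) v).
Proof.
move=> solX Xu Xv ou ov; rewrite /sim.
have cosetM : coset 'O_p^'(X) (u * v^-1) = coset 'O_p^'(X) u * (coset 'O_p^'(X) v)^-1.
  by rewrite morphM ?morphV ?groupV ?NH.
rewrite eq_mulgV1 -cosetM; apply/idP/eqP => [p'uv|].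
  apply: (pi'_elt_pgroup1 (pi := p) (G := <[coset 'O_p^'(X) v]>)).
  - by rewrite /pgroup -/#[_] (coset_order_p p_pr) // pnat_id.
  - by apply: (morph_p_elt (coset_morphism _)) => //; rewrite groupM ?groupV ?NH.
  - rewrite cosetM groupM ?groupV ?cycle_id //.
    by rewrite /= -(order_p_cosets p_pr cycp solX Xu Xv ou ov) cycle_id.
move/coset_idr => H; apply: (mem_p_elt (pcore_pgroup p^' X)); apply: H.
by rewrite groupM ?groupV ?NH.
Qed.

(** With [sim_exists], similarity to [u] selects exactly one generator of each subgroup of order
    [p]. *)
Lemma sim_uniq u v v1 v2 : #[u] = p -> #[v] = p -> v1 \in <[v]> -> v2 \in <[v]> ->
  #[v1] = p -> #[v2] = p -> sim u v1 -> sim u v2 -> v1 = v2.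
Proof.
move=> ou ov V1 V2 o1 o2; pose X := <<[set u; v]>>%G.
have Xu : u \in X by rewrite mem_gen ?set21.
have sVX : <[v]> \subset X by rewrite cycle_subG mem_gen ?set22.
have [X1 X2] := (subsetP sVX _ V1, subsetP sVX _ V2).
rewrite !(sim_coset (sol2 u v)) // => /eqP-> /eqP eqc.
have : v1 * v2^-1 \in 'O_p^'(X).
  apply: coset_idr; first by rewrite groupM ?groupV ?NH.
  by rewrite morphM ?morphV ?groupV ?NH //= eqc mulgV.
move=> H; apply/eqP; rewrite eq_mulgV1; apply/eqP.
apply: (pi'_elt_pgroup1 (order_p_elt p_pr ov)); last by rewrite groupM ?groupV.
exact: mem_p_elt (pcore_pgroup _ _) H.
Qed.

Lemma sim_exists u v : #[u] = p -> #[v] = p ->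
  exists2 v1, v1 \in <[v]> & #[v1] = p /\ sim u v1.
Proof.
move=> ou ov; pose X := <<[set u; v]>>%G.
have Xu : u \in X by rewrite mem_gen ?set21.
have Xv : v \in X by rewrite mem_gen ?set22.
have := order_p_cosets p_pr cycp (sol2 u v) Xu Xv ou ov => eqc.
have /cycleP[i defu] : coset 'O_p^'(X) u \in <[coset 'O_p^'(X) v]> by rewrite -eqc cycle_id.
exists (v ^+ i); first exact: mem_cycle.
have defu' : coset 'O_p^'(X) u = coset 'O_p^'(X) (v ^+ i) by rewrite defu -morphX ?NH.
have ovi : #[v ^+ i] = p.
  apply: (mem_order_p ov); first exact: mem_cycle.
  apply/eqP=> vi1; have := coset_order_p p_pr Xu ou; rewrite defu' vi1.
  by rewrite -[coset _ 1]/(coset_morphism _ 1) morph1 order1 => p1; move: p_pr; rewrite -p1.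
by split=> //; rewrite (sim_coset (sol2 u v)) ?groupX // defu'.
Qed.

Lemma simX u v k : #[u] = p -> #[v] = p -> #[u ^+ k] = p -> #[v ^+ k] = p ->
  sim u v -> sim (u ^+ k) (v ^+ k).
Proof.
move=> ou ov ouk ovk; pose X := <<[set u; v]>>%G.
have Xu : u \in X by rewrite mem_gen ?set21.
have Xv : v \in X by rewrite mem_gen ?set22.
rewrite !(sim_coset (sol2 u v)) ?groupX // => /eqP eqc.
rewrite -![coset _ _]/(coset_morphism _ _) !morphX ?NH //.
by rewrite [coset_morphism _ u]eqc.
Qed.

(* If z in <ts> has order p, then t and s^-1 agree modulo the normal subgroup C of
   elements centralizing z modulo O_p'(<t, s>); so t and s, a pi- and a pi'-element,
   both lie in C. *)
Lemma p'elt_mul pi t s : pi.-elt t -> pi^'.-elt s -> p^'.-elt t -> p^'.-elt s ->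
  p^'.-elt (t * s).
Proof.
move=> pit pi's p't p's; apply/idPn; rewrite /p_elt p'natE // negbK => pdvd.
have [z ts_z oz] := Cauchy p_pr pdvd.
pose Y := <<[set t; s]>>%G; have solY : solvable Y := sol2 t s.
have Yt : t \in Y by rewrite mem_gen ?set21.
have Ys : s \in Y by rewrite mem_gen ?set22.
have Yz : z \in Y by apply: subsetP ts_z; rewrite cycle_subG groupM.
pose H := 'O_p^'(Y)%G; pose zb := coset H z.
have [nsz _] := order_p_quotient_normal p_pr cycp solY Yz oz.
pose C := (coset H @*^-1 'C_(Y / H)(<[zb]>))%G.
have nsC : C <| Y.
  rewrite -(quotientGK (pcore_normal p^' Y)) cosetpre_normal.
  by rewrite /normal subsetIl normsI ?normG // norms_cent // normal_norm.
have nCY := subsetP (normal_norm nsC).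
have memC c : c \in Y -> (c \in C) = ([~ z, c] \in H).
  move=> Yc; have -> : (c \in C) = (coset H c \in 'C[zb]).
    apply/morphpreP/idP => [[_ /setIP[_]]|cc]; first by rewrite /= cent_cycle.
    by split; [apply: NH | rewrite inE mem_quotient //= cent_cycle].
  apply/cent1P/idP => [czc | Hzc].
    apply: coset_idr; first by rewrite groupR ?NH.
    rewrite -[coset _ _]/(coset_morphism _ _) morphR ?NH //; apply/eqP/commgP.
    exact: commute_sym.
  apply/commute_sym/commgP.
  by rewrite -[zb]/(coset_morphism H z) -[coset H c]/(coset_morphism H c) -morphR ?NH //= coset_id.
have Cts : t * s \in C.
  have Yts : t * s \in Y by rewrite groupM.
  rewrite memC // (_ : [~ z, t * s] = 1) ?group1 //.
  apply/eqP/commgP; have /cycleP[k ->] := ts_z; exact/commute_sym/commuteX.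
have ct1 : coset C t = 1.
  apply: (pi'_elt_pgroup1 (pi := pi^') (G := <[coset C t]>)); rewrite ?cycle_id //.
    have -> : coset C t = (coset C s)^-1.
      by apply/eqP; rewrite eq_mulgV1 invgK -morphM ?nCY // [coset_morphism _ _]coset_id.
    by rewrite /pgroup -/#[_] orderV; apply: (morph_p_elt (coset_morphism _)); rewrite ?nCY.
  by rewrite p_eltNK; apply: (morph_p_elt (coset_morphism _)); rewrite ?nCY.
have Ct : t \in C by apply: coset_idr ct1; rewrite nCY.
have Cs : s \in C by rewrite -(groupMl _ Ct).
have Ht : t \in H by apply: (p'elt_cent_order_p p_pr cycp solY Yz oz) => //; rewrite -memC.
have Hs : s \in H by apply: (p'elt_cent_order_p p_pr cycp solY Yz oz) => //; rewrite -memC.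
have := mem_p_elt (pcore_pgroup p^' Y) (groupM Ht Hs).
by rewrite /p_elt p'natE // pdvd.
Qed.

Lemma sim_trans_pi pi u v w : pi.-elt (u * v^-1) -> pi^'.-elt (v * w^-1) ->
  sim u v -> sim v w -> sim u w.
Proof.
move=> H1 H2 s1 s2; rewrite /sim -(mulgKV v u) -mulgA.
exact: p'elt_mul H1 H2 s1 s2.
Qed.

Lemma conj_diff_mem (B : {group gT}) y r v : y \in 'N(B) -> r \in B -> v \in B ->
  y ^ r * (y ^ v)^-1 \in B.
Proof.
move=> nBy Br Bv; have H w : w \in B -> y ^ w * y^-1 \in B.
  move=> Bw; have -> : y ^ w * y^-1 = w^-1 * w ^ y^-1 by rewrite !conjgE invgK !mulgA.
  by rewrite groupM ?groupV // memJ_norm ?groupV.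
have -> : y ^ r * (y ^ v)^-1 = (y ^ r * y^-1) * (y ^ v * y^-1)^-1.
  by rewrite [(y ^ v * y^-1)^-1]invMg invgK mulgA mulgKV.
by rewrite groupM ?groupV ?H.
Qed.

Variable x : gT.
Hypothesis ox : #[x] = p.
Let N := 'N(<[x]>)%G.

Lemma conj_order_p z : #[z] = p -> exists2 h, z \in <[x]> :^ h & <[z]> = <[x]> :^ h.
Proof.
move=> oz; have px := order_p_elt p_pr ox; have pz := order_p_elt p_pr oz.
have [P sylP sxP] := Sylow_superset (subsetT <[x]>) px.
have [k _ szP] := Sylow_Jsub sylP (subsetT <[z]>) pz.
have cycP := cycp (pHall_pgroup sylP).
have eqz : <[z]> :^ k = <[x]>.
  apply/eqP; rewrite (eq_subG_cyclic (G := P)) //.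
  by rewrite cardJg -!/#[_] ox oz.
exists k^-1; last by rewrite -eqz conjsgK.
by rewrite -eqz conjsgK cycle_id.
Qed.

(** * The factorization of the group as A N B *)

Section Factorization.
Variables (pi : nat_pred) (A B : {group gT}).
Hypotheses (piA : pi.-group A) (pi'B : pi^'.-group B) (p'A : p^'.-group A) (p'B : p^'.-group B).
Hypotheses (nAx : x \in 'N(A)) (nBx : x \in 'N(B)).

Let Nx y : y \in <[x]> -> y \in 'N(A) /\ y \in 'N(B).
Proof.
move=> Xy; have sA : <[x]> \subset 'N(A) by rewrite cycle_subG.
have sB : <[x]> \subset 'N(B) by rewrite cycle_subG.
by rewrite (subsetP sA) ?(subsetP sB).
Qed.

(** [x] and [x ^ a] differ by an element of [A], and [x ^ a] and [y'] by an element of a conjugate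
    of [B]; so [x] is similar to [y'] in [<[x]>], hence equal to it. Then [x * u^-1] is both a [pi]-
    and a [pi']-element, and [a] centralizes [x]. *)
Lemma fibre a b n n' : a \in A -> b \in B -> n \in N -> n' \in N -> a * n = n' * b ->
  a \in N /\ b \in N.
Proof.
move=> Aa Bb Nn Nn' E; pose u := x ^ a.
have defa : a = n' * b * n^-1 by rewrite -E mulgK.
have Xx := cycle_id x.
pose y := x ^ n'; have Xy : y \in <[x]> by rewrite memJ_norm.
pose y' := y ^ n^-1; have Xy' : y' \in <[x]> by rewrite memJ_norm ?groupV.
have defu : u = (y ^ b) ^ n^-1 by rewrite /u defa !conjgM.
have Axu : x * u^-1 \in A.
  by rewrite -{1}[x]conjg1 conj_diff_mem.
have Buy : u * y'^-1 \in B :^ n^-1.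
  rewrite defu /y' -conjVg -conjMg memJ_conjg -{2}[y]conjg1 conj_diff_mem //.
  by case: (Nx Xy).
have sxu : sim x u := mem_p_elt p'A Axu.
have bBn : pi^'.-group (B :^ n^-1) by rewrite pgroupJ.
have suy : sim u y' by apply: (mem_p_elt (G := B :^ n^-1)) Buy; rewrite pgroupJ.
have oy' : #[y'] = p by rewrite !orderJ.
have sxy : sim x y' by apply: sim_trans_pi (mem_p_elt piA Axu) (mem_p_elt bBn Buy) sxu suy.
have eqy : x = y'.
  apply: (sim_uniq (u := x) (v := x)) => //; rewrite /sim mulgV.
  by rewrite /p_elt order1.
have ux : u = x.
  apply/esym/eqP; rewrite eq_mulgV1; apply/eqP.
  apply: (pi'_elt_pgroup1 (pi := pi) (G := A)) => //.
  rewrite -p_eltV [(x * u^-1)^-1]invMg invgK.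
  by have := mem_p_elt bBn Buy; rewrite -eqy.
have Na : a \in N.
  by rewrite (subsetP (cent_sub _)) // cent_cycle; apply/cent1P/commute_sym/commgP/conjg_fixP.
by split=> //; rewrite -(groupMl _ Nn') -E groupM.
Qed.

Hypothesis big : #|[set: gT] : N| <= #|A : A :&: N| * #|B : B :&: N|.

Lemma factorization g : exists a n b, [/\ a \in A, n \in N, b \in B & g = a * n * b].
Proof.
pose F (t : {set gT} * gT * {set gT}) := (repr t.1.1)^-1 * t.1.2 * repr t.2.
pose D := setX (setX (rcosets (A :&: N) A) N) (rcosets (B :&: N) B).
have reprP (K : {group gT}) C : C \in rcosets (K :&: N) K -> repr C \in K /\ C = (K :&: N) :*
  repr C.
  case/rcosetsP=> k Kk ->; split; last by rewrite rcoset_repr.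
  by case: repr_rcosetP => h /setIP[Kh _]; rewrite groupM.
have injF : {in D &, injective F}.
  move=> [[C n] E] [[C' n'] E'] /setXP[/setXP[/= AC Nn] BE] /setXP[/setXP[/= AC' Nn'] BE'].
  rewrite /F /= => eqF.
  have [Ac defC] := reprP A C AC; have [Ac' defC'] := reprP A C' AC'.
  have [Be defE] := reprP B E BE; have [Be' defE'] := reprP B E' BE'.
  have eq1 : (repr C' * (repr C)^-1) * n = n' * (repr E' * (repr E)^-1).
    have E0 : repr C' * ((repr C)^-1 * n * repr E) = n' * repr E'.
      by rewrite eqF !mulgA mulgV mul1g.
    apply: (mulIg (repr E)).
    have -> : n' * (repr E' * (repr E)^-1) * repr E = n' * repr E' by rewrite mulgA mulgKV.
    by rewrite -E0 !mulgA.
  have [||Nc Ne] := fibre _ _ Nn Nn' eq1; rewrite ?groupM ?groupV //.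
  have eqC : C = C'.
    rewrite defC defC'; apply/esym/rcoset_eqP; rewrite mem_rcoset inE Nc.
    by rewrite groupM ?groupV.
  have eqE : E = E'.
    rewrite defE defE'; apply/esym/rcoset_eqP; rewrite mem_rcoset inE Ne.
    by rewrite groupM ?groupV.
  move: eqF; rewrite eqC eqE => /mulIg/mulgI->.
  by [].
have : F @: D = setT.
  apply/eqP; rewrite eqEcard subsetT (card_in_imset injF) !cardsX -(Lagrange (subsetT N)).
  by rewrite /= [X in (_ <= X)%N]mulnAC [X in (_ <= X)%N]mulnC leq_mul2l [X in _ || X]big orbT.
move/setP/(_ g); rewrite inE => /imsetP[[[C n] E] /setXP[/setXP[/= AC Nn] BE] ->].
exists (repr C)^-1, n, (repr E); rewrite groupV.
by have [-> _] := reprP A C AC; have [-> _] := reprP B E BE.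
Qed.

End Factorization.

(** * Families of conjugates under [A] and under [B] *)

Section Meet.
Variables (pi : nat_pred) (A B : {group gT}).
Hypotheses (piA : pi.-group A) (pi'B : pi^'.-group B) (p'A : p^'.-group A) (p'B : p^'.-group B).
Hypotheses (nAx : x \in 'N(A)) (nBx : x \in 'N(B)).
Hypothesis fact : forall g, exists a n b, [/\ a \in A, n \in N, b \in B & g = a * n * b].

Let XA : <[x]> \subset 'N(A). Proof. by rewrite cycle_subG. Qed.
Let XB : <[x]> \subset 'N(B). Proof. by rewrite cycle_subG. Qed.

Lemma meet y g h : y \in <[x]> -> #[y] = p -> exists v w y2,
  [/\ v \in B, w \in A, y2 \in <[x]> /\ #[y2] = p & y ^ (v * g) = y2 ^ (w * h)].
Proof.
move=> Xy oy; have [a [n [b [Aa Nn Bb E]]]] := fact (h * g^-1).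
have Xy2 : y ^ n^-1 \in <[x]> by rewrite memJ_norm ?groupV.
exists b; exists a^-1; exists (y ^ n^-1); split; rewrite ?groupV //; first by rewrite orderJ.
rewrite -conjgM; congr (y ^ _).
have -> : h = a * n * b * g by rewrite -E mulgKV.
by rewrite -!mulgA !mulKg.
Qed.

Lemma sim_conjB y g r v : y \in <[x]> -> r \in B -> v \in B ->
  pi^'.-elt (y ^ (r * g) * (y ^ (v * g))^-1) /\ sim (y ^ (r * g)) (y ^ (v * g)).
Proof.
move=> Xy Br Bv; rewrite /sim !conjgM -conjVg -conjMg !p_eltJ.
have BB : y ^ r * (y ^ v)^-1 \in B by rewrite conj_diff_mem // (subsetP XB).
by rewrite (mem_p_elt pi'B) ?(mem_p_elt p'B).
Qed.

Lemma sim_conjA y g r v : y \in <[x]> -> r \in A -> v \in A ->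
  pi.-elt (y ^ (r * g) * (y ^ (v * g))^-1) /\ sim (y ^ (r * g)) (y ^ (v * g)).
Proof.
move=> Xy Br Bv; rewrite /sim !conjgM -conjVg -conjMg !p_eltJ.
have BB : y ^ r * (y ^ v)^-1 \in A by rewrite conj_diff_mem // (subsetP XA).
by rewrite (mem_p_elt piA) ?(mem_p_elt p'A).
Qed.

(** [z'] is the element [y2 ^ h] supplied by [meet], with [<[x]> :^ h = <[z]>]. A step in [B] leads
    from [y ^ (r * g)] to [y ^ (v * g) = y2 ^ (w * h)], a step in [A] from there to [z'], and
    [sim_trans_pi] composes them. *)
Lemma sim_uniform y g z : y \in <[x]> -> #[y] = p -> #[z] = p ->
  exists z', [/\ z' \in <[z]>, #[z'] = p & {in B, forall r, sim (y ^ (r * g)) z'}].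
Proof.
move=> Xy oy oz; have [h _ eqz] := conj_order_p oz.
have [v [w [y2 [Bv Aw [Xy2 oy2] E]]]] := meet g h Xy oy.
exists (y2 ^ h); rewrite orderJ eqz memJ_conjg; split=> // r Br.
have [e1 s1] := sim_conjB g Xy Br Bv.
have [e2 s2] := sim_conjA h Xy2 Aw (group1 A).
rewrite E in e1 s1; rewrite mul1g in e2 s2.
by apply: (sim_trans_pi (pi := pi^') e1 _ s1 s2); rewrite p_eltNK.
Qed.

End Meet.

End Similarity.

(** * Thompson's two-generator theorem *)

Section MinSimpleFinal.
Variable gT : finGroupType.
Hypothesis solP : forall H : {group gT}, H :!=: [set: gT] -> solvable H.
Hypothesis nsolG : ~~ solvable [set: gT].
Hypothesis simpleG : forall N : {group gT}, N <| [set: gT] -> N :!=: 1 -> N :=: [set: gT].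
Hypothesis sol2 : forall x y : gT, solvable <<[set x; y]>>.

Let G := [set: gT]%G.

Lemma der1_min_simple : G^`(1) = G.
Proof.
apply: simpleG (der_normal 1 G) _; apply: contraNneq nsolG => /derG1P.
exact: abelian_sol.
Qed.

Section MaxPrime.
Variables (p : nat) (x : gT).
Hypotheses (p_pr : prime p) (p_gt3 : 3 < p) (ox : #[x] = p).
Hypothesis cycp : forall r (S : {group gT}), 3 < r -> r.-group S -> cyclic S.
Hypothesis maxp : forall r, prime r -> r %| #|G| -> r <= p.

Let N := 'N(<[x]>)%G.
Let cyp (S : {group gT}) : p.-group S -> cyclic S. Proof. exact: cycp. Qed.
Let px : p.-elt x. Proof. exact: order_p_elt. Qed.
Let ntx : x != 1. Proof. by rewrite -order_gt1 ox prime_gt1. Qed.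

(** For [r < p], [P = <[g]>] lies in the pair of [x] and [g]. An [x]-invariant Sylow [r]-subgroup of
    its [p']-core is cyclic, hence centralized by [x], and [order_p_normsub] then gives
    ['N_X(<[x]>)] the full [r]-part. *)
Lemma part_norm r : prime r -> 3 < r -> #|G|`_r %| #|N|.
Proof.
move=> r_pr r_gt3; have [->|npr] := eqVneq r p.
  have [P sylP sxP] := Sylow_superset (subsetT <[x]>) px.
  rewrite -(card_Hall sylP) cardSg // cents_norm // (subset_trans (cyclic_abelian (cyp
    (pHall_pgroup sylP)))) //.
  exact: centS.
have [P sylP] := Sylow_exists r G; have [_ rP _] := and3P sylP.
rewrite -(card_Hall sylP).
have [-> | ntP] := eqsVneq P 1; first by rewrite cards1 dvd1n.
have [_ rdvd _] := pgroup_pdiv rP ntP.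
have ltrp : r < p by rewrite ltn_neqAle npr maxp // (dvdn_trans rdvd) ?cardSg ?subsetT.
have /cyclicP[g defP] := cycp r_gt3 rP.
pose X := <<[set x; g]>>%G; have solX : solvable X := sol2 x g.
have Xx : x \in X by rewrite mem_gen ?set21.
have sPX : P \subset X by rewrite defP cycle_subG mem_gen ?set22.
have p'K : p^'.-group 'O_p^'(X) := pcore_pgroup _ _.
have nKx : <[x]> \subset 'N('O_p^'(X)) by rewrite cycle_subG (subsetP (gFnorm _ X)).
have [|R sylR nRx] := sol_coprime_Sylow_exists r (abelian_sol (cycle_abelian x)) nKx.
  by rewrite coprime_sym (pnat_coprime px).
have [sRK rR _] := and3P sylR.
have cRx : <[x]> \subset 'C(R) by apply: (cent_cyclic_pgroup r_pr p_pr ltrp rR (cycp r_gt3 rR) px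
  nRx).
have sylRN : r.-Sylow('N_('O_p^'(X))(<[x]>)) R.
  apply: (pHall_subl _ _ sylR); rewrite ?subsetIl // subsetI sRK.
  by rewrite cents_norm // centsC.
have := order_p_normsub p_pr cyp solX Xx ox sylR.
rewrite -(card_Hall sylRN) mulnC => /eqP; rewrite eqn_pmul2l ?cardG_gt0 // => /eqP eqX.
rewrite -(part_pnat_id rP) (dvdn_trans (partn_dvd _ _ (cardSg sPX))) ?cardG_gt0 // eqX.
by rewrite (dvdn_trans (dvdn_part _ _)) // cardSg ?subsetIr.
Qed.

Lemma index_norm : (#|G : N| = #|G : N|`_2 * #|G : N|`_3)%N.
Proof.
rewrite -[LHS](partnC 2 (indexg_gt0 _ _)); congr (_ * _)%N.
apply: eq_in_partn => q; rewrite mem_primes => /and3P[q_pr _ qdvd].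
rewrite !inE; apply/idP/idP => [nq2|/eqP->] //; apply/eqP.
have [q_gt3|] := ltnP 3 q; last by case: q q_pr nq2 {qdvd} => [|[|[|[|]]]].
have := part_norm q_pr q_gt3; rewrite -(Lagrange (subsetT N)) partnM ?cardG_gt0 //.
move/(partn_dvd q (cardG_gt0 N)); rewrite partnM ?part_gt0 // !(part_pnat_id (part_pnat _ _)).
move/(dvdn_leq (part_gt0 _ _)); rewrite -{2}[(#|N|`_q)%N]muln1 leq_pmul2l ?part_gt0 //.
by rewrite leqNgt p_part_gt1 mem_primes q_pr indexg_gt0 qdvd.
Qed.

(** Once similarity is transitive, each [g] raises the class of [x] to a power. Powers commute, so
    the stabilizer [H] of this class contains the derived subgroup, which is everything; for [n] in
    [N], [x ^ n] is similar, hence equal, to [x]. *)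
Lemma centralizer_x_norm : N \subset 'C(<[x]>).
Proof.
have [A [A3 nAx leA]] := @big_pgroup gT solP nsolG simpleG sol2 p x p_pr p_gt3 ox cyp 3 isT isT.
have [B [B2 nBx leB]] := @big_pgroup gT solP nsolG simpleG sol2 p x p_pr p_gt3 ox cyp 2 isT isT.
have sub q (K : {group gT}) : prime q -> q <= 3 -> q.-group K -> p^'.-group K.
  move=> q_pr q3; apply: sub_pgroup => r; rewrite !inE => /eqP->.
  by rewrite neq_ltn (leq_ltn_trans q3).
have p'A : p^'.-group A by apply: (sub 3).
have p'B : p^'.-group B by apply: (sub 2).
pose pi : nat_pred := 3.
have B3' : pi^'.-group B by apply: sub_pgroup B2 => r; rewrite !inE => /eqP->.
have big : #|G : N| <= #|A : A :&: N| * #|B : B :&: N| by rewrite index_norm mulnC leq_mul.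
have fAB := factorization p_pr cyp sol2 ox A3 B3' p'A p'B nAx nBx big.
have fBA g : exists a n b, [/\ a \in B, n \in N, b \in A & g = a * n * b].
  have [a [n [b [Aa Nn Bb E]]]] := fAB g^-1.
  exists b^-1, n^-1, a^-1; rewrite !groupV; split=> //.
  by rewrite -[g]invgK E !invMg mulgA.
have A3'' : pi^'^'.-group A by rewrite pgroupNK.
(* [e] lies in a [B]-family through [u] and an [A]-family ending in [<[w]>]. By [sim_uniform] the
   first is similar to one element of [<[y]>] and one of [<[w]>], namely [y] and [w]; so [e] is
   similar to both. Hence the second family passes through [w], and its common partner in [<[y]>] is
   [y]. *)
have strans (y u w : gT) : #[y] = p -> #[u] = p -> #[w] = p -> sim p y u -> sim p u w -> sim p y w.
  move=> oy ou ow syu suw.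
  have [g Xu _] := conj_order_p p_pr cyp ox ou; have [h Xw eqW] := conj_order_p p_pr cyp ox ow.
  pose y1 := u ^ g^-1; have Xy1 : y1 \in <[x]> by rewrite -mem_conjg.
  have oy1 : #[y1] = p by rewrite orderJ.
  have defu : u = y1 ^ g by rewrite conjgKV.
  have [v [a [y2 [Bv Aa [Xy2 oy2] E]]]] := meet fAB g h Xy1 oy1.
  pose e := y1 ^ (v * g); have oe : #[e] = p by rewrite orderJ.
  have [y' [Yy' oy' simy]] := sim_uniform p_pr cyp sol2 ox A3 B3' p'A p'B nAx nBx fAB g Xy1 oy1 oy.
  have suy' : sim p u y' by have := simy 1 (group1 _); rewrite mul1g -defu.
  have eqy : y' = y.
    by apply: (sim_uniq p_pr cyp sol2 (u := u) (v := y)) => //; rewrite ?cycle_id // sim_sym.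
  have sey : sim p e y by rewrite -{1}eqy; apply: simy.
  have [w' [Ww' ow' simw]] := sim_uniform p_pr cyp sol2 ox A3 B3' p'A p'B nAx nBx fAB g Xy1 oy1 ow.
  have suw' : sim p u w' by have := simw 1 (group1 _); rewrite mul1g -defu.
  have eqw : w' = w.
    by apply: (sim_uniq p_pr cyp sol2 (u := u) (v := w)) => //; rewrite ?cycle_id.
  have sew : sim p e w by rewrite -{1}eqw; apply: simw.
  have [_ sey2] := sim_conjA A3 p'A nAx h Xy2 Aa (group1 A).
  rewrite -E mul1g in sey2.
  have Ww2 : y2 ^ h \in <[w]> by rewrite eqW memJ_conjg.
  have eqw2 : y2 ^ h = w.
    by apply: (sim_uniq p_pr cyp sol2 (u := e) (v := w)) => //; rewrite ?cycle_id ?orderJ.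
  have [y3 [Yy3 oy3 simy3]] := sim_uniform p_pr cyp sol2 ox B3' A3'' p'B p'A nBx nAx fBA h Xy2
    oy2 oy.
  have sey3 : sim p e y3 by rewrite /e E; apply: simy3.
  have eqy3 : y3 = y.
    by apply: (sim_uniq p_pr cyp sol2 (u := e) (v := y)) => //; rewrite ?cycle_id.
  by have := simy3 1 (group1 _); rewrite mul1g eqw2 eqy3 sim_sym.
have srefl (u : gT) : sim p u u by rewrite /sim mulgV /p_elt order1.
have oJ g : #[x ^ g] = p by rewrite orderJ.
pose H := [set g | sim p (x ^ g) x].
have gH : group_set H.
  apply/group_setP; split; first by rewrite inE conjg1.
  move=> g h /[!inE] sg sh; apply: (strans _ (x ^ h)) => //.
  by rewrite conjgM simJ.
have comH g h : g * h * (h * g)^-1 \in H.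
  have key a : exists i, #[x ^+ i] = p /\ sim p (x ^ a) (x ^+ i).
    have [v /cycleP[i ->] [ov sv]] := sim_exists p_pr cyp sol2 (oJ a) ox.
    by exists i.
  have [i [oi si]] := key g; have [j [oj sj]] := key h.
  have oij : #[x ^+ i ^+ j] = p.
    apply: (mem_order_p p_pr oi (mem_cycle _ _)).
    apply: contraTneq (prime_gt1 p_pr) => /eqP; rewrite -order_dvdn oi -ox order_dvdn => /eqP xj1.
    by rewrite ox -oj xj1 order1.
  have xij : x ^+ i ^+ j = x ^+ j ^+ i by rewrite -!expgM mulnC.
  have sgh : sim p (x ^ (g * h)) (x ^+ i ^+ j).
    apply: (strans _ ((x ^ h) ^+ i)); rewrite ?oJ -?conjXg ?orderJ //.
      by rewrite conjgM simJ.
    by rewrite conjXg xij; apply: (simX p_pr cyp sol2); rewrite -?conjXg ?orderJ -?xij.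
  have shg : sim p (x ^ (h * g)) (x ^+ i ^+ j).
    apply: (strans _ ((x ^ g) ^+ j)); rewrite ?oJ -?conjXg ?orderJ //.
      by rewrite conjgM simJ.
    by rewrite conjXg; apply: (simX p_pr cyp sol2); rewrite -?conjXg ?orderJ.
  rewrite inE -(simJ _ _ _ (h * g)) -conjgM mulgKV.
  by apply: (strans _ _ _ _ _ _ sgh); rewrite // sim_sym.
have HT : Group gH = G.
  apply/group_inj/eqP; rewrite eqEsubset subsetT /=.
  have <- : G^`(1) = [set: gT] by apply: der1_min_simple.
  rewrite derg1 (gen_subG _ (Group gH)).
  apply/subsetP=> _ /imset2P[g h _ _ ->].
  have -> : [~ g, h] = g^-1 * h^-1 * (h^-1 * g^-1)^-1 by rewrite invMg !invgK commgEl conjgE !mulgA.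
  exact: comH.
apply/subsetP=> n Nn; rewrite cent_cycle; apply/cent1P/commute_sym/commgP/conjg_fixP.
have : n \in Group gH by rewrite HT inE.
rewrite inE => sn; apply: (sim_uniq p_pr cyp sol2 (u := x) (v := x)) => //; rewrite ?cycle_id //.
  by rewrite memJ_norm ?cycle_id.
by rewrite sim_sym.
Qed.

Lemma max_prime_contra : False.
Proof.
have [P sylP sxP] := Sylow_superset (subsetT <[x]>) px.
have pP := pHall_pgroup sylP; have cycP := cyp pP.
have Px : x \in P by rewrite -cycle_subG.
have cPP : abelian (idm P @* P) by rewrite im_idm cyclic_abelian.
have sPG : P \subset G := subsetT P.
pose V := @transfer_morphism _ _ G P (idm_morphism P) cPP.
have Gx : x \in G by rewrite inE.
have Pxm : x \in idm P @* P by rewrite im_idm.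
(* Each factor of the transfer is a power of [x] conjugated into [P]. If nontrivial, it generates
   the only subgroup of order [p] of the cyclic group [P], so the conjugating element lies in [N],
   hence centralizes [x]. *)
have Vx : V x = FiniteModule.fmod cPP (x ^+ #|G : P|).
  have trX := transversalP (rcosets_cycle_partition sPG Gx).
  rewrite /= (transfer_cycle_expansion sPG cPP Gx trX).
  rewrite -(sum_index_rcosets_cycle sPG Gx trX) FiniteModule.fmodX //.
  rewrite -GRing.sumrMnr; apply: eq_bigr => y _.
  have := mulg_exp_card_rcosets P x y; set n := #|_ : _| => /=.
  rewrite mem_rcoset -{1}[y]invgK -mulgA -conjgE => Pxn.
  rewrite -FiniteModule.fmodX // -[LHS]/(FiniteModule.fmod cPP (x ^+ n ^ y^-1)).
  congr FiniteModule.fmod.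
  have [-> | nt] := eqVneq (x ^+ n) 1; first by rewrite conj1g.
  have Xt := mem_cycle x n; have ot := mem_order_p p_pr ox Xt nt.
  have eqX := cycle_order_p ox Xt ot.
  have Ny : y^-1 \in N.
    apply/normP/eqP; rewrite -eqX -cycleJ (eq_subG_cyclic cycP) ?cycle_subG ?groupX //.
    by rewrite -!/#[_] orderJ.
  have := subsetP centralizer_x_norm _ Ny; rewrite cent_cycle => /cent1P cyx.
  by apply/conjg_fixP/commgP/commute_sym/commuteX/commute_sym.
have V1 : V x = 1.
  have : x \in 'ker V; last by move/mker.
  have : G \subset 'ker V; last by move/subsetP; apply.
  rewrite -{1}der1_min_simple; apply: der1_min; first by rewrite normal_norm ?ker_normal.
  have [phi injphi _] := first_isom V.
  by rewrite -(injm_abelian injphi) ?FinRing.zmod_abelian.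
have : x ^+ #|G : P| = 1.
  have Pxn : x ^+ #|G : P| \in idm P @* P by rewrite im_idm groupX.
  by rewrite -(FiniteModule.fmodK cPP Pxn) -Vx V1.
move/eqP; rewrite -order_dvdn ox; apply/negP.
by have [_ _] := and3P sylP; rewrite p'natE.
Qed.

End MaxPrime.

Lemma min_simple_contra : False.
Proof.
have G_gt1 : 1 < #|G|.
  by rewrite cardG_gt1; apply: contraNneq nsolG => ->; apply: solvable1.
pose p := max_pdiv #|G|.
have p_pr : prime p by apply: max_pdiv_prime.
have maxp r : prime r -> r %| #|G| -> r <= p.
  by move=> r_pr rG; apply: max_pdiv_max; rewrite mem_primes r_pr rG cardG_gt0.
have [p_gt3|p_le3] := ltnP 3 p; last first.
  case/negP: nsolG; apply: (Burnside_p_a_q_b (G := G)).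
  rewrite -[2]/(size [:: 2; 3]) uniq_leq_size ?primes_uniq // => r.
  rewrite mem_primes => /and3P[r_pr _ rG]; have := leq_trans (maxp r r_pr rG) p_le3.
  by case: r r_pr {rG} => [|[|[|[|]]]].
have [x _ ox] := Cauchy p_pr (max_pdiv_dvd #|G|).
apply: (max_prime_contra p_pr p_gt3 ox) => // r S r_gt3 rS.
have [P sylP] := Sylow_exists r G.
have [k _ sS] := Sylow_Jsub sylP (subsetT S) rS.
rewrite -(cyclicJ _ k) (cyclicS sS) //.
exact: (min_simple_Sylow_cyclic solP nsolG simpleG sol2 r_gt3 sylP).
Qed.

End MinSimpleFinal.

Lemma solvable_setT_two_generator (gT : finGroupType) :
  (forall x y : gT, solvable <<[set x; y]>>) -> solvable [set: gT].
Proof.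
have [n] := ubnP #|gT|; elim: n => // n IHn in gT * => /ltnSE leTn sol2.
apply/idPn => nsolG.
have solP (H : {group gT}) : H :!=: [set: gT] -> solvable H.
  move=> ltH; rewrite -(im_sgval H) morphim_sol //.
  apply: IHn.
    rewrite -cardsT -(card_injm (injm_sgval H)) ?subsetT // im_sgval.
    by rewrite (leq_trans _ leTn) // -cardsT proper_card // properEneq ltH subsetT.
  move=> x y; rewrite -(injm_sol (injm_sgval H)) ?subsetT //.
  rewrite morphim_gen ?subsetT // morphimU !morphim_set1 ?inE //; exact: sol2.
apply: (min_simple_contra solP nsolG _ sol2) => N nsN ntN.
apply/eqP/idPn => neNT; case/negP: nsolG.
rewrite (series_sol nsN) (solP N neNT) /=.
rewrite quotientT; apply: IHn.
  rewrite -cardsT -quotientT (leq_trans _ leTn) // -cardsT.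
  by rewrite ltn_quotient ?subsetT.
have liftN (xb : coset_of N) : exists x, xb = coset N x by case: (cosetP xb) => x; exists x.
move=> xb yb; have [x ->] := liftN xb; have [y ->] := liftN yb.
have nNG z : z \in 'N(N) by rewrite (subsetP (normal_norm nsN)) ?inE.
rewrite -2?morphim_set1 ?nNG // -morphimU -morphim_gen ?morphim_sol //; first exact: sol2.
by apply/subsetP=> z _; apply: nNG.
Qed.

Theorem solvable_two_generator (gT : finGroupType) (G : {group gT}) :
  {in G &, forall x y, solvable <<[set x; y]>>} -> solvable G.
Proof.
move=> sol2; rewrite -(im_sgval G) morphim_sol //.
apply: solvable_setT_two_generator => x y.
rewrite -(injm_sol (injm_sgval G)) ?subsetT // morphim_gen ?subsetT //.
by rewrite morphimU !morphim_set1 ?inE //; apply: sol2; apply: subgP.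
Qed.

Require Import Defs.
From HB Require Import structures.
From mathcomp Require Import all_boot all_order fingroup nilpotent.
From mathcomp Require Import all_classical topology.

Local Open Scope classical_set_scope.
Local Open Scope group_scope.

(** * Profinite groups *)

Section HomImage.
Variables (K : groupType) (A : finGroupType) (f : K -> A).
Hypothesis fM : {morph f : x y / x * y}.

Lemma hom1 : f 1 = 1.
Proof. by apply: (mulgI (f 1)); rewrite -fM !mulg1. Qed.

Lemma homV x : f x^-1 = (f x)^-1.
Proof. by apply: (mulgI (f x)); rewrite -fM !mulgV hom1. Qed.

Definition hom_image : {set A} := [set a | `[< exists x, f x = a >]]%SET.

Lemma hom_imageP a : reflect (exists x, f x = a) (a \in hom_image).
Proof. by rewrite inE; apply: asboolP. Qed.

Lemma mem_hom_image x : f x \in hom_image.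
Proof. by apply/hom_imageP; exists x. Qed.

Lemma hom_image_group_set : group_set hom_image.
Proof.
apply/group_setP; split; first by rewrite -hom1 mem_hom_image.
by move=> _ _ /hom_imageP[x <-] /hom_imageP[y <-]; rewrite -fM mem_hom_image.
Qed.

Definition hom_image_group := Group hom_image_group_set.

End HomImage.

(** Inclusion of kernels makes [g] factor through [f], so the image of [g] is a homomorphic image of
    that of [f]. *)
Lemma hom_image_solvable (K : groupType) (A B : finGroupType) (f : K -> A) (g : K -> B)
    (fM : {morph f : x y / x * y}) (gM : {morph g : x y / x * y}) :
  (forall x, f x = 1 -> g x = 1) -> solvable (hom_image f) -> solvable (hom_image g).
Proof.
move=> kerfg solf.
have eqfg x y : f x = f y -> g x = g y.
  move=> eqf; have : g (x * y^-1) = 1 by apply: kerfg; rewrite fM (homV fM) eqf mulgV.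
  by rewrite gM (homV gM) => /(canRL (mulgK _)); rewrite mul1g invgK.
have [h hf] : {h : A -> B & forall a x, f x = a -> g x = h a}.
  apply: (@choice _ _ (fun a b => forall x, f x = a -> g x = b)) => a.
  case: (pselect (exists x, f x = a)) => [[x fx]|nx].
    by exists (g x) => y fy; apply: eqfg; rewrite fy.
  by exists 1 => y fy; case: nx; exists y.
have hM : {in hom_image f &, {morph h : a b / a * b}}.
  move=> _ _ /hom_imageP[x <-] /hom_imageP[y <-].
  by rewrite -fM -!(hf _ _ erefl) gM.
pose phi := @Morphism _ _ (hom_image_group fM) h hM.
have <- : (phi @* hom_image f)%g = hom_image g.
  apply/setP=> b; apply/morphimP/hom_imageP => [[a Aa _ ->] | [x <-]].
    by have [x <-] := hom_imageP _ _ Aa; exists x; rewrite (hf _ _ erefl).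
  by exists (f x); rewrite ?mem_hom_image // (hf _ _ erefl).
by apply: (morphim_sol phi (G := hom_image_group fM)).
Qed.

Lemma hom_image_solvableT (K : groupType) (A : finGroupType) (f : K -> A) :
  {morph f : x y / x * y} -> solvable [set: A]%SET -> solvable (hom_image f).
Proof. by move=> fM; apply: (solvableS (finset.subsetT (hom_image_group fM))). Qed.

(* The projections need not be surjective, so that closed subgroups inherit
   coordinates; completeness only concerns threads with components in the images. *)
Record coordinates (K : topGroupType) (S : inverse_system) (phi : forall i, K -> S i) : Prop :=
  Coordinates {
  coordM : forall i, {morph phi i : x y / x * y};
  coord_compat : forall i j (ij : (i <= j)%O) x, sys_map ij (phi j x) = phi i x;
  coord_open : forall i x, nbhs x [set y | phi i y = phi i x];
  coord_basis : forall x U, nbhs x U -> exists i, [set y | phi i y = phi i x] `<=` U;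
  coord_complete : forall h : (forall i, S i),
    (forall i j (ij : (i <= j)%O), sys_map ij (h j) = h i) ->
    (forall i, exists x, phi i x = h i) -> exists x, forall i, phi i x = h i;
  coord_inj : forall x y, (forall i, phi i x = phi i y) -> x = y
}.

Lemma subgroup_val_continuous (K : topGroupType) (H : subgroup K) :
  continuous (val : set_type H -> K).
Proof. exact: initial_continuous. Qed.

Lemma prod_eval_continuous (I : Type) (T : I -> topologicalType) (i : I) :
  continuous (fun x : prod_topology T => x i).
Proof.
move=> x U Ui; have /cvg_sup/(_ i) : nbhs x --> (x : prod_topology T) by exact: cvg_id.
by apply; exact: (@initial_continuous _ _ (fun f : prod_topology T => f i) x U Ui).
Qed.

Lemma inverse_limit_coordinates (S : inverse_system) :
  @coordinates (inverse_limit S) S (fun i x => val x i).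
Proof.
have compat i j (ij : (i <= j)%O) (x : inverse_limit S) : sys_map ij (val x j) = val x i.
  by have := valP x; rewrite inE; apply.
split=> //.
- move=> i x; have cval := @subgroup_val_continuous _ (Subgroup (@threads_group_closed S)) x.
  apply: (cval [set y | y i = val x i]).
  apply: (@prod_eval_continuous _ (fun i => discrete_topology (S i)) i (val x) [set val x i]).
  exact: discrete_set1.
- move=> x U [_ [[V oV <-] /= Vx VU]].
  pose B i := [set y : inverse_limit S | val y i = val x i].
  (* The topology is generated by single coordinates, so the basis property is read off a
     convergence: directedness makes the sets [B i] a filter base, and the filter converges in every
     coordinate. *)
  pose F := filter_from setT B.
  have FF : Filter F.
    apply: filter_from_filter.
      by case: (sys_nonempty S) => i; exists i.
    move=> i j _ _; have [k [ik jk]] := sys_directed i j; exists k => // y eqy.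
    split; rewrite /B /=; first by rewrite -(compat _ _ ik) eqy compat.
    by rewrite -(compat _ _ jk) eqy compat.
  have Fx : (val @ F) --> (val x : prod_topology _).
    apply/cvg_sup => i U' [_ [[V' oV' <-] /= V'x V'U]].
    by exists i => // y eqy; apply: V'U; rewrite /= eqy.
  have [i _ sub] := Fx V (open_nbhs_nbhs (conj oV Vx)).
  by exists i => y eqy; apply: VU; apply: sub.
- move=> h hc _; have hS : h \in @threads S by rewrite inE => i j ij; apply: hc.
  by exists (exist _ h hS).
- move=> x y exy; apply: val_inj; exact: functional_extensionality_dep.
Qed.

Lemma isog_coordinates (K L : topGroupType) (S : inverse_system) (phi : forall i, L -> S i) :
  topgroup_isog K L -> coordinates phi -> exists psi : forall i, K -> S i, coordinates psi.
Proof.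
move=> [f [g [fM fK gK cf cg]]] cphi; exists (fun i x => phi i (f x)); split.
- by move=> i x y; rewrite fM (coordM cphi).
- by move=> i j ij x; rewrite (coord_compat cphi).
- by move=> i x; have := cf x _ (coord_open cphi i (f x)).
- move=> x U Ux; have : nbhs (f x) (g @^-1` U) by apply: (cg (f x)); rewrite fK.
  move/(coord_basis cphi) => [i sub]; exists i => y /= eqy.
  by rewrite -(fK y); apply: sub.
- move=> h hc hl; have [i|y hy] := coord_complete cphi hc.
    by have [x <-] := hl i; exists (f x).
  by exists (g y) => i; rewrite gK.
by move=> x y eqxy; rewrite -(fK x) -(fK y); congr g; apply: (coord_inj cphi).
Qed.

Lemma sub_coordinates (K : topGroupType) (S : inverse_system) (phi : forall i, K -> S i)
    (H : subgroup K) : closed (subgroup_set H) -> coordinates phi ->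
  @coordinates (set_type H) S (fun i x => phi i (val x)).
Proof.
move=> clH cphi; split.
- by move=> i x y; rewrite -(coordM cphi).
- by move=> i j ij x; rewrite (coord_compat cphi).
- by move=> i x; apply: (@subgroup_val_continuous K H x _ (coord_open cphi i (val x))).
- move=> x U [_ [[V oV <-] /= Vx VU]].
  have /(coord_basis cphi)[i sub] : nbhs (val x) V by apply: open_nbhs_nbhs.
  by exists i => y eqy; apply: VU; apply: sub.
- move=> h hc hl; have [i|y hy] := coord_complete cphi hc.
    by have [x <-] := hl i; exists (val x).
  (* The thread lifts to a point [y] of [K]; each neighbourhood of [y] meets [H], and closedness
     puts [y] in [H]. *)
  suff Hy : y \in subgroup_set H by exists (exist _ y Hy).
  rewrite inE; apply: clH => U /(coord_basis cphi)[i sub].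
  have [x hx] := hl i; exists (val x); split; first by have := valP x; rewrite inE.
  by apply: sub => /=; rewrite hx hy.
by move=> x y eqxy; apply: val_inj; apply: (coord_inj cphi).
Qed.

Lemma coordinates_isog (K : topGroupType) (S : inverse_system) (phi : forall i, K -> S i) :
  coordinates phi -> (forall i a, exists x, phi i x = a) -> topgroup_isog K (inverse_limit S).
Proof.
move=> cphi surj; have cL := inverse_limit_coordinates S.
have thr x : (fun i => phi i x : discrete_topology (S i)) \in @threads S.
  by rewrite inE => i j ij; apply: (coord_compat cphi).
pose f x : inverse_limit S := exist (fun y => y \in @threads S) _ (thr x).
have [g gP] : {g : inverse_limit S -> K & forall l i, phi i (g l) = val l i}.
  apply: (@choice _ _ (fun (l : inverse_limit S) y => forall i, phi i y = val l i)) => l.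
  apply: (coord_complete cphi (h := fun i => val l i)) => // i j ij.
  exact: (coord_compat cL).
exists f, g; split.
- move=> x y; apply: (coord_inj cL) => i; exact: (coordM cphi).
- by move=> x; apply: (coord_inj cphi) => i; rewrite gP.
- by move=> l; apply: (coord_inj cL) => i; rewrite /= gP.
- move=> x U /(coord_basis cL)[i sub].
  apply: (@filterS _ (nbhs x)) (coord_open cphi i x) => y /= eqy; exact: sub.
- move=> l U /(coord_basis cphi)[i sub].
  apply: (@filterS _ (nbhs l)) (coord_open cL i l) => y /= eqy; apply: sub => /=.
  by rewrite !gP.
Qed.

Section ImageSystem.
Variables (K : topGroupType) (S : inverse_system) (phi : forall i, K -> S i).
Hypothesis cphi : coordinates phi.

Let Q i := hom_image_group (coordM cphi i).

Let image_map i j (ij : (i <= j)%O) (u : subg_of (Q j)) : subg_of (Q i) :=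
  subg (Q i) (sys_map ij (sgval u)).

Let image_mapE i j (ij : (i <= j)%O) (u : subg_of (Q j)) :
  sgval (image_map ij u) = sys_map ij (sgval u).
Proof.
rewrite subgK //; have /hom_imageP[x <-] := subgP u.
by rewrite (coord_compat cphi) mem_hom_image.
Qed.

Let image_mapM i j (ij : (i <= j)%O) : {morph image_map ij : x y / x * y}.
Proof.
by move=> u v; apply: subg_inj; rewrite sgvalM ?image_mapE ?sgvalM ?sys_mapM.
Qed.

Let image_map_id i (ii : (i <= i)%O) u : image_map ii u = u.
Proof. by apply: subg_inj; rewrite image_mapE sys_map_id. Qed.

Let image_map_comp i j k (ij : (i <= j)%O) (jk : (j <= k)%O) (ik : (i <= k)%O) u :
  image_map ij (image_map jk u) = image_map ik u.
Proof. by apply: subg_inj; rewrite !image_mapE (sys_map_comp ij jk ik). Qed.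

(** Shrinking each group to the image of [K] makes the coordinates surjective, and solvability then
    has to be known for the images only. *)
Definition image_system : inverse_system :=
  @InverseSystem _ (sys_index S) (sys_nonempty S) (@sys_directed S)
    (fun i => subg_of (Q i)) image_map image_mapM image_map_id image_map_comp.

Lemma image_system_isog : topgroup_isog K (inverse_limit image_system).
Proof.
pose psi (i : sys_index image_system) (x : K) : image_system i := subg (Q i) (phi i x).
have psiE i x : sgval (psi i x) = phi i x by rewrite subgK // mem_hom_image.
have psi_eq i x y : (psi i x = psi i y) = (phi i x = phi i y).
  by apply: propext; split=> [|eqxy]; [rewrite -2!psiE => -> | apply: subg_inj; rewrite !psiE].
apply: (@coordinates_isog _ _ psi); last first.
  by move=> i a; have /hom_imageP[x phix] := subgP a; exists x; apply: subg_inj; rewrite psiE.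
split.
- move=> i x y; apply: subg_inj; apply: etrans (psiE i (x * y)) _.
  by rewrite (coordM cphi) -(psiE i x) -(psiE i y); apply/esym/sgvalM.
- by move=> i j ij x; apply: subg_inj; rewrite image_mapE !psiE (coord_compat cphi).
- move=> i x; rewrite (_ : [set y | _] = [set y | phi i y = phi i x]);
  first exact: (coord_open cphi).
  by apply/seteqP; split=> y /=; rewrite psi_eq.
- move=> x U /(coord_basis cphi)[i sub]; exists i => y /=; rewrite psi_eq; exact: sub.
- move=> h hc hl; have [i j ij||x hx] := coord_complete cphi (h := fun i => sgval (h i)).
  + by rewrite -(hc i j ij); apply/esym/image_mapE.
  + by move=> i; have [x <-] := hl i; exists x; rewrite psiE.
  by exists x => i; apply: subg_inj; rewrite psiE.
by move=> x y eqxy; apply: (coord_inj cphi) => i; rewrite -psi_eq.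
Qed.

Lemma coordinates_prosolvable : (forall i, solvable (hom_image (phi i))) -> prosolvable K.
Proof.
move=> solQ; exists image_system; split; last exact: image_system_isog.
by move=> i; rewrite -(injm_sol (injm_sgval (Q i))) ?finset.subsetT // im_sgval.
Qed.

End ImageSystem.

(** * Closed two-generator subgroups *)

Lemma generated_subgroup_closed (G : groupType) (A : set G) :
  group_closed (fun x => x \in generated_subgroup A).
Proof.
split; first by rewrite inE => B [[]]; rewrite inE.
move=> x y; rewrite !inE => Ax Ay B BA; have [[_ cB] _] := BA.
have := cB x y; rewrite !inE; apply; [exact: Ax | exact: Ay].
Qed.

Lemma closure_group_closed (G : topGroupType) (A : set G) :
  group_closed (fun x => x \in A) -> group_closed (fun x => x \in closure A).
Proof.
move=> [A1 cA]; split.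
  by rewrite inE; apply: subset_closure; rewrite -inE.
move=> x y; rewrite !inE => clx cly U Uxy.
have cdiv : continuous (fun z : G * G => z.1 / z.2).
  move=> z; apply: (@continuous_comp _ _ _ (fun z : G * G => (z.1, z.2^-1)) (fun z : G * G => z.1
    * z.2)); last exact: mulg_continuous.
  apply: cvg_pair; first exact: cvg_fst.
  apply: (@continuous_comp _ _ _ (fun z : G * G => z.2) (fun z : G => z^-1)); first exact: cvg_snd.
  exact: invg_continuous.
have [[V W] /= [Vx Wy] sub] := cdiv (x, y) U Uxy.
have [a [Aa Va]] := clx V Vx; have [b [Ab Wb]] := cly W Wy.
exists (a / b); split; last exact: (sub (a, b)).
by have := cA a b; rewrite !inE; apply.
Qed.

Theorem corollary5p28 (G : topGroupType) (profiniteG : profinite G) :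
  prosolvable G <->
  (forall H : subgroup G, closed_two_generator H -> prosolvable H).
Proof.
split=> [[S [solS isoG]] H [x [y defH]] | sol2].
  have [phi cphi] := isog_coordinates isoG (inverse_limit_coordinates S).
  have clH : closed (subgroup_set H) by rewrite defH; apply: closed_closure.
  apply: (coordinates_prosolvable (sub_coordinates clH cphi)) => i.
  exact: hom_image_solvableT (coordM (sub_coordinates clH cphi) i) (solS i).
have [S isoG] := profiniteG.
have [phi cphi] := isog_coordinates isoG (inverse_limit_coordinates S).
apply: (coordinates_prosolvable cphi) => i.
apply: (solvable_two_generator (G := hom_image_group (coordM cphi i))).
move=> _ _ /hom_imageP[x <-] /hom_imageP[y <-].
pose H := Subgroup (closure_group_closed (generated_subgroup_closed [set x; y])).
have clH : closed (subgroup_set H) by apply: closed_closure.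
have [|T [solT isoH]] := sol2 H; first by exists x, y.
have [psi cpsi] := isog_coordinates isoH (inverse_limit_coordinates T).
have cH := sub_coordinates clH cphi.
have [j kerj] := coord_basis cpsi (coord_open cH i 1).
have solH : solvable (hom_image (fun h : set_type H => phi i (val h))).
  apply: (hom_image_solvable (coordM cpsi j) (coordM cH i)); last first.
    exact: hom_image_solvableT (coordM cpsi j) (solT j).
  move=> h psih; have := kerj h; rewrite /= (hom1 (coordM cpsi j)) psih => /(_ erefl) ->.
  exact: (hom1 (coordM cphi i)).
apply: (@solvableS _ (hom_image_group (coordM cH i)) <<_>>%G _ solH);
  rewrite (gen_subG _ (hom_image_group (coordM cH i))).
have memH z : [set x; y] z -> z \in subgroup_set H.
  by move=> xyz; rewrite inE; apply: subset_closure => B [_]; apply.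
have Hx := memH x (or_introl erefl); have Hy := memH y (or_intror erefl).
apply/fintype.subsetP=> a; rewrite finset.in_set2 => /orP[] /eqP ->; apply/hom_imageP.
  by exists (exist _ x Hx).
by exists (exist _ y Hy).
Qed.
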